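(* Let $d,t\in\mathbb{N}$ and let $a\in C^1(\mathbb{T}^d)$ be a (complex-valued) diffusion coefficient with $\min_{\bm{x}\in\mathbb{T}^d}\mathrm{Re}(a(\bm{x}))\ge a_{\min}>0$ and Fourier expansion $a=\sum_{\bm{\nu}\in\mathbb{Z}^d}e_{\bm{\nu}}F_{\bm{\nu}}$, $e_{\bm{\nu}}=\langle a,F_{\bm{\nu}}\rangle$, with $e_{\bm 0}\in\mathbb{R}$ and $e_{\bm 0}\ge0$. Write $a=a_t+a^*$, where $$a_t=e_{\bm 0}+\sum_{\bm{\nu}\in T}e_{\bm{\nu}}F_{\bm{\nu}},\quad T\subset\mathbb{Z}^d\setminus\{\bm 0\},\ |T|\le t,\qquad a^*=a-a_t .$$ Let $\Lambda\subset\mathbb{Z}^d\setminus\{\bm 0\}$ be finite with $N=|\Lambda|$, and assume that $$\beta:=\sqrt{t\left(\|a_t\|_{H^1}^2-|e_{\bm 0}|^2\right)}<(\sqrt2-1)|e_{\bm 0}|,$$ $$\gamma:=\frac{\sqrt N}{2\pi}|a^*|_{H^1}+\|a^*\|_{L^2}<\sqrt{|e_{\bm 0}|^2-2|e_{\bm 0}|\beta-\beta^2}.$$ Then the system $\{\Phi_{\bm{\nu}}\}_{\bm{\nu}\in\Lambda}$, $\Phi_{\bm{\nu}}=-\nabla\cdot(a\nabla\Psi_{\bm{\nu}})$, is a bounded Riesz system with constants $$b_\Phi=\Big(\sqrt{|e_{\bm 0}|^2-2|e_{\bm 0}|\beta-\beta^2}-\gamma\Big)^2>0,\qquad B_\Phi=\Big(\sqrt{\|a_t\|_{H^1}^2+2|e_{\bm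 0}|\beta+\beta^2}+\gamma\Big)^2,$$ $$K_\Phi=|e_{\bm 0}|+\beta+\|a^*\|_{L^\infty}+\sum_{l=1}^d\Big\|\frac{\partial a^*}{\partial x_l}\Big\|_{L^\infty}.$$
   Context: $\mathbb{T}^d=(\mathbb{R}/\mathbb{Z})^d$; functions are complex-valued; $\langle u,v\rangle=\int_{\mathbb{T}^d}u\bar v\,\mathrm{d}\bm{x}$. $|v|_{H^1}^2=\int_{\mathbb{T}^d}\|\nabla v\|_2^2\,\mathrm{d}\bm{x}$ and $\|v\|_{H^1}^2=\|v\|_{L^2}^2+|v|_{H^1}^2$. $F_{\bm{\nu}}(\bm{x})=\exp(2\pi\mathrm{i}\,\bm{\nu}\cdot\bm{x})$ for $\bm{\nu}\in\mathbb{Z}^d$, and $\Psi_{\bm{\nu}}=\frac{1}{4\pi^2\|\bm{\nu}\|_2^2}F_{\bm{\nu}}$ for $\bm{\nu}\in\mathbb{Z}^d\setminus\{\bm 0\}$. Bounded Riesz system: a family $\{\Phi_{\bm{\nu}}\}_{\bm{\nu}\in\Lambda}\subset L^2(\mathbb{T}^d)$ is a Riesz system with constants $0<b_\Phi\le B_\Phi<\infty$ if $$b_\Phi\|\bm{z}\|_2^2\le\Big\|\sum_{\bm{\nu}\in\Lambda}z_{\bm{\nu}}\Phi_{\bm{\nu}}\Big\|_{L^2}^2\le B_\Phi\|\bm{z}\|_2^2\qquad\forall\,\bm{z}\in\ell^2(\Lambda;\mathbb{C}),$$ and it is bounded with constant $0<K_\Phi<\infty$ if $\|\Phi_{\bm{\nu}}\|_{L^\infty}\le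 K_\Phi$ for all $\bm{\nu}\in\Lambda$. *)

(* Defs.v *)
From HB Require Import structures.
From mathcomp Require Import all_boot all_order all_algebra finmap.
From mathcomp Require Import complex.
From mathcomp Require Import all_classical all_reals all_analysis.

Set Implicit Arguments.
Unset Strict Implicit.
Unset Printing Implicit Defensive.

Import Order.TTheory GRing.Theory Num.Theory.
Import numFieldNormedType.Exports.

Local Open Scope classical_set_scope.
Local Open Scope complex_scope.
Local Open Scope ring_scope.

Notation cabs := ComplexField.Normc.normc.

(* A function on T^d = (R/Z)^d is a function on R^d that is invariant under
   translation by Z^d. *)
Definition Zperiodic {R : realType} {d : nat} (u : 'rV[R]_d -> R[i]) : Prop :=
  forall (x : 'rV[R]_d) (k : 'rV[int]_d), u (x + map_mx intr k) = u x.

Section TorusMeasure.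
Context {R : realType}.

Definition tcons d (p : R * d.-tuple R) : d.+1.-tuple R :=
  [the d.+1.-tuple R of p.1 :: p.2].

Lemma measurable_tcons d :
  measurable_fun [set: measurableTypeR R * d.-tuple (measurableTypeR R)]
    (@tcons d : _ -> d.+1.-tuple (measurableTypeR R)).
Proof. exact: measurable_cons. Qed.

HB.instance Definition _ d := isMeasurableFun.Build _ _ _ _
  (@tcons d : measurableTypeR R * d.-tuple (measurableTypeR R) ->
              d.+1.-tuple (measurableTypeR R)) (@measurable_tcons d).

(* The Haar probability of T^d read on the fundamental domain [0, 1]^d: the
   d-fold product of the Lebesgue measure on [0, 1]. *)
Fixpoint torus_measure (d : nat) :
    probability (d.-tuple (measurableTypeR R)) R :=
  match d with
  | 0 => \d_ ([tuple] : 0.-tuple (measurableTypeR R))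
  | d'.+1 => distribution (uniform_prob (@ltr01 R) \x torus_measure d')%E
               (@tcons d')
  end.

End TorusMeasure.

Section TorusFunctions.
Context {R : realType} {d : nat}.
Implicit Types (u v : 'rV[R]_d -> R[i]) (nu : 'rV[int]_d).

Definition torus_pt (x : d.-tuple R) : 'rV[R]_d := \row_i tnth x i.

Local Notation mu := (@torus_measure R d).

Definition cintegral u : R[i] :=
  (\int[mu]_x complex.Re (u (torus_pt x))) +i*
  (\int[mu]_x complex.Im (u (torus_pt x))).

Definition inner u v : R[i] := cintegral (fun x => u x * (v x)^*).

Definition eLp_norm (p : \bar R) u : \bar R :=
  ('N[mu]_p[EFin \o (fun x => cabs (u (torus_pt x)))])%E.

Definition L2_norm u : R := fine (eLp_norm 2%:E u).
Definition Linf_norm u : R := fine (eLp_norm +oo u).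

Definition in_L2 u : Prop :=
  [/\ measurable_fun [set: d.-tuple (measurableTypeR R)]
        (fun x => complex.Re (u (torus_pt x))),
      measurable_fun [set: d.-tuple (measurableTypeR R)]
        (fun x => complex.Im (u (torus_pt x)))
    & (eLp_norm 2%:E u < +oo)%E].

Definition unit_vec (l : 'I_d) : 'rV[R]_d := delta_mx 0 l.

(* Real and imaginary parts are differentiated separately. *)
Definition partial (l : 'I_d) u : 'rV[R]_d -> R[i] := fun x =>
  ('D_(unit_vec l) (fun y => complex.Re (u y)) x) +i*
  ('D_(unit_vec l) (fun y => complex.Im (u y)) x).

Definition realC1 (f : 'rV[R]_d -> R) : Prop :=
  (forall x, differentiable f x) /\
  (forall l, continuous ('D_(unit_vec l) f)).

Definition torusC1 u : Prop :=
  [/\ Zperiodic u, realC1 (fun x => complex.Re (u x))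
    & realC1 (fun x => complex.Im (u x))].

Definition divergence (w : 'I_d -> 'rV[R]_d -> R[i]) : 'rV[R]_d -> R[i] :=
  fun x => \sum_(l < d) partial l (w l) x.

(* Only applied to C^1 functions, whose weak and classical gradients agree. *)
Definition H1_seminorm u : R :=
  Num.sqrt (\int[mu]_x \sum_(l < d) cabs (partial l u (torus_pt x)) ^+ 2).

Definition H1_norm u : R :=
  Num.sqrt (L2_norm u ^+ 2 + H1_seminorm u ^+ 2).

Definition dotZ nu (x : 'rV[R]_d) : R := \sum_(i < d) (nu 0 i)%:~R * x 0 i.

Definition sqnormZ nu : R := \sum_(i < d) (nu 0 i)%:~R ^+ 2.

Definition expi (t : R) : R[i] := cos t +i* sin t.

Definition fourier nu : 'rV[R]_d -> R[i] := fun x => expi (2 * pi * dotZ nu x).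

Definition Psi nu : 'rV[R]_d -> R[i] :=
  fun x => ((4 * pi ^+ 2 * sqnormZ nu)^-1)%:C * fourier nu x.

Definition fcoef u nu : R[i] := inner u (fourier nu).

Definition fourier_trunc (a : 'rV[R]_d -> R[i]) (T : {fset 'rV[int]_d}) :
    'rV[R]_d -> R[i] :=
  fun x => fcoef a 0 + \sum_(nu <- T) fcoef a nu * fourier nu x.

Definition diffusion (a : 'rV[R]_d -> R[i]) nu : 'rV[R]_d -> R[i] :=
  fun x => - divergence (fun l y => a y * partial l (Psi nu) y) x.

(* Since the index set is finite, l^2(L; C) is all of C^L; [z] is extended
   arbitrarily outside [L].  The inequalities are between extended reals, so
   that they cannot hold through the convention fine +oo = 0. *)
Definition riesz_system (L : {fset 'rV[int]_d})
    (Phi : 'rV[int]_d -> 'rV[R]_d -> R[i]) (b B : R) : Prop :=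
  [/\ 0 < b, b <= B, (forall nu, nu \in L -> in_L2 (Phi nu))
    & forall z : 'rV[int]_d -> R[i],
        let z2 := \sum_(nu <- L) cabs (z nu) ^+ 2 in
        let s := eLp_norm 2%:E (fun x => \sum_(nu <- L) z nu * Phi nu x) in
        ((b * z2)%:E <= s ^+ 2)%E /\ (s ^+ 2 <= (B * z2)%:E)%E].

Definition bounded_riesz_system (L : {fset 'rV[int]_d})
    (Phi : 'rV[int]_d -> 'rV[R]_d -> R[i]) (b B K : R) : Prop :=
  [/\ riesz_system L Phi b B, 0 < K
    & forall nu, nu \in L -> (eLp_norm +oo (Phi nu) <= K%:E)%E].

End TorusFunctions.

(* Main.v *)
(* Write kappa(mu, nu) = mu.nu / |nu|^2.  Then Phi_nu = sum_tau e_tau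
   kappa(tau + nu, nu) F_{tau + nu}.  Since |kappa(tau + nu, nu)| <= 1 + |tau|,
   Cauchy-Schwarz over T shows that the part of sum_nu z_nu Phi_nu coming from
   a_t differs from e_0 sum_nu z_nu F_nu by at most beta |z| in L^2; its norm
   thus lies between (e_0 - beta) |z| and (e_0 + beta) |z|.

   The part coming from a^* has norm at most gamma |z|.  Indeed its mu-th
   Fourier coefficient is sum_nu z_nu kappa(mu, nu) e_{mu - nu}, and one can
   split |kappa(mu, nu)| = k_nu + b_nu with
   sum_nu (k_nu / |mu - nu|)^2 <= N and sum_nu b_nu^2 <= 1.  Cauchy-Schwarz in
   each row, Minkowski over mu and Bessel for a^* and its partial derivatives
   then yield the two terms of gamma.  The splitting is a statement about
   lattice points: unless mu lies on a coordinate axis, the positive parts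
   ("excesses") of |kappa(mu, nu)| - |mu - nu| have square sum at most 1; and
   for mu = m eps with eps a unit vector, only eps and (m - 1) eps exceed.

   Completeness of the exponentials comes from a discrete Fejer-Korovkin
   argument: averaging u(j / m) against Fejer kernels over the grid (Z / m)^d
   gives trigonometric polynomials converging uniformly to u. *)

Require Import Defs.
From HB Require Import structures.
From mathcomp Require Import all_boot all_order all_algebra finmap.
From mathcomp Require Import complex.
From mathcomp Require Import all_classical all_reals all_analysis.
From mathcomp Require Import measurable_realfun derive realfun ess_sup_inf.
From mathcomp Require Import ring lra zify.

Set Implicit Arguments.
Unset Strict Implicit.
Unset Printing Implicit Defensive.

Import Order.TTheory GRing.Theory Num.Theory.
Import numFieldNormedType.Exports.

Local Open Scope ring_scope.

(** * Lattice points *)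

(** The obstacle is that the term [|a^*|] in gamma carries no factor [sqrt N]. The bound
    [|kappa(mu, nu)| <= 1 + |mu - nu|] would allow [k_nu = |mu - nu|] and [b_nu = 1], but then [b]
    has square sum [N]. So [b] must be square summable to 1 uniformly in [mu], in the index set and
    in [d]. The natural choice, [k = min(|kappa|, |mu - nu|)] with [b] the excess, achieves this
    unless [mu = m eps]: there [eps] alone has excess 1 and [(m - 1) eps] may add [1 / (m - 1)]. In
    that case [b] is raised at the second point and lowered at the first. The ratio [k / |mu - nu|]
    then falls below 1 at the second point, which pays for its slight excess over 1 at [eps]. For
    [|mu|^2 >= 24] every exceeding point is a unit vector or a neighbour of [mu]. For shorter [mu]
    the points are grouped by [(|nu|^2, |mu - nu|^2)] and each group is counted by a packing bound
    instead of being listed, so that one finite computation serves every dimension. *)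

Section IntegerVectors.
Context {d : nat}.
Implicit Types x y z mu nu : 'rV[int]_d.

Definition zdot x y : int := \sum_i x 0 i * y 0 i.

Lemma zdotC x y : zdot x y = zdot y x.
Proof. by apply: eq_bigr => i _; rewrite mulrC. Qed.

Lemma zdotDl x y z : zdot (x + y) z = zdot x z + zdot y z.
Proof. by rewrite -big_split; apply: eq_bigr => i _; rewrite mxE mulrDl. Qed.

Lemma zdotZl a x z : zdot (a *: x) z = a * zdot x z.
Proof. by rewrite mulr_sumr; apply: eq_bigr => i _; rewrite mxE mulrA. Qed.

Lemma zdotBl x y z : zdot (x - y) z = zdot x z - zdot y z.
Proof. by rewrite zdotDl -scaleN1r zdotZl mulN1r. Qed.

Lemma zdotZr a x z : zdot x (a *: z) = a * zdot x z.
Proof. by rewrite zdotC zdotZl zdotC. Qed.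

Lemma zdotBr x y z : zdot x (y - z) = zdot x y - zdot x z.
Proof. by rewrite zdotC zdotBl !(zdotC x). Qed.

Lemma zdot0l x : zdot 0 x = 0.
Proof. by rewrite /zdot big1// => i _; rewrite mxE mul0r. Qed.

Lemma zdot_suml I (r : seq I) (P : pred I) (F : I -> 'rV[int]_d) x :
  zdot (\sum_(i <- r | P i) F i) x = \sum_(i <- r | P i) zdot (F i) x.
Proof.
by elim/big_rec2: _ => [|i a b _ <-]; rewrite ?zdot0l// zdotDl.
Qed.

Lemma zdot_ge0 x : 0 <= zdot x x.
Proof. by apply: sumr_ge0 => i _; rewrite -expr2 sqr_ge0. Qed.

Lemma zdot_eq0 x : (zdot x x == 0) = (x == 0).
Proof.
apply/idP/eqP => [|->]; last by rewrite zdot0l.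
rewrite psumr_eq0 => [/allP h|i _]; last by rewrite -expr2 sqr_ge0.
apply/rowP => i; rewrite mxE.
by have := h i (mem_index_enum i); rewrite mulf_eq0 orbb => /eqP.
Qed.

Lemma zdot_gt0 x : (0 < zdot x x) = (x != 0).
Proof. by rewrite lt_def zdot_eq0 zdot_ge0 andbT. Qed.

Lemma zdot_sub x y : zdot (x - y) (x - y) = zdot x x + zdot y y - 2 * zdot x y.
Proof. by rewrite zdotBl !zdotBr (zdotC y x); ring. Qed.

Lemma zdot_cauchy x y : zdot x y ^+ 2 <= zdot x x * zdot y y.
Proof.
have [->|y0] := eqVneq y 0; first by rewrite zdotC !zdot0l mulr0 expr0n.
have := zdot_ge0 (zdot y y *: x - zdot x y *: y).
rewrite zdot_sub !zdotZl !zdotZr => h.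
rewrite -subr_ge0 -(@pmulr_rge0 _ (zdot y y)) ?zdot_gt0//.
by apply: le_trans h _; rewrite le_eqVlt; apply/orP; left; apply/eqP; ring.
Qed.

(** [|x - y|^2 = 2 (x.x - x.y)] is positive, and a positive integer is at least 1. *)
Lemma zdot_neq x y : zdot x x = zdot y y -> x != y -> zdot x y <= zdot x x - 1.
Proof.
move=> xy; rewrite -subr_eq0 -zdot_gt0 zdot_sub xy => h; lia.
Qed.

(** Cauchy-Schwarz for [mu] against the combination of [G] with weights [w], whose squared length is
    expanded into Gram entries. Upper bounds on these entries then control how many vectors lean
    towards [mu]. *)
Lemma zdot_bessel (G : seq 'rV[int]_d) (w : 'rV[int]_d -> int) mu :
  (\sum_(nu <- G) w nu * zdot nu mu) ^+ 2 <=
  (\sum_(nu <- G) \sum_(eta <- G) w nu * w eta * zdot nu eta) * zdot mu mu.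
Proof.
have := zdot_cauchy (\sum_(nu <- G) w nu *: nu) mu.
rewrite !zdot_suml.
under eq_bigr do rewrite zdotZl.
congr (_ ^+ 2 <= _ * _); apply: eq_bigr => nu _.
rewrite zdotC zdot_suml; apply: eq_bigr => eta _.
by rewrite zdotZl zdotZr (zdotC eta); ring.
Qed.

(* Distinct integer vectors of square length [n] have inner product at most
   [n - 1], so only few of them can lie in a small cap around [mu]. *)
Lemma packing (G : seq 'rV[int]_d) mu (n c : int) : uniq G ->
  {in G, forall nu, zdot nu nu = n /\ zdot nu mu = c} ->
  (size G)%:R * (c ^+ 2 - zdot mu mu * (n - 1)) <= zdot mu mu.
Proof.
move=> uG GP; set k : int := (size G)%:R.
have [->|kn0] := eqVneq k 0; first by rewrite mul0r zdot_ge0.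
have k0 : 0 < k by rewrite lt_def kn0 ler0n.
have sumk (a : int) : \sum_(nu <- G) a = k * a.
  by rewrite big_const_seq count_predT iter_addr_0 mulr_natl.
have := zdot_bessel G (fun=> 1) mu.
have -> : \sum_(nu <- G) 1 * zdot nu mu = k * c.
  rewrite -sumk; apply: eq_big_seq => nu nuG.
  by rewrite mul1r; have [] := GP _ nuG.
have h : \sum_(nu <- G) \sum_(eta <- G) 1 * 1 * zdot nu eta
    <= k * (1 + k * (n - 1)).
  rewrite -sumk big_seq [leRHS]big_seq; apply: ler_sum => nu nuG.
  apply: (@le_trans _ _ (\sum_(eta <- G) ((eta == nu)%:R + (n - 1)))).
    rewrite big_seq [leRHS]big_seq; apply: ler_sum => eta eG.
    have [nn _] := GP _ nuG; have [en _] := GP _ eG.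
    rewrite !mul1r; case: eqVneq => [->|ne]; first by rewrite nn; lia.
    by rewrite add0r zdotC -en zdot_neq ?nn.
  rewrite big_split /= sumk lerD2r -natr_sum -big_mkcond /= sum1_count.
  by rewrite count_uniq_mem// (ler_nat _ _ 1); case: (_ \in _).
move=> h2; have := le_trans h2 (ler_wpM2r (zdot_ge0 mu) h).
rewrite exprMn expr2 -!mulrA ler_pM2l// => h3.
by rewrite mulrBr lerBlDr; move: h3; congr (_ <= _); ring.
Qed.

(** Distinct integer unit vectors have inner product at most 0 by [zdot_neq], and the weights
    [zdot tau mu] are positive, so the off-diagonal Gram terms can only lower the sum. *)
Lemma unit_bessel (G : seq 'rV[int]_d) mu : uniq G ->
  {in G, forall tau, zdot tau tau = 1 /\ 0 < zdot tau mu} ->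
  \sum_(tau <- G) zdot tau mu ^+ 2 <= zdot mu mu.
Proof.
move=> uG GP; set S := (X in X <= _).
have S0 : 0 <= S by apply: sumr_ge0 => ? _; exact: sqr_ge0.
have [->|Sn0] := eqVneq S 0; first exact: zdot_ge0.
have Sgt0 : 0 < S by rewrite lt_def Sn0.
have := zdot_bessel G (zdot^~ mu) mu.
under eq_bigr do rewrite -expr2; rewrite -/S => h.
suff h2 : \sum_(nu <- G) \sum_(eta <- G) zdot nu mu * zdot eta mu * zdot nu eta
    <= S.
  by rewrite -(ler_pM2l Sgt0) -expr2 (le_trans h)// ler_wpM2r ?zdot_ge0.
rewrite big_seq [leRHS]big_seq; apply: ler_sum => nu nuG.
rewrite (bigD1_seq nu)//=; have [-> nu0] := GP _ nuG.
rewrite mulr1 -expr2 gerDl big_seq_cond; apply: sumr_le0 => eta /andP[eG ne].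
have [en eta0] := GP _ eG.
apply: mulr_ge0_le0; first by rewrite mulr_ge0 ?ltW.
have [nn _] := GP _ nuG.
have : zdot nu eta <= zdot nu nu - 1 by apply: zdot_neq; rewrite ?nn// eq_sym.
by rewrite nn subrr.
Qed.

End IntegerVectors.

(** * Short vectors: a finite check over classes of lattice points *)

Section ClassWeights.

(* [10 * Num.sqrt s] rounded down, for [s < 24]. *)
Definition sqrt10 (s : nat) : nat :=
  nth 0 [:: 0; 10; 14; 17; 20; 22; 24; 26; 28; 30; 31; 33; 34; 36; 37; 38; 40;
            41; 42; 43; 44; 45; 46; 47]%N s.

(* [class_weight M n s] bounds, in units of 1/10000, the sum of the squares
   of the excesses of all [nu] with [|nu|^2 = n], [|mu - nu|^2 = s], where
   [|mu|^2 = M]; the cap of these [nu] around [mu] contains at most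
   [M %/ g] points. *)
Definition class_weight (M n s : nat) : nat :=
  let c := ((M + n - s) %/ 2)%N in
  if [|| odd (M + n - s), M * n < c ^ 2 | (n == 1) && (c ^ 2 == M)]%N then 0%N
  else let q := (10 * c - n * sqrt10 s)%N in
  if q == 0%N then 0%N
  else let g := (c ^ 2 - M * (n - 1))%N in
  if g == 0%N then 10001%N
  else ((M %/ g) * ((100 * q ^ 2) %/ n ^ 2 + 1))%N.

(** Positive excess forces [n + s < M], so for [M < 24] these ranges of [n] and [s] cover every
    class. *)
Definition total_weight (M : nat) : nat :=
  sumn [seq sumn [seq class_weight M n s | s <- iota 1 23] | n <- iota 1 23].

Lemma total_weight_le (M : nat) : (0 < M < 24)%N -> (total_weight M <= 10000)%N.
Proof.
move=> hM; have : M \in iota 1 23 by rewrite mem_iota.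
clear hM; move: M; apply/allP.
by vm_compute.
Qed.

(** Excludes the value 10001, which [class_weight] returns when the packing bound is void ([g = 0]):
    that branch is never reached in this range. *)
Lemma class_weight_le (M n s : nat) : (0 < M < 24)%N -> (0 < n < 24)%N ->
  (0 < s < 24)%N -> (class_weight M n s <= 10000)%N.
Proof.
move=> hM hn hs; have : all (fun M => all (fun n => all (fun s =>
    (class_weight M n s <= 10000)%N) (iota 1 23)) (iota 1 23)) (iota 1 23).
  by vm_compute.
move=> /allP/(_ M); rewrite mem_iota => /(_ hM)/allP/(_ n).
by rewrite mem_iota => /(_ hn)/allP/(_ s); rewrite mem_iota => /(_ hs).
Qed.

(** Underestimating the square root of [s] overestimates the excess, which is the safe side. *)
Lemma sqrt10_le (s : nat) : (s < 24)%N -> (sqrt10 s ^ 2 <= 100 * s)%N.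
Proof.
move=> hs; have : s \in iota 0 24 by rewrite mem_iota.
clear hs; move: s; apply/allP.
by vm_compute.
Qed.

End ClassWeights.

Section Excess.
Context {R : rcfType} {d : nat}.
Implicit Types mu nu : 'rV[int]_d.

Definition zlen nu : R := Num.sqrt (zdot nu nu)%:~R.

Definition kappa mu nu : R := (zdot mu nu)%:~R / (zdot nu nu)%:~R.

Definition excess mu nu : R := `|kappa mu nu| - zlen (mu - nu).

(** Squaring [|c| / n > sqrt s] gives the second fact. If [c <= 0], then [s >= M] and Cauchy-Schwarz
    gives [c^2 <= n s], against it. Since [s >= 1], it also yields [c > n], which is [n + s < M]. *)
Lemma excess_facts mu nu : nu != 0 -> nu != mu -> 0 < excess mu nu ->
  let M := zdot mu mu in let n := zdot nu nu in
  let s := zdot (mu - nu) (mu - nu) in let c := zdot mu nu in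
  [/\ 0 < c, n ^+ 2 * s < c ^+ 2, 2 * c = M + n - s, c ^+ 2 <= M * n
    & [/\ 0 < n, 0 < s & n + s < M]].
Proof.
move=> nu0 numu ex0 /=.
have n0 : 0 < zdot nu nu by rewrite zdot_gt0.
have s0 : 0 < zdot (mu - nu) (mu - nu) by rewrite zdot_gt0 subr_eq0 eq_sym.
have cauchy := zdot_cauchy mu nu.
have sE := zdot_sub mu nu.
have : zdot nu nu ^+ 2 * zdot (mu - nu) (mu - nu) < zdot mu nu ^+ 2.
  move: ex0; rewrite /excess subr_gt0 /zlen /kappa => h.
  have nR : 0 < (zdot nu nu)%:~R :> R by rewrite ltr0z.
  have : Num.sqrt (zdot (mu - nu) (mu - nu))%:~R ^+ 2
      < `|(zdot mu nu)%:~R / (zdot nu nu)%:~R| ^+ 2 :> R.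
    by rewrite ltr_pXn2r// nnegrE ?sqrtr_ge0.
  rewrite sqr_sqrtr ?ler0z ?zdot_ge0// real_normK ?num_real//.
  rewrite expr_div_n ltr_pdivlMr ?exprn_gt0// -!rmorphXn -rmorphM ltr_int.
  by rewrite mulrC.
move: n0 s0 cauchy sE.
set M := zdot mu mu; set n := zdot nu nu; set c := zdot mu nu.
set s := zdot (mu - nu) _ => n0 s0 cauchy sE bad.
have c0 : 0 < c.
  rewrite ltNge; apply/negP => c0.
  have : s <= M by nia.
  by nia.
split=> //; first by lia.
by split=> //; nia.
Qed.


(** Carries the facts over to the truncated arithmetic of [class_weight]. Where [k^2 - m (n - 1)] is
    truncated to 0, the packing bound becomes trivial. *)
Lemma class_arith (m k n s z : nat) :
  2 * k%:Z = m%:Z + n%:Z - s%:Z -> k%:Z ^+ 2 <= m%:Z * n%:Z -> 0 < n%:Z ->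
  0 < s%:Z -> n%:Z + s%:Z < m%:Z ->
  z%:R * (k%:Z ^+ 2 - m%:Z * (n%:Z - 1)) <= m%:Z ->
  [/\ (m + n - s = k.*2)%N, (k ^ 2 <= m * n)%N, (0 < n)%N, (0 < s)%N
    & (n + s < m)%N /\ (z * (k ^ 2 - m * (n - 1)) <= m)%N].
Proof.
case: n => [|n]; first by lia.
rewrite subn1 /= => e1 e2 e3 e4 e5 e6; split; [lia|lia|lia|lia|split; first lia].
have [h|h] := leqP (m * n) (k ^ 2); last first.
  by move: (ltnW h); rewrite -subn_eq0 => /eqP ->; rewrite muln0.
have [w kw] : exists w, (k ^ 2 = m * n + w)%N.
  by exists (k ^ 2 - m * n)%N; rewrite subnKC.
rewrite kw addKn -lez_nat PoszM.
have <- : k%:Z ^+ 2 - m%:Z * (n.+1%:Z - 1) = w%:Z by clear e1 e2 e6; lia.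
by rewrite -[z%:Z]natz.
Qed.

(** All points of a class have the same inner product [(M + n - s) / 2] with [mu], hence the same
    excess. The sum is therefore one square times a cardinality, which [packing] bounds. *)
Lemma excess_class_le (G : seq 'rV[int]_d) mu (n s : nat) : uniq G ->
  0 \notin G -> mu \notin G -> (`|zdot mu mu| < 24)%N ->
  {in G, forall nu, zdot nu nu = 1 -> zdot mu nu ^+ 2 != zdot mu mu} ->
  \sum_(nu <- G | (0 < excess mu nu) && ((zdot nu nu == n) &&
      (zdot (mu - nu) (mu - nu) == s))) excess mu nu ^+ 2
  <= (class_weight `|zdot mu mu| n s)%:R / 10000%:R.
Proof.
move=> uG G0 Gmu M24 Gaxis.
rewrite -big_filter; set G' := seq.filter _ G.
have G'P nu : nu \in G' -> [/\ 0 < excess mu nu, zdot nu nu = n,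
   zdot (mu - nu) (mu - nu) = s & nu \in G].
  by rewrite mem_filter => /andP[/and3P[? /eqP ? /eqP ?] ?]; split.
have G'n0 nu : nu \in G' -> nu != 0 /\ nu != mu.
  by move=> /G'P[_ _ _ nuG]; split; apply/eqP => E; [move: G0|move: Gmu];
    rewrite -E nuG.
case E: G' => [|nu0 G'']; first by rewrite big_nil divr_ge0.
have nu0G' : nu0 \in G' by rewrite E mem_head.
rewrite -E; clear E G''.
have [ex0 n0E s0E nu0G] := G'P _ nu0G'.
have [nu0_0 nu0_mu] := G'n0 _ nu0G'.
have := excess_facts nu0_0 nu0_mu ex0 => /=.
rewrite n0E s0E; set M := zdot mu mu; set c := zdot mu nu0.
have [m Mm] : exists m : nat, M = m.
  by exists `|M|%N; rewrite gez0_abs ?zdot_ge0.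
move=> [c0 bad cE cauchy [n0 s0 nsM]].
have [k ck] : exists k : nat, c = k by exists `|c|%N; rewrite gez0_abs ?ltW.
have all_c nu : nu \in G' -> zdot nu mu = c.
  move=> nuG'; have [? nE sE _] := G'P _ nuG'; have [? ?] := G'n0 _ nuG'.
  have [] := @excess_facts mu nu => //.
  rewrite nE sE -/M zdotC -cE => _ _ + _ _.
  by apply: mulfI.
have uG' : uniq G' by rewrite filter_uniq.
have pack := @packing d G' mu n c uG'
  (fun nu h => conj (let: And4 _ e _ _ := G'P nu h in e) (all_c nu h)).
have Gax : ~~ ((n == 1) && (k ^ 2 == m)%N).
  apply/negP => /andP[/eqP n1 /eqP km].
  have := Gaxis _ nu0G; rewrite n0E n1 => /(_ erefl).
  rewrite -/c -/M ck Mm; apply/negP/negPn.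
  by clear -km; lia.
rewrite -/M Mm absz_nat in M24 pack *.
rewrite Mm ck in cE cauchy nsM pack.
have [cEn cauchyn nn0 ss0 [nsm pack_n]] := class_arith cE cauchy n0 s0 nsM pack.
clear cE cauchy n0 s0 nsM pack.
have exE nu : nu \in G' -> excess mu nu = k%:R / n%:R - Num.sqrt s%:R.
  move=> nuG'; have [_ nE sE _] := G'P _ nuG'.
  rewrite /excess /kappa /zlen nE sE zdotC all_c// ck -!pmulrn.
  by rewrite ger0_norm// divr_ge0.
rewrite big_seq (eq_bigr (fun=> (k%:R / n%:R - Num.sqrt s%:R) ^+ 2)); last first.
  by move=> nu /exE ->.
rewrite -big_seq big_const_seq count_predT iter_addr_0 -[leLHS]mulr_natl.
rewrite /class_weight cEn divn2 odd_double doubleK.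
rewrite (negPf Gax) [(m * n < _)%N]ltnNge cauchyn /=.
have sm : (s < m)%N by rewrite (leq_ltn_trans _ nsm)// leq_addl.
have nm : (n < m)%N by rewrite (leq_ltn_trans _ nsm)// leq_addr.
have s24 := ltn_trans sm M24.
have sq10 := sqrt10_le s24.
have sqle : (sqrt10 s)%:R / 10%:R <= Num.sqrt s%:R :> R.
  rewrite -[leLHS]ger0_norm ?divr_ge0// -sqrtr_sqr ler_sqrt//.
  by rewrite expr_div_n ler_pdivrMr ?exprn_gt0// -!natrX -natrM ler_nat mulnC.
have nR : 0 < n%:R :> R by rewrite ltr0n.
(* [q] is [10 n] times an upper bound of the common excess; truncation at 0 only enlarges it. *)
have u_le : k%:R / n%:R - Num.sqrt s%:R <=
    (10 * k - n * sqrt10 s)%N%:R / (10%:R * n%:R) :> R.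
  apply: (@le_trans _ _ (k%:R / n%:R - (sqrt10 s)%:R / 10%:R)); first lra.
  rewrite ler_pdivlMr ?mulr_gt0//.
  have -> : (k%:R / n%:R - (sqrt10 s)%:R / 10%:R) * (10%:R * n%:R) =
     10%:R * k%:R - n%:R * (sqrt10 s)%:R :> R by field; rewrite gt_eqF.
  rewrite -!natrM; have [h|h] := leqP (n * sqrt10 s) (10 * k).
    by rewrite natrB.
  by rewrite (@le_trans _ _ 0)// subr_le0 ler_nat ltnW.
have u0 : 0 < k%:R / n%:R - Num.sqrt s%:R :> R by rewrite -(exE nu0).
set q := (10 * k - n * sqrt10 s)%N in u_le *.
have q0 : (0 < q)%N.
  by move: (lt_le_trans u0 u_le); rewrite pmulr_lgt0 ?invr_gt0 ?mulr_gt0// ltr0n.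
rewrite gtn_eqF//.
(* For [g = 0] the weight would be 10001, which [class_weight_le] forbids. *)
case: ifPn => [/eqP g0|g0].
  have : (class_weight m n s <= 10000)%N.
    by apply: class_weight_le; rewrite ?nn0 ?ss0 ?s24 ?(ltn_trans nm)//
      (leq_ltn_trans _ nm).
  rewrite /class_weight cEn divn2 odd_double doubleK.
  rewrite (negPf Gax) [(m * n < _)%N]ltnNge cauchyn /= -/q gtn_eqF// g0.
  by rewrite eqxx.
set g := (k ^ 2 - m * (n - 1))%N in g0 *.
have sz : (size G' <= m %/ g)%N.
  by rewrite leq_divRL ?lt0n.
rewrite [in leRHS]natrM -[leRHS]mulrA; apply: ler_pM; rewrite ?sqr_ge0 ?ler_nat//.
apply: (@le_trans _ _ ((q%:R / (10%:R * n%:R)) ^+ 2)).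
  by rewrite ler_pXn2r ?nnegrE ?(ltW u0) ?divr_ge0 ?mulr_ge0.
have n2 : 0 < n%:R ^+ 2 :> R by rewrite exprn_gt0.
rewrite expr_div_n exprMn ler_pdivrMr ?mulr_gt0 ?exprn_gt0//.
(* In units of 1/10000 the square of [q / (10 n)] is [100 q^2 / n^2]; the [+ 1] makes up for the
   integer division. *)
have -> : ((100 * q ^ 2) %/ n ^ 2 + 1)%N%:R / 10000%:R * (10%:R ^+ 2 * n%:R ^+ 2)
   = (((100 * q ^ 2) %/ n ^ 2 + 1) * n ^ 2)%N%:R / 100%:R :> R.
  by rewrite natrM natrX; lra.
rewrite ler_pdivlMr// -natrX -natrM ler_nat mulnC addn1 ltnW//.
by rewrite ltn_ceil// expn_gt0 nn0.
Qed.


(** Every exceeding point lies in one of the tabulated classes, so the class bounds add up to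
    [total_weight]. The last hypothesis matches the branch of [class_weight] that discards [n = 1],
    [c^2 = M]. *)
Lemma excess_sum_le1_small (G : seq 'rV[int]_d) mu : uniq G -> 0 \notin G ->
  mu \notin G -> (`|zdot mu mu| < 24)%N ->
  {in G, forall nu, zdot nu nu = 1 -> zdot mu nu ^+ 2 != zdot mu mu} ->
  \sum_(nu <- G | 0 < excess mu nu) excess mu nu ^+ 2 <= 1.
Proof.
move=> uG G0 Gmu M24 Gaxis.
have facts nu : nu \in G -> 0 < excess mu nu ->
    (`|zdot nu nu|%N \in iota 1 23) && (`|zdot (mu - nu) (mu - nu)|%N \in iota 1 23).
  move=> nuG ex0.
  have nu0 : nu != 0 by apply/eqP => E; move: G0; rewrite -E nuG.
  have numu : nu != mu by apply/eqP => E; move: Gmu; rewrite -E nuG.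
  have [_ _ _ _ [n0 s0 h]] := excess_facts nu0 numu ex0.
  by rewrite !mem_iota; clear -M24 n0 s0 h; lia.
have [M0|M0] := eqVneq (zdot mu mu) 0.
  rewrite big_seq_cond big1 ?ler01// => nu /andP[nuG ex0].
  have nu0 : nu != 0 by apply/eqP => E; move: G0; rewrite -E nuG.
  have numu : nu != mu by apply/eqP => E; move: Gmu; rewrite -E nuG.
  have [_ _ _ _ []] := excess_facts nu0 numu ex0; rewrite M0 => n0 s0 h.
  by exfalso; clear -n0 s0 h; lia.
have Mgt0 : (0 < `|zdot mu mu| < 24)%N by rewrite M24 lt0n absz_eq0 M0.
have le1 : (total_weight `|zdot mu mu|)%:R / 10000%:R <= 1 :> R.
  by rewrite ler_pdivrMr// mul1r ler_nat total_weight_le.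
apply: le_trans le1; rewrite /total_weight sumnE big_map natr_sum mulr_suml.
apply: (@le_trans _ _ (\sum_(n <- iota 1 23) \sum_(s <- iota 1 23)
  \sum_(nu <- G | (0 < excess mu nu) && ((zdot nu nu == n) &&
      (zdot (mu - nu) (mu - nu) == s))) excess mu nu ^+ 2)); last first.
  apply: ler_sum => n _; rewrite sumnE big_map natr_sum mulr_suml.
  by apply: ler_sum => s _; exact: excess_class_le.
under [leRHS]eq_bigr do under eq_bigr do rewrite big_mkcondr.
under [leRHS]eq_bigr do rewrite exchange_big.
rewrite [leRHS]exchange_big /= big_seq_cond [leRHS]big_seq_cond.
apply: ler_sum => nu /andP[nuG ex0]; have /andP[nI sI] := facts _ nuG ex0.
(* The term of [nu] reappears at its own class; every other summand is nonnegative. *)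
rewrite (bigD1_seq `|zdot nu nu|%N) ?iota_uniq//=.
rewrite (bigD1_seq `|zdot (mu - nu) (mu - nu)|%N) ?iota_uniq//=.
rewrite !gez0_abs ?zdot_ge0// !eqxx /= -addrA lerDl addr_ge0//.
  by apply: sumr_ge0 => s _; case: ifP => // _; rewrite sqr_ge0.
apply: sumr_ge0 => n _; apply: sumr_ge0 => s _.
by case: ifP => // _; rewrite sqr_ge0.
Qed.

End Excess.

(** * Long vectors: only unit vectors and neighbours of [mu] exceed *)

Section LongVectors.
Context {R : rcfType} {d : nat}.
Implicit Types mu nu : 'rV[int]_d.
Local Notation excess := (@excess R d).

(** Let [x = c - n], which stands for [nu.(mu - nu)]. The bounds become [x^2 <= n s] and
    [n s < n + s + 2 x]. If [n] and [s] are both at least 2, they force [(n - 1)(s - 1) <= 10] and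
    [x <= 4], so [M = n + s + 2 x] stays below 24. *)
Lemma excess_pos_far (M n s c : int) : 0 < c -> n ^+ 2 * s < c ^+ 2 ->
  2 * c = M + n - s -> c ^+ 2 <= M * n -> 0 < n -> 0 < s -> 24 <= M ->
  n != 1 -> s = 1.
Proof.
move=> c0 bad cE cauchy n0 s0 M24 n1; apply/eqP; apply: contraTT M24 => s1.
have [a aE] : exists a, n = a + 1 by exists (n - 1); lia.
have [b bE] : exists b, s = b + 1 by exists (s - 1); lia.
have [x xE] : exists x, c = x + n by exists (c - n); lia.
have ME : M = n + s + 2 * x by lia.
have x2 : x ^+ 2 <= n * s by subst c M; nia.
have a1 : 1 <= a by lia.
have b1 : 1 <= b by lia.
have h1 : n * s < n + s + 2 * x.
  rewrite -(ltr_pM2l n0); rewrite xE in bad; clear -bad x2; lra.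
subst n s; clear bad cauchy cE c0 n1 s1 n0 s0 xE.
have ab : a + b <= a * b + 1 by nia.
have h2 : a * b - 1 < 2 * x by lia.
have h3 : (a * b - 1) ^+ 2 < 4 * ((a + 1) * (b + 1)).
  have h0 : 0 <= a * b - 1 by clear -a1 b1; nia.
  have : (a * b - 1) ^+ 2 < (2 * x) ^+ 2.
    by rewrite ltr_pXn2r// nnegrE (le_trans h0)// ltW.
  by clear -x2; lra.
have h4 : a * b <= 10 by clear h1 h2 x2; nia.
have x4 : x <= 4.
  rewrite leNgt; apply/negP => x5; have : 25 <= x ^+ 2 by clear -x5; nia.
  by move: x2 h4 ab; clear; nia.
by clear -ME x4 h4 ab; lia.
Qed.


(** For a neighbour [nu] of [mu] and [v = (mu - nu).mu], one has [n = M + 1 - 2 v] and excess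
    [(v - 1) / n]; the claim is that this is at most [3 v / (2 M)]. Estimating [M] below by [v^2]
    leaves [v (v - 1)(v - 3) >= 0], which fails only at [v = 2]. *)
Lemma neighbour_excess (M v : int) : 24 <= M -> 1 <= v -> v ^+ 2 <= M ->
  2 * M * (v - 1) <= 3 * v * (M + 1 - 2 * v).
Proof.
move=> M24 v1 vM; have [v2|v2] := eqVneq v 2; first by subst v; lia.
have v3 : 0 <= v * (v - 1) * (v - 3).
  have [->|vn1] := eqVneq v 1; first by rewrite subrr mulr0 mul0r.
  by rewrite !mulr_ge0//; lia.
have := ler_wpM2l (le_trans ler01 v1) vM => vM'.
by clear -v3 vM vM'; lra.
Qed.

(** The neighbours of [mu] ([S2]) contribute at most [9 / (4 M)]. There is at most one exceeding
    unit vector ([S1]), and since it is off the axis of [mu] its excess stays far enough below 1 to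
    absorb that amount. *)
Lemma excess_sum_le1_large (G : seq 'rV[int]_d) mu : uniq G -> 0 \notin G ->
  mu \notin G -> 24 <= zdot mu mu ->
  {in G, forall nu, zdot nu nu = 1 -> zdot mu nu ^+ 2 != zdot mu mu} ->
  \sum_(nu <- G | 0 < excess mu nu) excess mu nu ^+ 2 <= 1.
Proof.
move=> uG G0 Gmu M24 Gaxis; set M := zdot mu mu.
have M0 : 0 < M%:~R :> R by rewrite ltr0z (lt_le_trans _ M24).
have G0P nu : nu \in G -> nu != 0 /\ nu != mu.
  by move=> nuG; split; apply/eqP => E; [move: G0|move: Gmu]; rewrite -E nuG.
rewrite (bigID (fun nu => zdot nu nu == 1))/=.
set S1 := \sum_(_ <- _ | _ && (_ == _)) _.
set S2 := \sum_(_ <- _ | _) _.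
(* The differences [mu - nu] are distinct unit vectors, so [unit_bessel] bounds the sum of the [v^2]
   by [M]. *)
have S2le : S2 <= 9%:R / (4%:R * M%:~R).
  rewrite /S2 -big_filter; set G' := seq.filter _ _.
  have G'P nu : nu \in G' -> [/\ zdot (mu - nu) (mu - nu) = 1,
      1 <= zdot (mu - nu) mu &
      excess mu nu <= 3%:R / (2%:R * M%:~R) * (zdot (mu - nu) mu)%:~R].
    rewrite mem_filter => /andP[/andP[ex0 n1] nuG].
    have [nu0 numu] := G0P _ nuG.
    have [c0 bad cE cauchy [n0 s0 _]] := excess_facts nu0 numu ex0.
    have sE := excess_pos_far c0 bad cE cauchy n0 s0 M24 n1.
    set v := zdot (mu - nu) mu.
    have vE : v = M - zdot mu nu by rewrite /v zdotBl (zdotC nu).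
    have v1 : 1 <= v.
      by rewrite vE; move: cE bad; rewrite sE -/M => cE bad; clear -cE bad c0 n0; nia.
    have vM : v ^+ 2 <= M.
      by have := zdot_cauchy (mu - nu) mu; rewrite sE mul1r.
    split=> //.
    have nE : zdot nu nu = M + 1 - 2 * v by rewrite vE; clear -cE sE; lia.
    have cE' : zdot mu nu = zdot nu nu + (v - 1) by rewrite vE; clear -cE sE; lia.
    have nR : 0 < (zdot nu nu)%:~R :> R by rewrite ltr0z.
    rewrite /excess /kappa /zlen sE sqrtr1 ger0_norm; last first.
      by rewrite divr_ge0// ler0z ltW.
    rewrite cE' rmorphD mulrDl divff ?gt_eqF//= addrAC subrr add0r.
    have -> : 3%:R / (2%:R * M%:~R) * v%:~R = (3%:R * v%:~R) / (2%:R * M%:~R) :> R.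
      by rewrite mulrAC.
    rewrite ler_pdivrMr// mulrAC ler_pdivlMr ?mulr_gt0//.
    have := neighbour_excess M24 v1 vM; rewrite -nE -(ler_int R).
    rewrite !rmorphM /= => h; move: h; lra.
  rewrite big_seq.
  apply: (@le_trans _ _ (\sum_(nu <- G') (3%:R / (2%:R * M%:~R)) ^+ 2 *
      (zdot (mu - nu) mu ^+ 2)%:~R)).
    rewrite [leRHS]big_seq; apply: ler_sum => nu nuG.
    have [_ v1 exle] := G'P _ nuG.
    have ex0 : 0 < excess mu nu by move: nuG; rewrite mem_filter => /andP[/andP[]].
    rewrite rmorphXn -exprMn ler_pXn2r// ?nnegrE ?(ltW ex0)//.
    exact: le_trans (ltW ex0) exle.
  rewrite -mulr_sumr -rmorph_sum.
  have -> : 9%:R / (4%:R * M%:~R) = (3%:R / (2%:R * M%:~R)) ^+ 2 * M%:~R :> R.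
    by field; rewrite gt_eqF.
  rewrite ler_wpM2l ?sqr_ge0// ler_int.
  rewrite -(big_map (fun nu => mu - nu) xpredT (fun tau => zdot tau mu ^+ 2)).
  apply: unit_bessel.
    by rewrite map_inj_uniq ?filter_uniq// => x y /(congr1 -%R); rewrite !opprB => /addIr.
  by move=> _ /mapP[nu /G'P[? v1 _] ->]; split=> //; apply: lt_le_trans v1.
have S1le : S1 <= 1 - 9%:R / (4%:R * M%:~R).
  rewrite /S1 -big_filter; set G' := seq.filter _ _.
  have G'P nu : nu \in G' -> let c := zdot mu nu in
      [/\ zdot nu nu = 1, 5 <= c, c ^+ 2 < M, M + 2 < (c + 1) ^+ 2 &
       0 < excess mu nu].
    rewrite mem_filter => /andP[/andP[ex0 /eqP n1] nuG] /=.
    have [nu0 numu] := G0P _ nuG.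
    have [c0 bad cE cauchy [n0 s0 _]] := excess_facts nu0 numu ex0.
    have cM : zdot mu nu ^+ 2 < M.
      by rewrite lt_neqAle Gaxis//= -[M]mulr1 -n1.
    have Mc : M + 2 < (zdot mu nu + 1) ^+ 2.
      by move: bad cE; rewrite n1 -/M; clear; lia.
    split=> //; clear -Mc M24 c0; rewrite -/M in M24; nia.
  case E : G' => [|nu0 G''].
    rewrite big_nil subr_ge0 ler_pdivrMr ?mulr_gt0// mul1r.
    by move: M24; rewrite -/M -(ler_int R); lra.
  have nu0G : nu0 \in G' by rewrite E mem_head.
  have [n1 c5 cM Mc ex0] := G'P _ nu0G.
  (* [c^2 < M < (c + 1)^2] determines [c], so these points share it, and [packing] with [n = 1]
     gives [(size G') c^2 <= M < 2 c^2]. *)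
  have allc nu : nu \in G' -> zdot nu nu = 1 /\ zdot nu mu = zdot mu nu0.
    move=> /G'P[-> c5' cM' Mc' _]; split=> //; rewrite zdotC.
    clear -c5 cM Mc c5' cM' Mc'; nia.
  have uG' : uniq G' by rewrite filter_uniq.
  have := packing uG' allc; rewrite subrr mulr0 subr0 -/M => pack.
  have sz : (size G' <= 1)%N.
    rewrite leqNgt; apply/negP => sz.
    have : 2 <= (size G')%:R :> int by rewrite (ler_nat _ 2).
    clear -c5 cM Mc pack; nia.
  have : G'' = [::] by move: sz; rewrite E; case: (G'').
  move=> ->; rewrite big_seq1.
  have M_c : zdot mu nu0 ^+ 2 + 1 <= M by clear -cM; lia.
  have sE := zdot_sub mu nu0.
  move: ex0 M_c c5; rewrite /excess /kappa /zlen sE n1 divr1 -/M.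
  rewrite -!(ler_int R) !rmorphD /= rmorphXn rmorphN rmorphM /= rmorph1.
  set c := (zdot mu nu0)%:~R : R; set m := M%:~R : R => ex0 M_c c5.
  have c0 : 0 < c by lra.
  rewrite (ger0_norm (ltW c0)) in ex0 *.
  (* As [M >= c^2 + 1], the radicand is at least [(c - 1)^2 + 1], whose root exceeds [c - 1] by at
     least [1 / (2 c)]. *)
  have sqle : c - 1 + (2%:R * c)^-1 <= Num.sqrt (m + 1 - 2%:R * c).
    have i0 : 0 < (2%:R * c)^-1 by rewrite invr_gt0 mulr_gt0.
    have ic : c * (2%:R * c)^-1 = 2%:R^-1 by field; rewrite gt_eqF.
    rewrite -[leLHS]ger0_norm; last lra.
    rewrite -sqrtr_sqr ler_sqrt; last by nra.
    have : (2%:R * c)^-1 <= 1 by rewrite invf_le1 ?mulr_gt0//; lra.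
    nra.
  have u1 : c - Num.sqrt (m + 1 - 2%:R * c) <= 1 - (2%:R * c)^-1 by lra.
  apply: (@le_trans _ _ ((1 - (2%:R * c)^-1) ^+ 2)).
    by rewrite ler_pXn2r// nnegrE ?(ltW ex0)// (le_trans (ltW ex0)).
  have : 9%:R / (4%:R * m) <= 9%:R / (4%:R * c ^+ 2).
    rewrite ler_wpM2l// lef_pV2 ?posrE ?mulr_gt0 ?exprn_gt0//.
    by rewrite ler_pM2l//; lra.
  have -> : 9%:R / (4%:R * c ^+ 2) = 9%:R * (2%:R * c)^-1 ^+ 2 :> R.
    by field; rewrite gt_eqF.
  have : (2%:R * c)^-1 <= 10%:R^-1.
    by rewrite lef_pV2 ?posrE ?mulr_gt0//; lra.
  have : 0 < (2%:R * c)^-1 by rewrite invr_gt0 mulr_gt0.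
  (* It suffices that [(1 - i)^2 + 9 i^2 <= 1], true for [0 < i <= 1/5]; here [c >= 5] gives
     [i <= 1/10]. *)
  move: (9%:R / (4%:R * m)) ((2%:R * c)^-1) => w i i0 i10 wi.
  nra.
by rewrite -[leRHS](subrK (9%:R / (4%:R * M%:~R))) lerD.
Qed.
End LongVectors.

(** * Splitting a row of the matrix [kappa] *)

Section RowSplit.
Context {R : rcfType} {d : nat}.
Implicit Types mu nu : 'rV[int]_d.
Local Notation excess := (@excess R d).
Local Notation kappa := (@kappa R d).
Local Notation zlen := (@zlen R d).

(** [v] and [r = m - v] are the coordinates of [nu] and [mu - nu] along the axis, and [W = n - v^2]
    is the squared distance of [nu] from it. For [W >= 1] the condition contradicts
    [(v + r)^2 <= (v^2 + 1)(r^2 + 1)]; for [W = 0] it says [|v r| < |v + r|], which leaves [v = 1]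
    or [r = 1]. *)
Lemma axis_arith (m v n s : int) : 0 < m -> 0 < v -> 0 < s -> v ^+ 2 <= n ->
  s = m ^+ 2 + n - 2 * (m * v) -> n ^+ 2 * s < (m * v) ^+ 2 ->
  n = v ^+ 2 /\ (v = 1 \/ v = m - 1).
Proof.
move=> m0 v0 s0 vn sE bad.
have [r rE] : exists r, m = v + r by exists (m - v); lia.
have [W WE] : exists W, n = v ^+ 2 + W by exists (n - v ^+ 2); lia.
have W0 : 0 <= W by lia.
have sE' : s = r ^+ 2 + W by subst; clear; lia.
subst s m n; rewrite sE' in bad s0; clear sE' vn.
have [W1|W1] := leP 1 W.
  have h1 : (v ^+ 2 + 1) ^+ 2 * (r ^+ 2 + 1) <= (v ^+ 2 + W) ^+ 2 * (r ^+ 2 + W).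
    apply: ler_pM; rewrite ?addr_ge0 ?sqr_ge0 ?lerD2l//.
    by rewrite ler_pXn2r ?nnegrE ?addr_ge0 ?sqr_ge0 ?lerD2l.
  have h2 : (v + r) ^+ 2 <= (v ^+ 2 + 1) * (r ^+ 2 + 1).
    by have := sqr_ge0 (v * r - 1); clear; lra.
  have h3 : v ^+ 2 * (v + r) ^+ 2
      <= (v ^+ 2 + 1) * ((v ^+ 2 + 1) * (r ^+ 2 + 1)).
    by apply: ler_pM; rewrite ?sqr_ge0// lerDl.
  by exfalso; clear -bad h1 h3; lra.
have W00 : W = 0 by clear -W0 W1; lia.
subst W; split; first by rewrite addr0.
rewrite !addr0 in bad s0.
have bad' : (v * r) ^+ 2 < (v + r) ^+ 2.
  by rewrite -(ltr_pM2l (exprn_gt0 2 v0)); clear -bad; lra.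
have h : v * r < v + r.
  rewrite ltNge; apply/negP => h; move: bad'; rewrite ltNge => /negP; apply.
  by rewrite ler_pXn2r ?nnegrE ?(ltW m0) ?(le_trans (ltW m0) h).
have [r0|r0] := leP r 0.
  have r1 : r <= -1 by have := s0; clear -r0; nia.
  have : - (v * r) < v + r.
    rewrite ltNge; apply/negP => h'; move: bad'; rewrite ltNge => /negP; apply.
    by rewrite -[leRHS]sqrrN ler_pXn2r ?nnegrE ?(ltW m0) ?(le_trans (ltW m0) h').
  by clear -r1 v0; nia.
have [v1|v1] := eqVneq v 1; [by left|right].
have : r = 1 by clear -h r0 v0 v1; nia.
by move=> ->; rewrite addrK.
Qed.

Lemma axis_excess (G : seq 'rV[int]_d) mu eps : 0 \notin G -> mu \notin G ->
  zdot eps eps = 1 -> 0 < zdot mu eps -> zdot mu eps ^+ 2 = zdot mu mu ->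
  mu = zdot mu eps *: eps /\
  {in G, forall nu, 0 < excess mu nu ->
    nu = eps \/ nu = (zdot mu eps - 1) *: eps}.
Proof.
move=> G0 Gmu e1 m0 mM.
have muE : mu = zdot mu eps *: eps.
  apply/eqP; rewrite -subr_eq0 -zdot_eq0 zdot_sub !zdotZr zdotZl e1 -mM.
  by apply/eqP; ring.
split=> // nu nuG ex0.
have nu0 : nu != 0 by apply/eqP => E; move: G0; rewrite -E nuG.
have numu : nu != mu by apply/eqP => E; move: Gmu; rewrite -E nuG.
have [c0 bad cE _ [_ s0 _]] := excess_facts nu0 numu ex0.
have cvE : zdot mu nu = zdot mu eps * zdot nu eps.
  by rewrite {1}muE zdotZl (zdotC eps).
have v0 : 0 < zdot nu eps by rewrite -(pmulr_rgt0 _ m0) -cvE.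
have vn : zdot nu eps ^+ 2 <= zdot nu nu.
  by have := zdot_cauchy nu eps; rewrite e1 mulr1.
rewrite cvE in bad cE.
have sE : zdot (mu - nu) (mu - nu) =
    zdot mu eps ^+ 2 + zdot nu nu - 2 * (zdot mu eps * zdot nu eps).
  by rewrite mM cE; ring.
have [nE vE] := axis_arith m0 v0 s0 vn sE bad.
have nuE : nu = zdot nu eps *: eps.
  apply/eqP; rewrite -subr_eq0 -zdot_eq0 zdot_sub !zdotZr zdotZl e1 nE.
  by apply/eqP; ring.
by rewrite nuE; case: vE => ->; [left; rewrite scale1r|right].
Qed.

(** With [D = j (j^2 + 1)] the two ratios are [1 + 2 / D] and [1 - (j^2 - 1) / D]: the gain at [eps]
    is of order [j^-3], the loss at [j eps] of order [j^-1]. *)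
Lemma axis_split_arith (j : R) : 2%:R <= j ->
  ((j + 1 - (j ^+ 2 - 1) / (j ^+ 2 + 1)) / j) ^+ 2 +
  ((j + 1) / j - 2%:R * j / (j ^+ 2 + 1)) ^+ 2 <= 2%:R.
Proof.
move=> j2; have j0 : 0 < j by lra.
have jj : 0 < j ^+ 2 + 1 by nra.
pose D := j * (j ^+ 2 + 1); have D0 : 0 < D by rewrite mulr_gt0.
have -> : (j + 1 - (j ^+ 2 - 1) / (j ^+ 2 + 1)) / j = 1 + 2%:R / D.
  by rewrite /D; field; rewrite !gt_eqF.
have -> : (j + 1) / j - 2%:R * j / (j ^+ 2 + 1) = 1 - (j ^+ 2 - 1) / D.
  by rewrite /D; field; rewrite !gt_eqF.
rewrite -subr_le0.
have -> : (1 + 2%:R / D) ^+ 2 + (1 - (j ^+ 2 - 1) / D) ^+ 2 - 2%:R =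
  ((6%:R - 2%:R * j ^+ 2) * D + 4%:R + (j ^+ 2 - 1) ^+ 2) / D ^+ 2.
  by field; rewrite gt_eqF.
rewrite pmulr_lle0 ?invr_gt0 ?exprn_gt0// /D.
have : 0 <= (j - 2%:R) * j by nra.
nra.
Qed.

Lemma bigD2_seq (I : eqType) (V : nmodType) (r : seq I) (x y : I) (F : I -> V) :
  x \in r -> y \in r -> uniq r -> y != x ->
  \sum_(i <- r) F i = F x + F y + \sum_(i <- r | (i != x) && (i != y)) F i.
Proof.
move=> xr yr ur yx; rewrite (bigD1_seq x)//= -big_filter -addrA; congr (_ + _).
by rewrite (bigD1_seq y) ?filter_uniq ?mem_filter ?yx//= big_filter_cond.
Qed.

Lemma row_split (G : seq 'rV[int]_d) mu : uniq G -> 0 \notin G ->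
  mu \notin G ->
  exists k b : 'rV[int]_d -> R,
  [/\ {in G, forall nu, `|kappa mu nu| = k nu + b nu},
    \sum_(nu <- G) (k nu / zlen (mu - nu)) ^+ 2 <= (size G)%:R
  & \sum_(nu <- G) b nu ^+ 2 <= 1].
Proof.
move=> uG G0 Gmu.
have t0 nu : nu \in G -> 0 < zlen (mu - nu).
  move=> nuG; rewrite sqrtr_gt0 ltr0z zdot_gt0 subr_eq0.
  by apply/eqP => E; move: Gmu; rewrite E nuG.
have bounded nu : nu \in G -> ~~ (0 < excess mu nu) ->
    (`|kappa mu nu| / zlen (mu - nu)) ^+ 2 <= 1.
  move=> nuG; rewrite -leNgt /excess subr_le0 => h.
  by rewrite expr_le1// ?divr_ge0 ?sqrtr_ge0// ler_pdivrMr ?mul1r ?t0.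
case: (boolP (\sum_(nu <- G | 0 < excess mu nu) excess mu nu ^+ 2 <= 1)).
  (* When the excesses already have square sum at most 1, [k] is the minimum of [|kappa|] and
     [|mu - nu|], and [b] is the excess. *)
  move=> h; exists (fun nu => if 0 < excess mu nu then zlen (mu - nu) else `|kappa mu nu|).
  exists (fun nu => if 0 < excess mu nu then excess mu nu else 0).
  split.
  - by move=> nu nuG; case: ifP => _; rewrite ?addr0// /excess addrC subrK.
  - rewrite -sum1_size natr_sum big_seq [leRHS]big_seq.
    apply: ler_sum => nu nuG; case: ifPn => ex; last exact: bounded.
    by rewrite divff ?expr1n// gt_eqF ?t0.
  - apply: le_trans h; rewrite [leRHS]big_mkcond /=.
    by apply: ler_sum => nu _; case: ifP => //; rewrite expr0n.
rewrite -ltNge => big.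
pose B := [seq nu <- G | 0 < excess mu nu].
have uB : uniq B by rewrite filter_uniq.
have B0 : 0 \notin B by apply: contra G0; rewrite mem_filter => /andP[].
have Bmu : mu \notin B by apply: contra Gmu; rewrite mem_filter => /andP[].
have BE := big_filter G (fun nu => 0 < excess mu nu) (fun nu => excess mu nu ^+ 2).
rewrite -BE -/B in big.
(* A square sum above 1 forces some unit vector of [B] to be parallel to [mu]; otherwise the bound
   for short or for long vectors applies. *)
have [eps epsB [e1 m0 mM]] : exists2 eps, eps \in B &
    [/\ zdot eps eps = 1, 0 < zdot mu eps & zdot mu eps ^+ 2 = zdot mu mu].
  have [/hasP[eps epsB /andP[/eqP e1 /eqP mM]]|] := boolP (has (fun eps =>
      (zdot eps eps == 1) && (zdot mu eps ^+ 2 == zdot mu mu)) B).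
    exists eps => //; split=> //.
    move: (epsB); rewrite mem_filter => /andP[ex0 epsG].
    have [] := @excess_facts R _ mu eps _ _ ex0 => //.
      by apply/eqP => E; move: G0; rewrite -E epsG.
    by apply/eqP => E; move: Gmu; rewrite -E epsG.
  move=> /hasPn offaxis; exfalso; move: big; apply/negP; rewrite -leNgt.
  have Bid : [seq nu <- B | 0 < excess mu nu] = B by rewrite filter_id.
  rewrite -[X in \sum_(_ <- X) _]Bid big_filter.
  have Baxis : {in B, forall nu, zdot nu nu = 1 -> zdot mu nu ^+ 2 != zdot mu mu}.
    by move=> nu /offaxis; rewrite negb_and => /orP[/eqP//|].
  have [M24|M24] := leP 24 (zdot mu mu); first exact: excess_sum_le1_large.
  apply: excess_sum_le1_small => //.
  by rewrite -ltz_nat gez0_abs ?zdot_ge0.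
have epsG : eps \in G by move: epsB; rewrite mem_filter => /andP[].
have [muE badE] := axis_excess G0 Gmu e1 m0 mM.
pose j := zdot mu eps - 1; have mj : zdot mu eps = j + 1 by rewrite subrK.
rewrite -/j in badE.
have j0 : 0 <= j by rewrite /j; clear -m0; lia.
clearbody j.
have keps : kappa mu eps = j%:~R + 1 by rewrite /kappa e1 divr1 mj rmorphD.
have zeps : zlen (mu - eps) = j%:~R.
  rewrite /zlen zdot_sub e1 mj -mM mj -[RHS]ger0_norm ?ler0z// -sqrtr_sqr.
  by congr Num.sqrt; rewrite -rmorphXn; congr (_%:~R); ring.
have exeps : excess mu eps = 1.
  by rewrite /excess keps zeps ger0_norm ?addr_ge0 ?ler0z// addrAC subrr add0r.
(* Unless [j eps] is a second exceeding point, only [eps] exceeds, and its excess 1 does not surpass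
   1. *)
have [/andP[j2 jB]|notboth] := boolP ((2 <= j) && (j *: eps \in B)); last first.
  have Beps nu : nu \in B -> nu = eps.
    move=> nuB; move: (nuB); rewrite mem_filter => /andP[ex0 nuG].
    have [//|nuE] := badE _ nuG ex0.
    move: notboth; rewrite -nuE nuB andbT -ltNge => jlt2.
    have [j_0|j_1] : j = 0 \/ j = 1 by clear -jlt2 j0; lia.
      by move: B0; rewrite -[0](scale0r eps) -j_0 -nuE nuB.
    by rewrite nuE j_1 scale1r.
  exfalso; move: big; apply/negP; rewrite -leNgt (bigD1_seq eps)//=.
  rewrite exeps expr1n gerDl big_seq_cond big1// => nu /andP[/Beps ->].
  by rewrite eqxx.
have jG : j *: eps \in G by move: jB; rewrite mem_filter => /andP[].
have jR : 2%:R <= j%:~R :> R by rewrite -(ler_int R) in j2.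
have jn0 : j%:~R != 0 :> R by rewrite gt_eqF// (lt_le_trans _ jR).
have neq : j *: eps != eps.
  apply/eqP => /(congr1 (zdot eps)); rewrite zdotZr e1.
  by clear -j2; lia.
have kj : kappa mu (j *: eps) = (j%:~R + 1) / j%:~R.
  rewrite /kappa !zdotZr zdotZl e1 mulr1 mj !rmorphM rmorphD /=.
  by field.
have zj : zlen (mu - j *: eps) = 1.
  rewrite /zlen {1 2}muE -scalerBl zdotZl zdotZr e1 mj.
  by rewrite addrAC subrr add0r !mulr1 sqrtr1.
(* The identity [(j^2 - 1)^2 + (2 j)^2 = (j^2 + 1)^2] makes the square sum of [b] exactly 1.
   Compared with the excesses 1 and [1 / j], [b] is lowered at [eps] and raised at [j eps]. *)
pose b nu : R := if nu == eps then (j%:~R ^+ 2 - 1) / (j%:~R ^+ 2 + 1)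
  else if nu == j *: eps then 2%:R * j%:~R / (j%:~R ^+ 2 + 1) else 0.
have beps : b eps = (j%:~R ^+ 2 - 1) / (j%:~R ^+ 2 + 1) by rewrite /b eqxx.
have bj : b (j *: eps) = 2%:R * j%:~R / (j%:~R ^+ 2 + 1).
  by rewrite /b (negPf neq) eqxx.
exists (fun nu => `|kappa mu nu| - b nu), b; split.
- by move=> nu _; rewrite subrK.
- rewrite -sum1_size natr_sum.
  rewrite !(bigD2_seq _ epsG jG)//.
  apply: lerD.
    rewrite keps kj zeps zj beps bj divr1 !ger0_norm ?divr_ge0 ?addr_ge0 ?ler0z//.
    exact: axis_split_arith.
  rewrite big_seq_cond [leRHS]big_seq_cond; apply: ler_sum => nu /and3P[nuG ne nj].
  have -> : b nu = 0 by rewrite /b (negPf ne) (negPf nj).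
  rewrite subr0 bounded//; apply/negP => ex0.
  by have [E|E] := badE _ nuG ex0; [move: ne|move: nj]; rewrite E eqxx.
- rewrite (bigD2_seq _ epsG jG)// beps bj.
  rewrite big_seq_cond big1 => [|nu /and3P[_ ne nj]]; last first.
    by rewrite /b (negPf ne) (negPf nj) expr0n.
  rewrite addr0 le_eqVlt; apply/orP; left; apply/eqP; field.
  by rewrite gt_eqF// ltr_pwDr// sqr_ge0.
Qed.

End RowSplit.

Local Open Scope classical_set_scope.
Local Open Scope complex_scope.
Local Open Scope ring_scope.

(** * Periodic functions and density of trigonometric polynomials *)

Section ComplexModulus.
Context {R : realType}.
Implicit Types (z w : R[i]) (t : R).
Local Notation Re := complex.Re.
Local Notation Im := complex.Im.

Lemma cabs_sqr z : cabs z ^+ 2 = Re z ^+ 2 + Im z ^+ 2.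
Proof. by case: z => a b /=; rewrite sqr_sqrtr// addr_ge0 ?sqr_ge0. Qed.

Lemma cabs_ge0 z : 0 <= cabs z.
Proof. by case: z => a b; exact: sqrtr_ge0. Qed.

Lemma cabs0 : cabs (0 : R[i]) = 0.
Proof. exact: ComplexField.Normc.normc0. Qed.

Lemma cabsM z w : cabs (z * w) = cabs z * cabs w.
Proof. exact: ComplexField.Normc.normcM. Qed.

Lemma cabsD z w : cabs (z + w) <= cabs z + cabs w.
Proof. exact: le_normcD. Qed.

Lemma cabsN z : cabs (- z) = cabs z.
Proof. exact: normcN. Qed.

Lemma cabs_sum I (r : seq I) (P : pred I) (F : I -> R[i]) :
  cabs (\sum_(i <- r | P i) F i) <= \sum_(i <- r | P i) cabs (F i).
Proof.
elim/big_rec2: _ => [|i a b _ h]; first by rewrite cabs0.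
by apply: le_trans (cabsD _ _) _; rewrite lerD2l.
Qed.

Lemma cabs_real t : cabs t%:C = `|t|.
Proof. by rewrite /= expr0n/= addr0 sqrtr_sqr. Qed.

Lemma mul_conj z : z * z^* = (cabs z ^+ 2)%:C.
Proof.
rewrite cabs_sqr; case: z => a b; apply/eqP; rewrite eq_complex /=.
by apply/andP; split; apply/eqP; ring.
Qed.

Lemma Re_le_cabs z : `|Re z| <= cabs z.
Proof.
rewrite -(@ler_pXn2r _ 2) ?nnegrE ?cabs_ge0// cabs_sqr real_normK ?num_real//.
by rewrite lerDl sqr_ge0.
Qed.

Lemma Im_le_cabs z : `|Im z| <= cabs z.
Proof.
rewrite -(@ler_pXn2r _ 2) ?nnegrE ?cabs_ge0// cabs_sqr real_normK ?num_real//.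
by rewrite lerDr sqr_ge0.
Qed.

Lemma cabs_le_ReIm z : cabs z <= `|Re z| + `|Im z|.
Proof.
rewrite -(@ler_pXn2r _ 2) ?nnegrE ?cabs_ge0 ?addr_ge0// cabs_sqr.
rewrite sqrrD !real_normK ?num_real// lerD2r lerDl.
by rewrite mulrn_wge0// mulr_ge0.
Qed.

Lemma expiD (s t : R) : expi (s + t) = expi s * expi t.
Proof.
rewrite /expi cosD sinD; apply/eqP; rewrite eq_complex /=.
by rewrite eqxx andTb addrC [X in _ == X]addrC; apply/eqP; ring.
Qed.

Lemma expi0 : expi (0 : R) = 1.
Proof. by rewrite /expi cos0 sin0. Qed.

Lemma cabs_expi t : cabs (expi t) = 1.
Proof. by rewrite /= cos2Dsin2 sqrtr1. Qed.

Lemma conj_expi t : (expi t)^* = expi (- t).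
Proof. by rewrite /expi cosN sinN. Qed.

Lemma cReM_real t z : Re (t%:C * z) = t * Re z.
Proof. by case: z => a b /=; rewrite mul0r subr0. Qed.

Lemma cReD z w : Re (z + w) = Re z + Re w.
Proof. by case: z w => ? ? []. Qed.
Lemma cImD z w : Im (z + w) = Im z + Im w.
Proof. by case: z w => ? ? []. Qed.
Lemma cReM z w : Re (z * w) = Re z * Re w - Im z * Im w.
Proof. by case: z w => ? ? []. Qed.
Lemma cImM z w : Im (z * w) = Re z * Im w + Im z * Re w.
Proof. by case: z w => ? ? []. Qed.

End ComplexModulus.

Section TorusContinuity.
Context {R : realType} {d : nat}.
Implicit Types (u v : 'rV[R]_d -> R[i]).

Definition tcontinuous u : Prop :=
  [/\ Zperiodic u, continuous (fun x => complex.Re (u x)) &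
      continuous (fun x => complex.Im (u x))].

Lemma tcontinuous_near u (x : 'rV[R]_d) (e : R) : tcontinuous u -> 0 < e ->
  exists2 r : R, 0 < r & forall y : 'rV[R]_d, (forall i, `|y 0 i - x 0 i| < r) ->
    cabs (u y - u x) < e.
Proof.
move=> [_ cR cI] e0.
have e20 : 0 < e / 2 by rewrite divr_gt0.
have /cvgrPdist_lt/(_ _ e20) hR := cR x.
have /cvgrPdist_lt/(_ _ e20) hI := cI x.
have /nbhs_ballP[r /= r0 hr] : nbhs x [set y |
    `|complex.Re (u x) - complex.Re (u y)| < e / 2 /\
    `|complex.Im (u x) - complex.Im (u y)| < e / 2] by exact: filterI.
exists r => // y yx; have /hr[/= h1 h2] : ball x r y.
  by split=> // i j; rewrite (ord1 i) -ball_normE/= distrC.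
rewrite -cabsN opprB; apply: le_lt_trans (cabs_le_ReIm _) _.
by rewrite [e]splitr ltrD//; case: (u x) (u y) h1 h2 => ? ? [].
Qed.

Lemma compact_unit_cube :
  compact [set x : 'rV[R]_d | forall i, 0 <= x 0 i <= 1].
Proof.
rewrite (_ : mkset _ = [set x : 'rV[R]_d | forall i, `[0, 1]%classic (x ord0 i)]).
  apply: (@rV_compact R d (fun=> `[0, 1]%classic)) => i; exact: segment_compact.
by apply/seteqP; split => x /= h i; have := h i; rewrite in_itv.
Qed.

Lemma Zperiodic_shift u (x : 'rV[R]_d) : Zperiodic u ->
  exists2 k : 'rV[int]_d, forall y, u (y + map_mx intr k) = u y &
    forall i, 0 <= (x + map_mx intr k) 0 i <= 1.
Proof.
move=> pu; exists (\row_i (- Num.floor (x 0 i))); first by move=> y; exact: pu.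
move=> i; rewrite !mxE /= rmorphN /=.
by have /andP[h1 h2] := floor_itv (x 0 i); rewrite rmorphD /= in h2; lra.
Qed.

(** Compactness yields a common radius for [x] in the unit cube; an integer translation of both
    points brings any other [x] there. *)
Lemma tcontinuous_unif u (e : R) : tcontinuous u -> 0 < e ->
  exists2 r : R, 0 < r & forall x y : 'rV[R]_d, (forall i, `|y 0 i - x 0 i| < r) ->
    cabs (u y - u x) < e.
Proof.
move=> cu e0; have [pu _ _] := cu.
have e20 : 0 < e / 2 by rewrite divr_gt0.
have /compact_near_coveringP/(_ R (0^'+)
  (fun r x => forall y : 'rV[R]_d, (forall i, `|y 0 i - x 0 i| < r) -> cabs (u y - u x) < e)) :=
  compact_unit_cube.
case => // [x Kx|].
  have [r r0 hr] := tcontinuous_near x cu e20.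
  have r20 : 0 < r / 2 by rewrite divr_gt0.
  (* Halved radii: [y] within [r / 2] of [x] and [w] within [r / 2] of [y] keep [w] within [r] of
     [x]. *)
  exists (ball x (r / 2), `]-oo, (r / 2)[%classic) => /=.
    split; first exact: nbhsx_ballx.
    exact: nbhs_right_lt.
  move=> [y r'] /= [[_ yx] r'r] w wy.
  rewrite -(subrKA (u x)) (le_lt_trans (cabsD _ _))// [e]splitr ltrD//.
    apply: hr => i; rewrite -(subrKA (y 0 i)) (le_lt_trans (ler_normD _ _))//.
    rewrite [r]splitr ltrD//.
      by apply: lt_trans (wy i) _; move: r'r; rewrite in_itv.
    by have := yx 0 i; rewrite -ball_normE /= distrC.
  rewrite -cabsN opprB; apply: hr => i.
  by have := yx 0 i; rewrite -ball_normE /= distrC => /lt_trans -> //; lra.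
move=> rr /= rr0 h; exists (rr / 2); first by rewrite divr_gt0.
move=> x y xy; have [k uk xk] := Zperiodic_shift x pu.
rewrite -(uk x) -(uk y); apply: (h (rr / 2)) => //.
- by rewrite /= sub0r normrN gtr0_norm ?divr_gt0// ltr_pdivrMr// ltr_pMr// ltr1n.
- by rewrite divr_gt0.
- by move=> i; rewrite !mxE opprD addrACA subrr addr0.
Qed.

End TorusContinuity.

Section Modulus.
Context {R : realType} {d : nat}.
Implicit Types (u v : 'rV[R]_d -> R[i]).

Lemma expi_2pi_int (k : int) : expi (2 * pi * k%:~R) = 1 :> R[i].
Proof.
have h (n : nat) : expi (2 * pi * n%:R) = 1 :> R[i].
  elim: n => [|n ih]; first by rewrite mulr0 expi0.
  rewrite -[n.+1%:R]natr1 mulrDr expiD ih mul1r mulr1 mulrC /expi.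
  by rewrite mulr_natr cos2pi sin2pi.
case: k => n; first by rewrite -pmulrn h.
by rewrite NegzE rmorphN /= mulrN -conj_expi -pmulrn h; exact: conjc1.
Qed.

Lemma expi_periodic (t : R) (k : int) : expi (2 * pi * (t + k%:~R)) = expi (2 * pi * t).
Proof. by rewrite mulrDr expiD expi_2pi_int mulr1. Qed.

Lemma cos_periodic (t : R) (k : int) : cos (2 * pi * (t + k%:~R)) = cos (2 * pi * t).
Proof. exact: (congr1 (@complex.Re R) (expi_periodic t k)). Qed.

Lemma tcontinuous_bounded u : tcontinuous u ->
  exists2 M : R, 0 <= M & forall x, cabs (u x) <= M.
Proof.
move=> cu; have [pu _ _] := cu.
have /compact_near_coveringP/(_ R (pinfty_nbhs R) (fun M x => cabs (u x) <= M)) :=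
  @compact_unit_cube R d.
case => [x Kx|M [_ hM]].
  have [r r0 hr] := tcontinuous_near x cu ltr01.
  exists (ball x r, `](cabs (u x) + 1), +oo[%classic) => /=.
    split; first exact: nbhsx_ballx.
    by exists (cabs (u x) + 1); split; [exact: num_real|move=> z /= ?; rewrite in_itv/= andbT].
  move=> [y M] /= [[_ yx] yM].
  have : cabs (u y - u x) < 1.
    by apply: hr => i; have := yx 0 i; rewrite -ball_normE /= distrC.
  have := cabsD (u y - u x) (u x); rewrite subrK.
  by move: yM; rewrite /= in_itv/= andbT; lra.
exists (`|M| + 1) => [|x]; first by rewrite addr_ge0.
have [k uk xk] := Zperiodic_shift x pu.
rewrite -uk; apply: hM => //.
by rewrite (le_lt_trans (ler_norm M))// ltrDl.
Qed.

(** A modulus of continuity that Fejer averages evaluate exactly. Modulo integers, two points are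
    either close, or differ in some coordinate by an amount where [1 - cos] is bounded below; there
    [C] times it dominates [2 M]. *)
Lemma tcontinuous_modulus u (e : R) : tcontinuous u -> 0 < e ->
  exists2 C : R, 0 <= C & forall x y : 'rV[R]_d,
    cabs (u y - u x) <= e + C * \sum_l (1 - cos (2 * pi * (y 0 l - x 0 l))).
Proof.
move=> cu e0; have [pu _ _] := cu.
have [M M0 uM] := tcontinuous_bounded cu.
have [r r0 hr] := tcontinuous_unif cu e0.
(* The bound 1/4 keeps [2 pi s] inside []0, pi[], where cosine decreases. *)
pose s := Num.min r 4^-1.
have s0 : 0 < s by rewrite lt_min r0 invr_gt0 ltr0n.
have s4 : s <= 4^-1 by rewrite ge_min lexx orbT.
have sr : s <= r by rewrite ge_min lexx.
have pi0 := @pi_gt0 R.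
have cos_anti (t : R) : s <= `|t| <= 2^-1 -> cos (2 * pi * t) <= cos (2 * pi * s).
  move=> /andP[st t2].
  have -> : cos (2 * pi * t) = cos (2 * pi * `|t|).
    have p0 : 0 <= 2 * pi :> R by rewrite mulr_ge0// ltW.
    by rewrite -cos_norm normrM (ger0_norm p0).
  by rewrite leNgt ltr_cos ?in_itv/= ?ltr_pM2l ?mulr_gt0// -?leNgt//;
    apply/andP; split; nra.
have eta0 : 0 < 1 - cos (2 * pi * s).
  rewrite subr_gt0 -[X in _ < X]cos0 ltr_cos ?mulr_gt0// in_itv/= ?lexx//; first nra.
  by apply/andP; split; nra.
exists (2 * M / (1 - cos (2 * pi * s))).
  by rewrite divr_ge0 ?mulr_ge0// ltW.
move=> x y.
have S0 (P : pred 'I_d) : 0 <= \sum_(l | P l) (1 - cos (2 * pi * (y 0 l - x 0 l))).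
  by apply: sumr_ge0 => l _; rewrite subr_ge0 cos_le1.
(* Reduction to the nearest integer: each coordinate of [y' - x] lies in [[-1/2, 1/2]]. *)
pose k : 'rV[int]_d := \row_i (- Num.floor (y 0 i - x 0 i + 2^-1)).
pose y' := y + map_mx intr k.
have y'2 i : `|y' 0 i - x 0 i| <= 2^-1.
  rewrite !mxE rmorphN /= ler_norml.
  have /andP[] := floor_itv (y 0 i - x 0 i + 2^-1).
  rewrite rmorphD /=; set f := (Num.floor _)%:~R; lra.
have [close|/existsNP[i /negP]] := pselect (forall i, `|y' 0 i - x 0 i| < r).
  rewrite -(pu y k) -/y' ler_wpDr// ?mulr_ge0 ?divr_ge0 ?mulr_ge0 ?S0 ?(ltW eta0)//.
  by rewrite ltW// hr.
rewrite -leNgt => hi.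
apply: (@le_trans _ _ (2 * M)).
  by apply: le_trans (cabsD _ _) _; rewrite cabsN mulr_natl mulr2n lerD.
apply: (ler_wpDl (ltW e0)); rewrite -[leRHS]mulrA ler_peMr// ?mulr_ge0// mulrC ler_pdivlMr// mul1r.
rewrite (bigD1 i)//= ler_wpDr ?S0// lerD2l lerN2.
have -> : cos (2 * pi * (y 0 i - x 0 i)) = cos (2 * pi * (y' 0 i - x 0 i)).
  rewrite -(cos_periodic _ (k 0 i)) /y' !mxE; congr (cos (_ * _)); ring.
by apply: cos_anti; rewrite y'2 (le_trans sr).
Qed.

End Modulus.

(** * Fejer kernels on a finite grid *)

Section FejerKernel.
Context {R : realType}.
Implicit Types (t : R) (n m : nat) (q : int).

Lemma expi_sum I (r : seq I) (P : pred I) (F : I -> R) :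
  expi (\sum_(i <- r | P i) F i) = \prod_(i <- r | P i) expi (F i).
Proof. by elim/big_rec2: _ => [|i a b _ <-]; rewrite ?expi0 ?expiD. Qed.

Lemma expi_mulrn t n : expi (t *+ n) = expi t ^+ n.
Proof. by elim: n => [|n ih]; rewrite ?mulr0n ?expi0// mulrS exprS expiD ih. Qed.

Lemma expi_neq1 (x : R) : 0 < x < pi -> expi (2 * x) != 1.
Proof.
move=> x0; have := sin_gt0_pi x0; rewrite mulr_natl => s0.
apply/eqP => /(congr1 (@complex.Re R)) /=.
rewrite cos_mulr2n cos2sin2 => h.
have : 0 < sin x ^+ 2 by rewrite exprn_gt0.
by move: h; rewrite mulr2n; lra.
Qed.

(** A geometric sum in an [m]-th root of unity [w]; since [|q| < m], [w = 1] only for [q = 0]. *)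
Lemma grid_sum m q t : (`|q| < m)%N ->
  \sum_(i < m) expi (2 * pi * (q%:~R * (t - i%:R / m%:R))) =
  (if q == 0 then m%:R else 0) :> R[i].
Proof.
move=> qm; have m0n : (0 < m)%N by rewrite (leq_ltn_trans _ qm).
have m0 : 0 < m%:R :> R by rewrite ltr0n.
have [->|q0] := eqVneq q 0.
  under eq_bigr do rewrite mul0r mulr0 expi0.
  by rewrite sumr_const card_ord.
set w : R[i] := expi (- (2 * pi * (q%:~R / m%:R))).
have E (i : 'I_m) : true -> expi (2 * pi * (q%:~R * (t - i%:R / m%:R))) =
    expi (2 * pi * (q%:~R * t)) * w ^+ i.
  move=> _; rewrite -expi_mulrn -expiD; congr expi.
  have -> : - (2 * pi * (q%:~R / m%:R)) *+ i = - (2 * pi * (q%:~R / m%:R)) * i%:R :> R.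
    by rewrite mulr_natr.
  by ring.
rewrite (eq_bigr _ E) -mulr_sumr.
have wm : w ^+ m = 1.
  have wE : - (2 * pi * (q%:~R / m%:R)) *+ m = - (2 * pi * q%:~R) :> R.
    by rewrite -[LHS]mulr_natr; field; rewrite gt_eqF.
  rewrite -expi_mulrn wE.
  by rewrite -conj_expi expi_2pi_int conjC1.
have w1 : w != 1.
  have : expi (2 * (pi * (`|q|%N%:R / m%:R))) != 1 :> R[i].
    apply: expi_neq1; rewrite mulr_gt0 ?pi_gt0 ?divr_gt0 ?ltr0n ?absz_gt0//=.
    by rewrite gtr_pMr ?pi_gt0// ltr_pdivrMr// mul1r ltr_nat.
  move=> /eqP h; apply/eqP => w1; apply: h.
  have [qE|qE] : q = `|q|%N \/ q = - (`|q|%N%:Z) by lia.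
    move: w1; rewrite /w {1}qE -pmulrn -mulrA => h.
    by rewrite -[LHS]conjCK conj_expi h conjC1.
  move: w1; rewrite /w {1}qE rmorphN /= -pmulrn.
  by rewrite mulNr mulrN opprK mulrA.
have : (w - 1) * \sum_(i < m) w ^+ i = 0 by rewrite -subrX1 wm subrr.
by move/eqP; rewrite mulf_eq0 subr_eq0 (negPf w1)/= => /eqP ->; rewrite mulr0.
Qed.

Definition fejer n t : R :=
  n%:R^-1 * cabs (\sum_(a < n) expi (2 * pi * (a%:R * t))) ^+ 2.

Lemma fejer_ge0 n t : 0 <= fejer n t.
Proof. by rewrite mulr_ge0 ?invr_ge0 ?sqr_ge0. Qed.

Lemma fejerE n t : (fejer n t)%:C = (n%:R^-1)%:C *
  \sum_(p : 'I_n * 'I_n) expi (2 * pi * ((p.1%:Z - p.2%:Z)%:~R * t)).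
Proof.
rewrite /fejer rmorphM /= -mul_conj rmorph_sum mulr_suml; congr (_ * _).
rewrite -(pair_bigA _ (fun a b : 'I_n => expi (2 * pi * ((a%:Z - b%:Z)%:~R * t)))) /=.
apply: eq_bigr => a _; rewrite mulr_sumr; apply: eq_bigr => b _.
rewrite [X in _ * X]conj_expi -expiD; congr expi.
by rewrite rmorphB /= -!pmulrn; ring.
Qed.

(** The frequencies [a - b] of the kernel are smaller than [m] in absolute value, so summation over
    the grid keeps exactly the [n] diagonal pairs. *)
Lemma fejer_avg n m t : (n < m)%N -> (0 < n)%N ->
  \sum_(i < m) m%:R^-1 * fejer n (t - i%:R / m%:R) = 1.
Proof.
move=> nm n0; apply: (@complexI R); rewrite rmorph_sum /=.
under eq_bigr do rewrite rmorphM /= fejerE mulrA.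
rewrite -mulr_sumr exchange_big /=.
rewrite (eq_bigr (fun p : 'I_n * 'I_n => if p.1 == p.2 then m%:R else 0)); last first.
  move=> [a b] _ /=; rewrite grid_sum; last first.
    by have := ltn_ord a; have := ltn_ord b; lia.
  by rewrite subr_eq0 eqz_nat.
rewrite -(pair_bigA _ (fun a b : 'I_n => if a == b then m%:R else 0 : R[i])) /=.
have E (a : 'I_n) : true -> \sum_(b < n) (if a == b then m%:R else 0) = m%:R :> R[i].
  by move=> _; rewrite -big_mkcond (big_pred1 a).
rewrite (eq_bigr _ E) sumr_const card_ord.
have -> : m%:R *+ n = (m%:R * n%:R)%:C :> R[i].
  by rewrite rmorphM !rmorph_nat mulr_natr.
rewrite -!rmorphM; congr (_%:C); field.
by rewrite !pnatr_eq0 -!lt0n n0 (ltn_trans n0).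
Qed.

(** Multiplication by the exponential turns the frequency [a - b] into [a - b + 1], still below [m].
    The [n - 1] pairs with [b = a + 1] survive, so the cosine has mean [1 - 1 / n]. *)
Lemma fejer_cos_avg n m t : (n < m)%N -> (0 < n)%N ->
  \sum_(i < m) m%:R^-1 * fejer n (t - i%:R / m%:R) *
     (1 - cos (2 * pi * (t - i%:R / m%:R))) = n%:R^-1.
Proof.
move=> nm n0.
under eq_bigr do rewrite mulrBr mulr1.
rewrite sumrB fejer_avg//.
suff : \sum_(i < m) (m%:R^-1 * fejer n (t - i%:R / m%:R))%:C *
     expi (2 * pi * (t - i%:R / m%:R)) = (1 - n%:R^-1)%:C.
  move=> /(congr1 (@complex.Re R)); rewrite raddf_sum /= => h.
  under eq_bigr do rewrite -[cos _]/(complex.Re (expi _)) -cReM_real.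
  by rewrite h subKr.
have EF (i : 'I_m) : true -> (m%:R^-1 * fejer n (t - i%:R / m%:R))%:C *
     expi (2 * pi * (t - i%:R / m%:R)) = ((m%:R^-1)%:C * (n%:R^-1)%:C) *
     \sum_(p : 'I_n * 'I_n) expi (2 * pi * ((p.1%:Z - p.2%:Z)%:~R *
       (t - i%:R / m%:R))) * expi (2 * pi * (t - i%:R / m%:R)).
  by move=> _; rewrite rmorphM /= fejerE -mulr_suml; ring.
rewrite (eq_bigr _ EF).
rewrite -mulr_sumr exchange_big /=.
rewrite (eq_bigr (fun p : 'I_n * 'I_n => if p.1.+1 == p.2 then m%:R else 0)); last first.
  move=> [a b] _ /=.
  rewrite (eq_bigr (fun i : 'I_m => expi (2 * pi * ((a%:Z - b%:Z + 1)%:~R *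
      (t - i%:R / m%:R))))); last first.
    move=> i _; rewrite -expiD; congr expi.
    by rewrite [(_ + 1)%:~R]rmorphD /=; ring.
  rewrite grid_sum; last first.
    by have := ltn_ord a; have := ltn_ord b; lia.
  by congr (if _ then _ else _); lia.
rewrite -(pair_bigA _ (fun a b : 'I_n => if a.+1 == b then m%:R else 0 : R[i])) /=.
clear EF; case: n n0 nm => [//|n] _ nm.
rewrite big_ord_recr /= [X in _ + X]big1 => [|b _]; last first.
  by rewrite gtn_eqF.
have E (a : 'I_n) : true -> \sum_(b < n.+1) (if a.+1 == b then m%:R else 0) = m%:R :> R[i].
  by move=> _; rewrite -big_mkcond (big_pred1 (lift ord0 a)).
rewrite (eq_bigr _ E) sumr_const card_ord addr0.
have -> : m%:R *+ n = (m%:R * n%:R)%:C :> R[i].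
  by rewrite rmorphM !rmorph_nat mulr_natr.
rewrite -!rmorphM; congr (_%:C); rewrite -[n.+1%:R]natr1; field.
by rewrite natr1 !pnatr_eq0 /= -lt0n (ltn_trans _ nm).
Qed.

End FejerKernel.

Section TrigDensity.
Context {R : realType} {d : nat}.
Implicit Types (u v : 'rV[R]_d -> R[i]) (s : seq (R[i] * 'rV[int]_d)).

Definition trigpoly s : 'rV[R]_d -> R[i] :=
  fun x => \sum_(q <- s) q.1 * fourier q.2 x.

Lemma dotZE (nu : 'rV[int]_d) (x : 'rV[R]_d) :
  dotZ nu x = \sum_i (nu 0 i)%:~R * x 0 i.
Proof. by []. Qed.

Lemma dotZBr (nu : 'rV[int]_d) (x y : 'rV[R]_d) :
  dotZ nu (x - y) = dotZ nu x - dotZ nu y.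
Proof. by rewrite /dotZ -sumrB; apply: eq_bigr => i _; rewrite !mxE mulrBr. Qed.

Lemma fourierB (nu : 'rV[int]_d) (x y : 'rV[R]_d) :
  fourier nu (x - y) = fourier nu x * (fourier nu y)^*.
Proof. by rewrite /fourier dotZBr mulrBr expiD conj_expi. Qed.

(** [T] averages the samples of [u] with weights of sum 1. Averaging the bound of
    [tcontinuous_modulus] with the same weights leaves the error [e / 2 + C d / n]. *)
Lemma trig_density u (e : R) : tcontinuous u -> 0 < e ->
  exists s, forall x, cabs (u x - trigpoly s x) <= e.
Proof.
move=> cu e0; have e20 : 0 < e / 2 by rewrite divr_gt0.
have [C C0 hC] := tcontinuous_modulus cu e20.
have [n n0 hn] : exists2 n, (0 < n)%N & C * d%:R / n%:R <= e / 2.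
  exists (Num.trunc (C * d%:R / (e / 2))).+1 => //.
  rewrite ler_pdivrMr ?ltr0n// -ler_pdivrMl// mulrC ltW//.
  exact: truncnS_gt.
(* The smallest grid size to which both Fejer averages apply. *)
pose m := n.+1.
pose pt (j : {ffun 'I_d -> 'I_m}) : 'rV[R]_d := \row_l ((j l)%:R / m%:R).
pose w (j : {ffun 'I_d -> 'I_m}) (x : 'rV[R]_d) : R :=
  \prod_l (m%:R^-1 * fejer n (x 0 l - (j l)%:R / m%:R)).
have w0 j x : 0 <= w j x.
  by apply: prodr_ge0 => l _; rewrite mulr_ge0 ?invr_ge0 ?fejer_ge0.
have w1 x : \sum_j w j x = 1.
  rewrite /w -(bigA_distr_bigA (fun l (i : 'I_m) =>
    m%:R^-1 * fejer n (x 0 l - i%:R / m%:R))).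
  by rewrite big1// => l _; rewrite fejer_avg.
have wcos x l : \sum_j w j x * (1 - cos (2 * pi * (x 0 l - pt j 0 l))) = n%:R^-1.
  have E (j : {ffun 'I_d -> 'I_m}) : true ->
      w j x * (1 - cos (2 * pi * (x 0 l - pt j 0 l))) =
      \prod_l' (m%:R^-1 * fejer n (x 0 l' - (j l')%:R / m%:R) *
        (if l' == l then 1 - cos (2 * pi * (x 0 l' - (j l')%:R / m%:R)) else 1)).
    move=> _; rewrite big_split /= -big_mkcond big_pred1_eq; congr (_ * _).
    by rewrite /pt mxE.
  rewrite (eq_bigr _ E) -(bigA_distr_bigA (fun l' (i : 'I_m) =>
    m%:R^-1 * fejer n (x 0 l' - i%:R / m%:R) *
        (if l' == l then 1 - cos (2 * pi * (x 0 l' - i%:R / m%:R)) else 1))).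
  rewrite (bigD1 l)//= eqxx fejer_cos_avg// big1 ?mulr1// => l' /negPf ->.
  by under eq_bigr do rewrite mulr1; rewrite fejer_avg.
pose T x := \sum_j (w j x)%:C * u (pt j).
have Tu x : cabs (u x - T x) <= e.
  have -> : u x - T x = \sum_j (w j x)%:C * (u x - u (pt j)).
    under eq_bigr do rewrite mulrBr.
    by rewrite sumrB -mulr_suml -rmorph_sum w1 mul1r.
  apply: le_trans (cabs_sum _ _ _) _.
  apply: (@le_trans _ _ (\sum_j (w j x * (e / 2) +
     C * \sum_l w j x * (1 - cos (2 * pi * (x 0 l - pt j 0 l)))))).
    apply: ler_sum => j _; rewrite cabsM cabs_real ger0_norm//.
    rewrite -mulr_sumr [leRHS](_ : _ = w j x * (e / 2 +
      C * \sum_l (1 - cos (2 * pi * (x 0 l - pt j 0 l))))); last by ring.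
    by rewrite ler_wpM2l.
  rewrite big_split /= -mulr_suml w1 mul1r -mulr_sumr exchange_big /=.
  under eq_bigr do rewrite wcos.
  rewrite sumr_const card_ord -[n%:R^-1 *+ d]mulr_natl mulrA.
  by rewrite [leRHS]splitr lerD2l.
(* Expanding the product of kernels selects a pair of indices in each coordinate; [fr P] is the
   resulting frequency. *)
pose fr (P : {ffun 'I_d -> 'I_n * 'I_n}) : 'rV[int]_d :=
  \row_l ((P l).1%:Z - (P l).2%:Z).
pose c : R[i] := \prod_(l < d) ((m%:R^-1 * n%:R^-1)%:C).
have wE j x : (w j x)%:C = c * \sum_P fourier (fr P) x * (fourier (fr P) (pt j))^*.
  rewrite /w rmorph_prod /=.
  under eq_bigr do rewrite rmorphM /= fejerE mulrA -rmorphM.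
  rewrite big_split /= -/c; congr (_ * _).
  rewrite (bigA_distr_bigA (fun l (p : 'I_n * 'I_n) =>
     expi (2 * pi * ((p.1%:Z - p.2%:Z)%:~R * (x 0 l - (j l)%:R / m%:R))))).
  apply: eq_bigr => P _; rewrite -expi_sum -mulr_sumr -fourierB.
  congr (expi (_ * _)); rewrite dotZE; apply: eq_bigr => l _.
  by rewrite !mxE.
exists [seq (\sum_j c * (fourier (fr P) (pt j))^* * u (pt j), fr P)
       | P <- index_enum {ffun 'I_d -> 'I_n * 'I_n}].
move=> x; suff <- : T x = trigpoly [seq (\sum_j c * (fourier (fr P) (pt j))^* * u (pt j), fr P)
       | P <- index_enum {ffun 'I_d -> 'I_n * 'I_n}] x by [].
rewrite /trigpoly big_map.
have -> : T x = \sum_j \sum_P c * (fourier (fr P) x * (fourier (fr P) (pt j))^*) * u (pt j).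
  by apply: eq_bigr => j _; rewrite wE mulr_sumr mulr_suml.
rewrite exchange_big /=; apply: eq_bigr => P _.
by rewrite mulr_suml; apply: eq_bigr => j _; ring.
Qed.

End TrigDensity.

(** * Integration over the torus *)

Section TorusIntegral.
Context {R : realType}.

Lemma measurable_cos_dotZ d (nu : 'rV[int]_d) (phi : R) :
  measurable_fun [set: d.-tuple (measurableTypeR R)]
    (fun x => cos (2 * pi * dotZ nu (torus_pt x) + phi)).
Proof.
apply: measurableT_comp; first exact: (@continuous_measurable_fun R cos (@continuous_cos R)).
apply: measurable_funD => //; apply: measurable_funM => //.
apply: measurable_sum => i; apply: measurable_funM => //.
under eq_fun do rewrite mxE.
exact: measurable_tnth.
Qed.

(** The constant 1 makes the integrand nonnegative, as Tonelli's theorem requires in the induction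
    on the dimension. The phase [phi] receives the first coordinate in that induction and produces
    sines from cosines. *)
Lemma integral_cos_uniform (k : int) (phi : R) : k != 0 ->
  (\int[uniform_prob (@ltr01 R)]_s (1 + cos (2 * pi * (k%:~R * s) + phi))%:E = 1)%E.
Proof.
move=> k0; have w0 : 2 * pi * k%:~R != 0 :> R.
  by rewrite !mulf_neq0 ?intr_eq0// gt_eqF ?pi_gt0.
have cc : continuous (fun s : R => 1 + cos (2 * pi * (k%:~R * s) + phi)).
  move=> s; apply: cvgD; first exact: cvg_cst.
  apply: continuous_comp; last exact: continuous_cos.
  apply: cvgD; last exact: cvg_cst.
  apply: cvgM; first exact: cvg_cst.
  by apply: cvgM; [exact: cvg_cst|exact: cvg_id].
rewrite integral_uniform; last 2 first.
- by apply/measurable_EFinP; exact: continuous_measurable_fun.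
- by move=> s; rewrite lee_fin -lerBlDl sub0r cos_geN1.
pose F (s : R) := s + (2 * pi * k%:~R)^-1 * sin (2 * pi * (k%:~R * s) + phi).
have dF (s : R) : is_derive s 1 F (1 + cos (2 * pi * (k%:~R * s) + phi)).
  have dl : is_derive s 1 (fun s : R => 2 * pi * (k%:~R * s) + phi) (2 * pi * k%:~R).
    have -> : (fun s : R => 2 * pi * (k%:~R * s) + phi) =
        ((2 * pi * k%:~R) \*: id) + cst phi.
      by apply/funext => y; rewrite mulrA.
    have h := is_deriveD (is_deriveZ (2 * pi * k%:~R) (is_derive_id s (1 : R)))
      (is_derive_cst phi s (1 : R)).
    by apply: is_derive_eq h _; rewrite addr0 -[_ *: _]/(_ * _) mulr1.
  have dsin := @is_derive1_comp R sin (fun s : R => 2 * pi * (k%:~R * s) + phi) s _ _ (is_derive_sin _) dl.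
  have -> : F = id + ((2 * pi * k%:~R)^-1 \*: (sin \o (fun s : R => 2 * pi * (k%:~R * s) + phi))).
    by apply/funext => y; rewrite /F.
  have h := is_deriveD (is_derive_id s (1 : R)) (is_deriveZ (2 * pi * k%:~R)^-1 dsin).
  by apply: is_derive_eq h _; rewrite /= -[_ *: _]/(_ * _) mulrCA mulVf// mulr1.
have cF : continuous F.
  by move=> s; apply: differentiable_continuous; apply/derivable1_diffP; exact: ex_derive.
rewrite (@continuous_FTC2 _ _ F)//; last 3 first.
- exact: continuous_subspaceT.
- split; first by move=> s _; exact: ex_derive.
  + exact: cvg_at_right_filter (cF 0).
  + exact: cvg_at_left_filter (cF 1).
- by move=> s _; rewrite derive1E; apply: derive_val.
rewrite subr0 invr1 mul1e -EFinD /F mulr1 !mulr0 !add0r.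
have -> : sin (2 * pi * k%:~R + phi) = sin phi.
  have e1 := @expi_2pi_int R k.
  have := congr1 (@complex.Re R) e1; have := congr1 (@complex.Im R) e1.
  by rewrite sinD /= => -> ->; rewrite mul0r mul1r add0r.
by rewrite -addrA subrr addr0.
Qed.

Lemma torus_pt_tcons d (p : R * d.-tuple R) (nu : 'rV[int]_d.+1) :
  dotZ nu (torus_pt (tcons p)) =
  (nu 0 ord0)%:~R * p.1 + dotZ (\row_i nu 0 (lift ord0 i)) (torus_pt p.2).
Proof.
rewrite /dotZ big_ord_recl !mxE tnth0; congr (_ + _).
by apply: eq_bigr => i _; rewrite !mxE tnthS.
Qed.

(** Induction on [d], the first coordinate [s] being absorbed into the phase. If the remaining
    frequency is nonzero, the inner integral is 1 for every [s]; otherwise only the integral over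
    [s] is left. *)
Lemma integral_cos_torus d (nu : 'rV[int]_d) (phi : R) : nu != 0 ->
  (\int[@torus_measure R d]_x (1 + cos (2 * pi * dotZ nu (torus_pt x) + phi))%:E
   = 1)%E.
Proof.
elim: d nu phi => [|d ih] nu phi nu0; first by rewrite thinmx0 eqxx in nu0.
have mf : measurable_fun [set: d.+1.-tuple (measurableTypeR R)]
    (fun x => (1 + cos (2 * pi * dotZ nu (torus_pt x) + phi))%:E).
  by apply/measurable_EFinP; apply: measurable_funD => //; exact: measurable_cos_dotZ.
have f0 (t : R) : (0 <= (1 + cos t)%:E)%E by rewrite lee_fin -lerBlDl sub0r cos_geN1.
rewrite /= ge0_integral_distribution//.
rewrite fubini_tonelli1; first last.
- by move=> x; exact: f0.
- by apply: (measurableT_comp mf); exact: measurable_tcons.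
rewrite /fubini_F /=.
pose nu' : 'rV[int]_d := \row_i nu 0 (lift ord0 i).
have E (s : R) (x : d.-tuple R) : 2 * pi * dotZ nu (torus_pt (tcons (s, x))) + phi =
    2 * pi * dotZ nu' (torus_pt x) + (2 * pi * ((nu 0 ord0)%:~R * s) + phi).
  by rewrite torus_pt_tcons /= mulrDr [X in X + phi]addrC addrA.
transitivity (\int[uniform_prob (@ltr01 R)]_s \int[@torus_measure R d]_x
    (1 + cos (2 * pi * dotZ nu' (torus_pt x) +
              (2 * pi * ((nu 0 ord0)%:~R * s) + phi)))%:E)%E.
  by apply: eq_integral => s _; apply: eq_integral => x _; rewrite -E.
have [nu'0|nu'0] := eqVneq nu' 0; last first.
  under eq_integral do rewrite ih//.
  rewrite integral_cst// mul1e.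
  exact: (@probability_setT _ _ _ (uniform_prob (@ltr01 R))).
have nu00 : nu 0 ord0 != 0.
  apply: contra nu0 => /eqP h; apply/eqP/rowP => i; rewrite mxE.
  have [->//|[j ->]] : i = ord0 \/ exists j, i = lift ord0 j.
    by case: (unliftP ord0 i) => [j ->|->]; [right; exists j|left].
  by have /rowP/(_ j) := nu'0; rewrite !mxE.
have E0 (x : d.-tuple R) : dotZ nu' (torus_pt x) = 0.
  by rewrite nu'0 /dotZ big1// => i _; rewrite mxE mul0r.
transitivity (\int[uniform_prob (@ltr01 R)]_s
    (1 + cos (2 * pi * ((nu 0 ord0)%:~R * s) + phi))%:E)%E.
  apply: eq_integral => s _.
  under eq_integral do rewrite E0 mulr0 add0r.
  rewrite integral_cst// [X in (_ * X)%E](_ : _ = 1%E) ?mule1//.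
  exact: (@probability_setT _ _ _ (@torus_measure R d)).
exact: integral_cos_uniform.
Qed.

End TorusIntegral.

Section BoundedMeasurable.
Context {R : realType} {d : nat}.
Implicit Types (f g : 'rV[R]_d -> R) (u v w : 'rV[R]_d -> R[i]).
Local Notation mu := (@torus_measure R d).

Definition tmeasurable f : Prop :=
  measurable_fun [set: d.-tuple (measurableTypeR R)] (fun x => f (torus_pt x)).

(** On a probability space these functions are integrable, and they are closed under sums and
    products, so integrals can be manipulated without separate integrability conditions. *)
Definition tbounded f : Prop :=
  tmeasurable f /\ exists M, forall x, `|f x| <= M.

Definition tint f : R := \int[mu]_x f (torus_pt x).

Lemma tbounded_integrable f : tbounded f ->
  mu.-integrable setT (EFin \o (fun x => f (torus_pt x))).
Proof.
move=> [mf [M fM]]; apply: measurable_bounded_integrable => //.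
  exact: (le_lt_trans (@probability_le1 _ _ _ mu setT measurableT) (ltry 1)).
exists M; split; first exact: num_real.
by move=> y My x _ /=; rewrite (le_trans (fM _))// ltW.
Qed.

Lemma tbounded_cst c : tbounded (fun=> c).
Proof. by split; [exact: measurable_cst|exists `|c|]. Qed.

Lemma tboundedD f g : tbounded f -> tbounded g -> tbounded (fun x => f x + g x).
Proof.
move=> [mf [M fM]] [mg [N gN]]; split; first exact: measurable_funD.
by exists (M + N) => x; rewrite (le_trans (ler_normD _ _))// lerD.
Qed.

Lemma tboundedM f g : tbounded f -> tbounded g -> tbounded (fun x => f x * g x).
Proof.
move=> [mf [M fM]] [mg [N gN]]; split; first exact: measurable_funM.
by exists (M * N) => x; rewrite normrM ler_pM.
Qed.

Lemma tboundedN f : tbounded f -> tbounded (fun x => - f x).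
Proof.
move=> hf; have := tboundedM (tbounded_cst (-1)) hf.
by under eq_fun do rewrite mulN1r.
Qed.

Lemma tintD f g : tbounded f -> tbounded g ->
  tint (fun x => f x + g x) = tint f + tint g.
Proof. by move=> hf hg; apply: RintegralD => //; exact: tbounded_integrable. Qed.

Lemma tintZ c f : tbounded f -> tint (fun x => c * f x) = c * tint f.
Proof. by move=> hf; apply: RintegralZl => //; exact: tbounded_integrable. Qed.

Lemma tintN f : tbounded f -> tint (fun x => - f x) = - tint f.
Proof.
move=> hf; rewrite -mulN1r -tintZ//; congr tint; apply/funext => x.
by rewrite mulN1r.
Qed.

Lemma tint_cst c : tint (fun=> c) = c.
Proof.
rewrite /tint Rintegral_cst//.
rewrite [X in fine X](_ : _ = 1%E) ?mulr1//.
exact: (@probability_setT _ _ _ mu).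
Qed.

Lemma le_tint f g : tbounded f -> tbounded g -> (forall x, f x <= g x) ->
  tint f <= tint g.
Proof. by move=> hf hg fg; apply: le_Rintegral => //; exact: tbounded_integrable. Qed.

Definition cbounded u : Prop :=
  tbounded (fun x => complex.Re (u x)) /\ tbounded (fun x => complex.Im (u x)).

Lemma cbounded_cst c : cbounded (fun=> c).
Proof. by split; exact: tbounded_cst. Qed.

Lemma cboundedD u v : cbounded u -> cbounded v -> cbounded (fun x => u x + v x).
Proof.
move=> [ru iu] [rv iv]; split.
  by under eq_fun do rewrite cReD; exact: tboundedD.
by under eq_fun do rewrite cImD; exact: tboundedD.
Qed.

Lemma cboundedM u v : cbounded u -> cbounded v -> cbounded (fun x => u x * v x).
Proof.
move=> [ru iu] [rv iv]; split.
  under eq_fun do rewrite cReM.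
  by apply: tboundedD; [|apply: tboundedN]; exact: tboundedM.
by under eq_fun do rewrite cImM; apply: tboundedD; exact: tboundedM.
Qed.

Lemma cbounded_conj u : cbounded u -> cbounded (fun x => (u x)^*).
Proof.
move=> [ru iu]; split.
  have -> // : (fun x => complex.Re (u x)^*) = (fun x => complex.Re (u x)).
  by apply/funext => x; case: (u x).
have -> : (fun x => complex.Im (u x)^*) = (fun x => - complex.Im (u x)).
  by apply/funext => x; case: (u x).
exact: tboundedN.
Qed.

Lemma cboundedZ c u : cbounded u -> cbounded (fun x => c * u x).
Proof. by move=> gu; apply: cboundedM => //; exact: cbounded_cst. Qed.

Lemma cboundedB u v : cbounded u -> cbounded v -> cbounded (fun x => u x - v x).
Proof.
move=> gu gv; have := cboundedD gu (cboundedZ (-1) gv).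
by under eq_fun do rewrite mulN1r.
Qed.

Lemma cbounded_sum I (r : seq I) (F : I -> 'rV[R]_d -> R[i]) :
  (forall i, cbounded (F i)) -> cbounded (fun x => \sum_(i <- r) F i x).
Proof.
move=> gF; elim: r => [|i r ih].
  by under eq_fun do rewrite big_nil; exact: cbounded_cst.
by under eq_fun do rewrite big_cons; exact: cboundedD.
Qed.

Lemma cbounded_fourier (nu : 'rV[int]_d) : cbounded (fourier nu).
Proof.
split; (split; last by exists 1 => x /=; rewrite ?cos_max ?sin_max).
  by have := @measurable_cos_dotZ R d nu 0; under eq_fun do rewrite addr0.
have := @measurable_cos_dotZ R d nu (- (pi / 2)).
by under eq_fun do rewrite cosBpihalf.
Qed.

(** Measurability for the product sigma-algebra on tuples comes from [trig_density]: [u] is a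
    pointwise limit of trigonometric polynomials, which are measurable coordinate by coordinate. *)
Lemma tcontinuous_cbounded u : tcontinuous u -> cbounded u.
Proof.
move=> cu; have [M M0 uM] := tcontinuous_bounded cu.
have /choice[s hs] (n : nat) :
    exists s, forall x, cabs (u x - trigpoly s x) <= n.+1%:R^-1.
  by apply: trig_density.
have gs n : cbounded (trigpoly (s n)).
  by apply: cbounded_sum => q; exact/cboundedZ/cbounded_fourier.
have conv (f : R[i] -> R) : (forall z1 z2, `|f z1 - f z2| <= cabs (z1 - z2)) ->
    forall x, (fun n => f (trigpoly (s n) x)) @ \oo --> f (u x).
  move=> hf x; apply/cvgrPdist_le => e e0.
  near=> n; apply: le_trans (hf _ _) _; apply: le_trans (hs _ _) _.
  by apply/ltW; near: n; exact: near_infty_natSinv_lt (PosNum e0).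
split; split.
- apply: (measurable_fun_cvg (h := fun n x => complex.Re (trigpoly (s n) (torus_pt x)))).
    by move=> n; have [[]] := gs n.
  move=> x _; apply: conv => z1 z2.
  by apply: le_trans (Re_le_cabs _); rewrite cReD; case: z2.
- by exists M => x; apply: le_trans (Re_le_cabs _) (uM x).
- apply: (measurable_fun_cvg (h := fun n x => complex.Im (trigpoly (s n) (torus_pt x)))).
    by move=> n; have [_ []] := gs n.
  move=> x _; apply: conv => z1 z2.
  by apply: le_trans (Im_le_cabs _); rewrite cImD; case: z2.
- by exists M => x; apply: le_trans (Im_le_cabs _) (uM x).
Unshelve. all: by end_near. Qed.

Lemma cintegralE u : cintegral u =
  tint (fun x => complex.Re (u x)) +i* tint (fun x => complex.Im (u x)).
Proof. by []. Qed.

Lemma cintegralD u v : cbounded u -> cbounded v ->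
  cintegral (fun x => u x + v x) = cintegral u + cintegral v.
Proof.
move=> [ru iu] [rv iv]; rewrite !cintegralE.
under [X in tint X]eq_fun do rewrite cReD.
under [X in _ +i* tint X]eq_fun do rewrite cImD.
by rewrite !tintD.
Qed.

Lemma cintegralZ c u : cbounded u -> cintegral (fun x => c * u x) = c * cintegral u.
Proof.
move=> [ru iu]; rewrite !cintegralE.
under [X in tint X]eq_fun do rewrite cReM -mulNr.
under [X in _ +i* tint X]eq_fun do rewrite cImM.
have b a f : tbounded f -> tbounded (fun x => a * f x).
  by move=> hf; apply: tboundedM => //; exact: tbounded_cst.
rewrite !tintD//; try exact: b.
by rewrite !tintZ// mulNr; case: c.
Qed.

Lemma cintegral_sum I (r : seq I) (F : I -> 'rV[R]_d -> R[i]) :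
  (forall i, cbounded (F i)) ->
  cintegral (fun x => \sum_(i <- r) F i x) = \sum_(i <- r) cintegral (F i).
Proof.
move=> gF; elim: r => [|i r ih].
  under eq_fun do rewrite big_nil.
  by rewrite big_nil cintegralE !tint_cst.
under eq_fun do rewrite big_cons.
by rewrite cintegralD// ?big_cons ?ih//; exact: cbounded_sum.
Qed.

Lemma cintegral_conj u : cbounded u -> cintegral (fun x => (u x)^*) = (cintegral u)^*.
Proof.
move=> [_ iu]; rewrite !cintegralE -[RHS]/(_ +i* - _) -tintN//.
by congr (tint _ +i* tint _); apply/funext => x; case: (u x).
Qed.

Lemma cintegral_fourier (nu : 'rV[int]_d) :
  cintegral (fourier nu : 'rV[R]_d -> R[i]) = (nu == 0)%:R.
Proof.
have [->|nu0] := eqVneq nu 0.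
  have E (x : 'rV[R]_d) : fourier 0 x = 1.
    by rewrite /fourier /dotZ big1 ?mulr0 ?expi0// => i _; rewrite mxE mul0r.
  have -> : (fourier 0 : 'rV[R]_d -> R[i]) = fun=> 1 by apply/funext.
  by rewrite cintegralE !tint_cst.
have h (phi : R) : tint (fun x => cos (2 * pi * dotZ nu x + phi)) = 0.
  have b : tbounded (fun x => cos (2 * pi * dotZ nu x + phi)).
    by split; [exact: measurable_cos_dotZ|exists 1 => x; exact: cos_max].
  have : tint (fun x => 1 + cos (2 * pi * dotZ nu x + phi)) = 1.
    by rewrite /tint /Rintegral integral_cos_torus.
  rewrite tintD//; last exact: tbounded_cst.
  by rewrite tint_cst => /(congr1 (fun y => y - 1)); rewrite addrAC subrr add0r.
(* Phase 0 gives the real part, phase [- pi / 2] the imaginary part. *)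
have hc := h 0; have hs := h (- (pi / 2)).
rewrite cintegralE -[RHS]/(0 +i* 0); congr (_ +i* _).
  by rewrite -[RHS]hc; congr tint; apply/funext => x; rewrite addr0.
by rewrite -[RHS]hs; congr tint; apply/funext => x; rewrite cosBpihalf.
Qed.

End BoundedMeasurable.

(** * Orthogonality, Bessel and Parseval *)

Section InnerProduct.
Context {R : realType} {d : nat}.
Implicit Types (u v w : 'rV[R]_d -> R[i]) (mu nu : 'rV[int]_d).

Definition sqn u : R := tint (fun x => cabs (u x) ^+ 2).

Lemma tbounded_sq u : cbounded u -> tbounded (fun x => cabs (u x) ^+ 2).
Proof.
move=> [ru iu]; have := tboundedD (tboundedM ru ru) (tboundedM iu iu).
by under eq_fun do rewrite -!expr2 -cabs_sqr.
Qed.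

Lemma sqn_ge0 u : 0 <= sqn u.
Proof. by apply: Rintegral_ge0 => x _; exact: sqr_ge0. Qed.

Lemma inner_self u : inner u u = (sqn u)%:C.
Proof.
rewrite /inner; under eq_fun do rewrite mul_conj.
by rewrite cintegralE /= tint_cst.
Qed.

Lemma sqnZ c u : cbounded u -> sqn (fun x => c * u x) = cabs c ^+ 2 * sqn u.
Proof.
move=> gu; rewrite -tintZ; last exact: tbounded_sq.
by congr tint; apply/funext => x; rewrite cabsM exprMn.
Qed.

(** Integrates the pointwise bound [(p + q)^2 <= (1 + b'/a') p^2 + (1 + a'/b') q^2], whose right
    side becomes [(a' + b')^2]. Adding [e / 2] to both norms keeps the quotients meaningful when a
    norm is 0. *)
Lemma sqn_triangle u v : cbounded u -> cbounded v ->
  Num.sqrt (sqn (fun x => u x + v x)) <= Num.sqrt (sqn u) + Num.sqrt (sqn v).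
Proof.
move=> gu gv; set a := Num.sqrt (sqn u); set b := Num.sqrt (sqn v).
have a0 : 0 <= a by exact: sqrtr_ge0.
have b0 : 0 <= b by exact: sqrtr_ge0.
apply/ler_addgt0Pr => e e0.
set a' := a + e / 2; set b' := b + e / 2.
have a'0 : 0 < a' by rewrite ltr_wpDl// divr_gt0.
have b'0 : 0 < b' by rewrite ltr_wpDl// divr_gt0.
have -> : a + b + e = a' + b' by rewrite /a' /b'; lra.
have ab0 : 0 <= a' + b' by rewrite addr_ge0// ltW.
rewrite -(ger0_norm ab0) -sqrtr_sqr ler_sqrt ?sqr_ge0//.
have bu := tbounded_sq gu; have bv := tbounded_sq gv.
have bc c f : tbounded f -> tbounded (fun x : 'rV[R]_d => c * f x).
  by move=> hf; apply: tboundedM => //; exact: tbounded_cst.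
apply: (@le_trans _ _ (tint (fun x => (1 + b' / a') * cabs (u x) ^+ 2 +
   (1 + a' / b') * cabs (v x) ^+ 2))).
  apply: le_tint; first exact/tbounded_sq/cboundedD.
    by apply: tboundedD; exact: bc.
  move=> x; apply: (@le_trans _ _ ((cabs (u x) + cabs (v x)) ^+ 2)).
    by rewrite ler_pXn2r ?nnegrE ?addr_ge0 ?cabs_ge0 ?cabsD.
  have := sqr_ge0 (b' * cabs (u x) - a' * cabs (v x)).
  have ab1 : 0 < a' * b' by rewrite mulr_gt0.
  move=> h; rewrite -subr_ge0 -(pmulr_rge0 _ ab1).
  apply: le_trans h _; rewrite le_eqVlt; apply/orP; left; apply/eqP.
  by field; rewrite !gt_eqF.
rewrite tintD; [|exact: bc..]; rewrite !tintZ//.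
have uE : tint (fun x => cabs (u x) ^+ 2) <= a' ^+ 2.
  rewrite -[leLHS]sqr_sqrtr ?sqn_ge0// ler_pXn2r ?nnegrE ?sqrtr_ge0 ?ltW//.
  by rewrite /a' ltrDl divr_gt0.
have vE : tint (fun x => cabs (v x) ^+ 2) <= b' ^+ 2.
  rewrite -[leLHS]sqr_sqrtr ?sqn_ge0// ler_pXn2r ?nnegrE ?sqrtr_ge0 ?ltW//.
  by rewrite /b' ltrDl divr_gt0.
have -> : (a' + b') ^+ 2 = (1 + b' / a') * a' ^+ 2 + (1 + a' / b') * b' ^+ 2.
  by field; rewrite !gt_eqF.
by apply: lerD; rewrite ler_wpM2l// addr_ge0// divr_ge0// ltW.
Qed.

Lemma innerDl u v w : cbounded u -> cbounded v -> cbounded w ->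
  inner (fun x => u x + v x) w = inner u w + inner v w.
Proof.
move=> gu gv gw; rewrite /inner; under eq_fun do rewrite mulrDl.
by rewrite cintegralD//; apply: cboundedM => //; exact: cbounded_conj.
Qed.

Lemma innerZl c u v : cbounded u -> cbounded v ->
  inner (fun x => c * u x) v = c * inner u v.
Proof.
move=> gu gv; rewrite /inner; under eq_fun do rewrite -mulrA.
by rewrite cintegralZ//; apply: cboundedM => //; exact: cbounded_conj.
Qed.

Lemma inner_suml I (r : seq I) (c : I -> R[i]) (F : I -> 'rV[R]_d -> R[i]) v :
  (forall i, cbounded (F i)) -> cbounded v ->
  inner (fun x => \sum_(i <- r) c i * F i x) v = \sum_(i <- r) c i * inner (F i) v.
Proof.
move=> gF gv; rewrite /inner; under eq_fun do rewrite mulr_suml.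
rewrite cintegral_sum; last first.
  by move=> i; apply: cboundedM; [exact: cboundedZ|exact: cbounded_conj].
by apply: eq_bigr => i _; rewrite -[RHS]innerZl.
Qed.

Lemma inner_conj u v : cbounded u -> cbounded v -> inner v u = (inner u v)^*.
Proof.
move=> gu gv; rewrite /inner -cintegral_conj; last first.
  by apply: cboundedM => //; exact: cbounded_conj.
by congr cintegral; apply/funext => x; rewrite rmorphM /= conjCK mulrC.
Qed.

Lemma fourierD mu nu (x : 'rV[R]_d) :
  fourier (mu + nu) x = fourier mu x * fourier nu x.
Proof.
rewrite /fourier -expiD -mulrDr; congr (expi (_ * _)); rewrite /dotZ -big_split.
by apply: eq_bigr => i _; rewrite !mxE rmorphD mulrDl.
Qed.

Lemma fourierN nu (x : 'rV[R]_d) : fourier (- nu) x = (fourier nu x)^*.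
Proof.
rewrite /fourier conj_expi; congr expi; rewrite -mulrN; congr (_ * _).
by rewrite /dotZ -sumrN; apply: eq_bigr => i _; rewrite !mxE rmorphN mulNr.
Qed.

Lemma inner_fourier mu nu :
  inner (fourier mu : 'rV[R]_d -> R[i]) (fourier nu) = (mu == nu)%:R.
Proof.
rewrite /inner; under eq_fun do rewrite -fourierN -fourierD.
by rewrite cintegral_fourier subr_eq0.
Qed.

Lemma fcoef_mul_fourier u nu mu :
  fcoef (fun x => u x * fourier nu x) mu = fcoef u (mu - nu).
Proof.
rewrite /fcoef /inner; congr cintegral; apply/funext => x.
by rewrite -mulrA -!fourierN -fourierD opprB.
Qed.

Definition fproj u (F : seq 'rV[int]_d) : 'rV[R]_d -> R[i] :=
  fun x => \sum_(nu <- F) fcoef u nu * fourier nu x.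

Lemma cbounded_fproj u F : cbounded (fproj u F).
Proof. by apply: cbounded_sum => nu; exact/cboundedZ/cbounded_fourier. Qed.

Lemma fcoef_trig (F : seq 'rV[int]_d) (c : 'rV[int]_d -> R[i]) nu : uniq F ->
  fcoef (fun x => \sum_(mu <- F) c mu * fourier mu x) nu =
  if nu \in F then c nu else 0.
Proof.
move=> uF; rewrite /fcoef inner_suml; [|exact: cbounded_fourier..].
under eq_bigr do rewrite inner_fourier.
case: ifPn => [nuF|nuF].
  rewrite (bigD1_seq nu)//= eqxx mulr1 big1 ?addr0// => mu /negPf ->.
  by rewrite mulr0.
rewrite big_seq big1// => mu muF; case: eqVneq => [E|_]; last by rewrite mulr0.
by rewrite -E muF in nuF.
Qed.

Lemma inner_fproj_diff u F nu : cbounded u -> uniq F -> nu \in F ->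
  inner (fun x => u x - fproj u F x) (fourier nu) = 0.
Proof.
move=> gu uF nuF.
have -> : (fun x => u x - fproj u F x) = (fun x => u x + (-1) * fproj u F x).
  by apply/funext => x; rewrite mulN1r.
have gF := cbounded_fproj u F; have gn := @cbounded_fourier R d nu.
rewrite innerDl//; last exact: cboundedZ.
by rewrite innerZl// [inner (fproj _ _) _]fcoef_trig// nuF mulN1r subrr.
Qed.

Lemma inner_trig_orth g I (r : seq I) (c : I -> R[i]) (nu : I -> 'rV[int]_d) :
  cbounded g -> (forall i, i \in [seq nu i | i <- r] -> inner g (fourier i) = 0) ->
  inner g (fun x => \sum_(i <- r) c i * fourier (nu i) x) = 0.
Proof.
move=> gg h; have gt : cbounded (fun x : 'rV[R]_d => \sum_(i <- r) c i * fourier (nu i) x).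
  by apply: cbounded_sum => i; exact/cboundedZ/cbounded_fourier.
rewrite (inner_conj gt gg) inner_suml//; last by move=> i; exact: cbounded_fourier.
elim: r h {gt} => [|i r ih] h; first by rewrite big_nil conjC0.
rewrite big_cons rmorphD /= ih ?addr0; last first.
  by move=> j jr; apply: h; rewrite inE jr orbT.
rewrite rmorphM /= -(inner_conj _ gg); last exact: cbounded_fourier.
by rewrite h ?mulr0// mem_head.
Qed.

Lemma sqn_fproj u F : cbounded u -> uniq F ->
  sqn u = sqn (fun x => u x - fproj u F x) + \sum_(nu <- F) cabs (fcoef u nu) ^+ 2.
Proof.
move=> gu uF; set g := fun x => u x - fproj u F x.
have gF := cbounded_fproj u F; have gg : cbounded g by exact: cboundedB.
apply: (@complexI R).
have -> : (sqn g + \sum_(nu <- F) cabs (fcoef u nu) ^+ 2)%:C =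
    (sqn g)%:C + \sum_(nu <- F) (cabs (fcoef u nu) ^+ 2)%:C.
  by rewrite rmorphD rmorph_sum.
rewrite -(inner_self u) -(inner_self g).
have uE : u = fun x => g x + fproj u F x by apply/funext => x; rewrite subrK.
have ort : inner g (fproj u F) = 0.
  apply: inner_trig_orth => // nu; rewrite map_id => nuF.
  exact: inner_fproj_diff.
rewrite {1}uE innerDl//; congr (_ + _).
  rewrite (inner_conj gu gg) {1}uE innerDl// rmorphD /=.
  by rewrite -(inner_conj gg gg) -(inner_conj gF gg) ?ort ?addr0.
rewrite /fproj inner_suml//; last by move=> nu; exact: cbounded_fourier.
apply: eq_bigr => nu _; rewrite -[RHS]mul_conj (inner_conj gu)//.
exact: cbounded_fourier.
Qed.

Lemma bessel u F : cbounded u -> uniq F ->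
  \sum_(nu <- F) cabs (fcoef u nu) ^+ 2 <= sqn u.
Proof. by move=> gu uF; rewrite (sqn_fproj gu uF) lerDr sqn_ge0. Qed.

Lemma sqn_trig (F : seq 'rV[int]_d) (c : 'rV[int]_d -> R[i]) : uniq F ->
  sqn (fun x => \sum_(nu <- F) c nu * fourier nu x) = \sum_(nu <- F) cabs (c nu) ^+ 2.
Proof.
move=> uF; set h := (fun x => _).
have gh : cbounded h by apply: cbounded_sum => nu; exact/cboundedZ/cbounded_fourier.
have cE nu : nu \in F -> fcoef h nu = c nu by rewrite fcoef_trig// => ->.
rewrite (sqn_fproj gh uF) [X in X + _](_ : _ = 0) ?add0r.
  by rewrite big_seq [RHS]big_seq; apply: eq_bigr => nu /cE ->.
have -> : (fun x => h x - fproj h F x) = fun=> 0.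
  apply/funext => x; rewrite /fproj /h -sumrB big_seq big1// => nu /cE.
  by rewrite /h => ->; rewrite subrr.
by rewrite /sqn; under eq_fun do rewrite cabs0 expr0n; rewrite tint_cst.
Qed.

(** Completeness in the form used later: a bound on all finite sums of squared coefficients bounds
    the norm. Projecting on the frequencies of a uniformly close trigonometric polynomial leaves a
    residual no larger than the distance to that polynomial. *)
Lemma parseval_le u (K : R) : tcontinuous u ->
  (forall F, uniq F -> \sum_(nu <- F) cabs (fcoef u nu) ^+ 2 <= K) -> sqn u <= K.
Proof.
move=> cu hK; have gu := tcontinuous_cbounded cu.
apply/ler_addgt0Pr => e e0; pose e' := Num.min 1 e.
have e'0 : 0 < e' by rewrite lt_min ltr01.
have e'e : e' ^+ 2 <= e.
  have e'1 : e' <= 1 by rewrite ge_min lexx.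
  have : e' <= e by rewrite ge_min lexx orbT.
  nra.
have [s us] := trig_density cu e'0.
pose F := undup [seq q.2 | q <- s]; have uF : uniq F := undup_uniq _.
set g := fun x => u x - fproj u F x.
have gF := cbounded_fproj u F; have gg : cbounded g by exact: cboundedB.
have gP : cbounded (trigpoly s) by apply: cbounded_sum => q; exact/cboundedZ/cbounded_fourier.
have oF nu : nu \in F -> inner g (fourier nu) = 0 by exact: inner_fproj_diff.
have oP : inner g (trigpoly s) = 0.
  apply: inner_trig_orth => // nu nus; apply: oF.
  by rewrite mem_undup.
have oproj : inner g (fproj u F) = 0.
  by apply: inner_trig_orth => // nu; rewrite map_id; exact: oF.
pose w x := u x - trigpoly s x; have gw : cbounded w by exact: cboundedB.
(* [g] is orthogonal both to [fproj u F] and to the approximating polynomial. *)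
have gE : inner g g = inner g w.
  have e1 : inner g u = inner g g.
    rewrite (inner_conj gu gg).
    have -> : u = fun x => g x + fproj u F x by apply/funext => x; rewrite subrK.
    by rewrite innerDl// rmorphD /= -!(inner_conj _ gg)// oproj addr0.
  rewrite -e1 (inner_conj gu gg) (inner_conj gw gg); congr (_^*).
  have -> : u = fun x => w x + trigpoly s x by apply/funext => x; rewrite subrK.
  by rewrite innerDl// -[inner (trigpoly s) g]conjCK -(inner_conj gP gg) oP conjC0 addr0.
have sg : sqn g <= e' ^+ 2.
  have h1 : sqn g <= 2^-1 * sqn g + 2^-1 * sqn w.
    rewrite {1}(_ : sqn g = complex.Re (inner g w)); last by rewrite -gE inner_self.
    have b1 := tbounded_sq gg; have b2 := tbounded_sq gw.
    have bc f : tbounded f -> tbounded (fun x : 'rV[R]_d => 2^-1 * f x).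
      by move=> hf; apply: tboundedM => //; exact: tbounded_cst.
    rewrite -!tintZ// -tintD; [|exact: bc..].
    rewrite -[leLHS]/(tint (fun x => complex.Re (g x * (w x)^*))).
    apply: le_tint.
    - by have [] := cboundedM gg (cbounded_conj gw).
    - by apply: tboundedD; exact: bc.
    move=> x; rewrite !cabs_sqr; case: (g x) (w x) => a b [p q] /=.
    by have := sqr_ge0 (a - p); have := sqr_ge0 (b - q); lra.
  have h2 : sqn w <= e' ^+ 2.
    rewrite -(@tint_cst R d (e' ^+ 2)); apply: le_tint.
    - exact: tbounded_sq.
    - exact: tbounded_cst.
    by move=> x; rewrite ler_pXn2r ?nnegrE ?cabs_ge0 ?us// ltW.
  lra.
rewrite (sqn_fproj gu uF) addrC lerD ?hK//.
exact: le_trans sg e'e.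
Qed.

End InnerProduct.

Section TContinuousClosure.
Context {R : realType} {d : nat}.
Implicit Types (u v : 'rV[R]_d -> R[i]) (nu : 'rV[int]_d).

Lemma tcontinuous_cst c : tcontinuous (fun=> c : R[i]) (R := R) (d := d).
Proof.
split; first by [].
  exact: (@cst_continuous _ _ (complex.Re c)).
exact: (@cst_continuous _ _ (complex.Im c)).
Qed.

Lemma tcontinuousD u v : tcontinuous u -> tcontinuous v ->
  tcontinuous (fun x => u x + v x).
Proof.
move=> [pu ru iu] [pv rv iv]; split; first by move=> x k; rewrite pu pv.
- have -> : (fun x => complex.Re (u x + v x)) =
      (fun x => complex.Re (u x) + complex.Re (v x)).
    by apply/funext => x; rewrite cReD.
  by move=> x; exact: (continuousD (ru x) (rv x)).
- have -> : (fun x => complex.Im (u x + v x)) =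
      (fun x => complex.Im (u x) + complex.Im (v x)).
    by apply/funext => x; rewrite cImD.
  by move=> x; exact: (continuousD (iu x) (iv x)).
Qed.

Lemma tcontinuousM u v : tcontinuous u -> tcontinuous v ->
  tcontinuous (fun x => u x * v x).
Proof.
move=> [pu ru iu] [pv rv iv]; split; first by move=> x k; rewrite pu pv.
- have -> : (fun x => complex.Re (u x * v x)) = (fun x =>
      complex.Re (u x) * complex.Re (v x) - complex.Im (u x) * complex.Im (v x)).
    by apply/funext => x; rewrite cReM.
  by move=> x; exact: (continuousB (continuousM (ru x) (rv x)) (continuousM (iu x) (iv x))).
- have -> : (fun x => complex.Im (u x * v x)) = (fun x =>
      complex.Re (u x) * complex.Im (v x) + complex.Im (u x) * complex.Re (v x)).
    by apply/funext => x; rewrite cImM.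
  by move=> x; exact: (continuousD (continuousM (ru x) (iv x)) (continuousM (iu x) (rv x))).
Qed.

Lemma tcontinuous_sum I (r : seq I) (F : I -> 'rV[R]_d -> R[i]) :
  (forall i, tcontinuous (F i)) -> tcontinuous (fun x => \sum_(i <- r) F i x).
Proof.
move=> cF; elim: r => [|i r ih].
  by under eq_fun do rewrite big_nil; exact: tcontinuous_cst.
by under eq_fun do rewrite big_cons; exact: tcontinuousD.
Qed.

Lemma continuous_dotZ nu : continuous (dotZ nu : 'rV[R]_d -> R).
Proof.
rewrite /dotZ; elim: (index_enum _) => [|i r ih] x.
  under eq_fun do rewrite big_nil.
  exact: (@cst_continuous _ _ (0 : R)).
under eq_fun do rewrite big_cons.
apply: (continuousD (continuousM _ (@coord_continuous _ _ _ 0 i x)) (ih x)).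
exact: cst_continuous.
Qed.

Lemma fourier_addr nu (x y : 'rV[R]_d) :
  fourier nu (x + y) = fourier nu x * fourier nu y.
Proof.
rewrite /fourier -expiD -mulrDr; congr (expi (_ * _)); rewrite /dotZ -big_split.
by apply: eq_bigr => i _; rewrite mxE mulrDr.
Qed.

Lemma tcontinuous_fourier nu : tcontinuous (fourier nu : 'rV[R]_d -> R[i]).
Proof.
have c2 : continuous (fun x : 'rV[R]_d => 2 * pi * dotZ nu x).
  move=> x; apply: (continuousM _ (@continuous_dotZ nu x)).
  exact: cst_continuous.
split=> [x k|x|x].
- rewrite /fourier (_ : dotZ nu (x + _) = dotZ nu x + (zdot nu k)%:~R).
    exact: expi_periodic.
  rewrite /dotZ rmorph_sum -big_split; apply: eq_bigr => i _.
  by rewrite !mxE mulrDr rmorphM.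
- apply: (@continuous_comp _ _ _ (fun x : 'rV[R]_d => 2 * pi * dotZ nu x) cos).
    exact: c2.
  exact: continuous_cos.
- apply: (@continuous_comp _ _ _ (fun x : 'rV[R]_d => 2 * pi * dotZ nu x) sin).
    exact: c2.
  exact: continuous_sin.
Qed.

Lemma tcontinuous_shift u y : tcontinuous u -> tcontinuous (fun x => u (x + y)).
Proof.
move=> [pu ru iu]; split=> [x k|x|x]; first by rewrite addrAC pu.
  apply: (@continuous_comp _ _ _ (fun x : 'rV[R]_d => x + y) (fun x => complex.Re (u x))).
    by apply: continuousD; [exact: cvg_id|exact: cst_continuous].
  exact: ru.
apply: (@continuous_comp _ _ _ (fun x : 'rV[R]_d => x + y) (fun x => complex.Im (u x))).
  by apply: continuousD; [exact: cvg_id|exact: cst_continuous].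
exact: iu.
Qed.

Lemma tcontinuous_Re u : tcontinuous u ->
  tcontinuous (fun x => (complex.Re (u x))%:C).
Proof.
move=> [pu ru iu]; split=> /=; [by move=> x k; rewrite pu|by []|].
exact: (@cst_continuous _ _ (0 : R)).
Qed.

Lemma tcontinuous_Im u : tcontinuous u ->
  tcontinuous (fun x => (complex.Im (u x))%:C).
Proof.
move=> [pu ru iu]; split=> /=; [by move=> x k; rewrite pu|by []|].
exact: (@cst_continuous _ _ (0 : R)).
Qed.

Lemma cabs_cintegral_le u (M : R) : cbounded u -> (forall x, cabs (u x) <= M) ->
  cabs (cintegral u) <= M + M.
Proof.
move=> [ru iu] uM; apply: le_trans (cabs_le_ReIm _) _.
have h (f : 'rV[R]_d -> R) : tbounded f -> (forall x, `|f x| <= M) -> `|tint f| <= M.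
  move=> bf fM; have fM' x : - M <= f x <= M by rewrite -ler_norml.
  rewrite ler_norml; apply/andP; split.
    rewrite -(@tint_cst R d (- M)); apply: le_tint => //; first exact: tbounded_cst.
    by move=> x; have /andP[] := fM' x.
  rewrite -[leRHS](@tint_cst R d M); apply: le_tint => //; first exact: tbounded_cst.
  by move=> x; have /andP[] := fM' x.
apply: lerD.
  by apply: (h _ ru) => x; apply: le_trans (Re_le_cabs _) (uM x).
by apply: (h _ iu) => x; apply: le_trans (Im_le_cabs _) (uM x).
Qed.

(** The measure lives on a fixed cube, which a translation does not preserve. For an exponential the
    claim is immediate, since both integrals vanish unless the frequency is 0; density gives the
    rest. *)
Lemma cintegral_shift u y : tcontinuous u ->
  cintegral (fun x => u (x + y)) = cintegral u.
Proof.
move=> cu; have gu := tcontinuous_cbounded cu.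
have gs := tcontinuous_cbounded (tcontinuous_shift y cu).
apply/eqP; rewrite -subr_eq0; apply/eqP/ComplexField.Normc.eq0_normc/eqP.
rewrite eq_le cabs_ge0 andbT; apply/ler_addgt0Pr => e e0.
have e80 : 0 < e / 4 by rewrite divr_gt0.
have [s us] := trig_density cu e80.
have gq (q : R[i] * 'rV[int]_d) : cbounded (fun x : 'rV[R]_d => q.1 * fourier q.2 x).
  exact/cboundedZ/cbounded_fourier.
have gP : cbounded (trigpoly s) by exact: cbounded_sum.
have gPs : cbounded (fun x => trigpoly s (x + y)).
  apply: tcontinuous_cbounded; apply: (tcontinuous_shift y); apply: tcontinuous_sum => q.
  by apply: tcontinuousM; [exact: tcontinuous_cst|exact: tcontinuous_fourier].
have PE : cintegral (fun x => trigpoly s (x + y)) = cintegral (trigpoly s).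
  rewrite /trigpoly !cintegral_sum//; last first.
    move=> q; have := tcontinuous_cbounded (tcontinuous_shift y
      (tcontinuousM (tcontinuous_cst q.1) (tcontinuous_fourier q.2))).
    by [].
  apply: eq_bigr => q _; rewrite [RHS]cintegralZ ?cintegral_fourier; last first.
    exact: cbounded_fourier.
  have -> : (fun x : 'rV[R]_d => q.1 * fourier q.2 (x + y)) =
      fun x => (q.1 * fourier q.2 y) * fourier q.2 x.
    by apply/funext => x; rewrite fourier_addr; ring.
  rewrite cintegralZ ?cintegral_fourier; last exact: cbounded_fourier.
  case: eqVneq => [->|_]; last by rewrite !mulr0.
  rewrite /fourier (_ : dotZ 0 y = 0) ?mulr0 ?expi0 ?mulr1//.
  by rewrite /dotZ big1// => i _; rewrite mxE mul0r.
have gus : cbounded (fun x => u (x + y) - trigpoly s (x + y)) by exact: cboundedB.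
have gu0 : cbounded (fun x => u x - trigpoly s x) by exact: cboundedB.
have cB v w : cbounded v -> cbounded w ->
    cintegral (fun x => v x - w x) = cintegral v - cintegral w.
  move=> gv gw; rewrite -mulN1r -cintegralZ// -cintegralD//; last exact: cboundedZ.
  by congr cintegral; apply/funext => x; rewrite mulN1r.
rewrite add0r.
have -> : cintegral (fun x => u (x + y)) - cintegral u =
   cintegral (fun x => u (x + y) - trigpoly s (x + y)) -
   cintegral (fun x => u x - trigpoly s x).
  by rewrite !cB// PE opprB addrA subrK.
apply: le_trans (cabsD _ _) _; rewrite cabsN.
have -> : e = (e / 4 + e / 4) + (e / 4 + e / 4) by lra.
by apply: lerD; apply: cabs_cintegral_le => // x; exact: us.
Qed.

End TContinuousClosure.

(** * Partial derivatives *)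

Section Partials.
Context {R : realType} {d : nat}.
Implicit Types (u v : 'rV[R]_d -> R[i]) (nu : 'rV[int]_d) (l : 'I_d).
Local Notation e_ l := (@unit_vec R d l).

Lemma derive_line (f : 'rV[R]_d -> R) (v x : 'rV[R]_d) (t : R) :
  (derivable (fun s : R => f (s *: v + x)) t 1 <-> derivable f (t *: v + x) v) /\
  'D_1 (fun s : R => f (s *: v + x)) t = 'D_v f (t *: v + x).
Proof.
rewrite /derivable /derive.
suff -> : (fun h : R => h^-1 *: (((fun s : R => f (s *: v + x)) \o shift t) (h *: 1) -
    f (t *: v + x))) =
  (fun h => h^-1 *: ((f \o shift (t *: v + x)) (h *: v) - f (t *: v + x))) by [].
apply/funext => h /=; congr (_ *: (f _ - _)).
by rewrite /shift /= [h *: 1]mulr1 scalerDl addrA.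
Qed.

Definition pderivable l u : Prop := forall x,
  derivable (fun y => complex.Re (u y)) x (e_ l) /\
  derivable (fun y => complex.Im (u y)) x (e_ l).

Lemma partial_cst l (c : R[i]) x : partial l (fun=> c) x = 0.
Proof.
rewrite /partial (derive_cst (complex.Re c)) (derive_cst (complex.Im c)).
by [].
Qed.

Lemma pderivable_cst l (c : R[i]) : pderivable l (fun=> c).
Proof.
by move=> x; split; [exact: (derivable_cst (complex.Re c))|
  exact: (derivable_cst (complex.Im c))].
Qed.

Lemma complexD_def (a b a' b' : R) :
  (a +i* b) + (a' +i* b') = (a + a') +i* (b + b').
Proof. by []. Qed.

Lemma pderivableD l u v : pderivable l u -> pderivable l v ->
  pderivable l (fun x => u x + v x).
Proof.
move=> du dv x; have [ru iu] := du x; have [rv iv] := dv x.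
split.
  rewrite (_ : (fun y => _) = (fun y => complex.Re (u y)) + (fun y => complex.Re (v y))).
    exact: (derivableD ru rv).
  by apply/funext => y; rewrite cReD.
rewrite (_ : (fun y => _) = (fun y => complex.Im (u y)) + (fun y => complex.Im (v y))).
  exact: (derivableD iu iv).
by apply/funext => y; rewrite cImD.
Qed.

Lemma partialD l u v x : pderivable l u -> pderivable l v ->
  partial l (fun x => u x + v x) x = partial l u x + partial l v x.
Proof.
move=> du dv; have [ru iu] := du x; have [rv iv] := dv x.
rewrite /partial (_ : (fun y => complex.Re (u y + v y)) =
    (fun y => complex.Re (u y)) + (fun y => complex.Re (v y))); last first.
  by apply/funext => y; rewrite cReD.
rewrite (_ : (fun y => complex.Im (u y + v y)) =
    (fun y => complex.Im (u y)) + (fun y => complex.Im (v y))); last first.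
  by apply/funext => y; rewrite cImD.
rewrite (deriveD ru rv) (deriveD iu iv).
exact: (esym (complexD_def _ _ _ _)).
Qed.

Lemma reM_fun u v : (fun y => complex.Re (u y * v y)) =
  (fun y => complex.Re (u y)) * (fun y => complex.Re (v y)) -
  (fun y => complex.Im (u y)) * (fun y => complex.Im (v y)).
Proof. by apply/funext => y; rewrite cReM. Qed.

Lemma imM_fun u v : (fun y => complex.Im (u y * v y)) =
  (fun y => complex.Re (u y)) * (fun y => complex.Im (v y)) +
  (fun y => complex.Im (u y)) * (fun y => complex.Re (v y)).
Proof. by apply/funext => y; rewrite cImM. Qed.

Lemma pderivableM l u v : pderivable l u -> pderivable l v ->
  pderivable l (fun x => u x * v x).
Proof.
move=> du dv x; have [ru iu] := du x; have [rv iv] := dv x; split.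
  rewrite reM_fun; exact: (derivableB (derivableM ru rv) (derivableM iu iv)).
rewrite imM_fun; exact: (derivableD (derivableM ru iv) (derivableM iu rv)).
Qed.

Lemma partialM l u v x : pderivable l u -> pderivable l v ->
  partial l (fun x => u x * v x) x = partial l u x * v x + u x * partial l v x.
Proof.
move=> du dv; have [ru iu] := du x; have [rv iv] := dv x.
rewrite /partial reM_fun imM_fun.
rewrite (deriveB (derivableM ru rv) (derivableM iu iv)).
rewrite (deriveD (derivableM ru iv) (derivableM iu rv)).
rewrite (deriveM ru rv) (deriveM iu iv) (deriveM ru iv) (deriveM iu rv).
move: ('D_(e_ l) _ x) ('D_(e_ l) _ x) ('D_(e_ l) _ x) ('D_(e_ l) _ x) => a1 a2 a3 a4.
case: (u x) (v x) => a b [p q]; apply/eqP; rewrite eq_complex /= -![_ *: _]/(_ * _).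
by apply/andP; split; apply/eqP; ring.
Qed.

Lemma dotZ_line nu l (t : R) x :
  dotZ nu (t *: e_ l + x) = t * (nu 0 l)%:~R + dotZ nu x.
Proof.
rewrite /dotZ.
under eq_bigr do rewrite !mxE eqxx /= mulrDr.
rewrite big_split /=; congr (_ + _).
rewrite (bigD1 l)//= eqxx mulr1 mulrC big1 ?addr0// => i /negPf.
by rewrite eq_sym => ->; rewrite mulr0 mulr0.
Qed.

Lemma is_derive_affine (a b t : R) : is_derive t 1 (fun s : R => a * s + b) a.
Proof.
have h := is_deriveD (is_deriveZ a (is_derive_id t (1 : R)))
  (is_derive_cst b t (1 : R)).
by apply: is_derive_eq h _; rewrite addr0 -[_ *: _]/(_ * _) mulr1.
Qed.

Lemma fourier_derive nu l x :
  is_derive x (e_ l) (fun y => complex.Re (fourier nu y))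
    (- (2 * pi * (nu 0 l)%:~R * sin (2 * pi * dotZ nu x))) /\
  is_derive x (e_ l) (fun y => complex.Im (fourier nu y))
    (2 * pi * (nu 0 l)%:~R * cos (2 * pi * dotZ nu x)).
Proof.
have gen (f df : R -> R) : (forall y : R, is_derive y 1 f (df y)) ->
    is_derive x (e_ l) (fun y : 'rV[R]_d => f (2 * pi * dotZ nu y))
      (df (2 * pi * dotZ nu x) * (2 * pi * (nu 0 l)%:~R)).
  move=> hf.
  have [h1 h2] := derive_line (fun y => f (2 * pi * dotZ nu y)) (e_ l) x 0.
  rewrite scale0r add0r in h1 h2.
  have E : (fun s : R => f (2 * pi * dotZ nu (s *: e_ l + x))) =
      f \o (fun s : R => 2 * pi * (nu 0 l)%:~R * s + 2 * pi * dotZ nu x).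
    apply/funext => s /=; rewrite dotZ_line; congr f; ring.
  have := @is_derive1_comp R f (fun s : R => 2 * pi * (nu 0 l)%:~R * s +
    2 * pi * dotZ nu x) 0 _ _ (hf _) (is_derive_affine _ _ 0).
  rewrite -E mulr0 add0r => -[g1 g2]; split; first exact/h1.
  by rewrite -h2.
split.
  have := gen cos (fun y => - sin y) (@is_derive_cos R).
  by move=> h; apply: is_derive_eq h _; rewrite mulNr mulrC.
have := gen sin cos (@is_derive_sin R).
by move=> h; apply: is_derive_eq h _; rewrite mulrC.
Qed.

Lemma pderivable_fourier l nu : pderivable l (fourier nu).
Proof. by move=> x; have [[? _] [? _]] := fourier_derive nu l x. Qed.

Lemma partial_fourier l nu (x : 'rV[R]_d) : partial l (fourier nu) x =
  (0 +i* (2 * pi * (nu 0 l)%:~R)) * fourier nu x.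
Proof.
have [[_ e1] [_ e2]] := fourier_derive nu l x.
rewrite /partial e1 e2; apply/eqP; rewrite eq_complex /=.
by rewrite !mul0r sub0r add0r !eqxx.
Qed.

End Partials.

Section DirC1.
Context {R : realType} {d : nat}.
Implicit Types (u v : 'rV[R]_d -> R[i]) (nu : 'rV[int]_d) (l : 'I_d).
Local Notation e_ l := (@unit_vec R d l).

Definition dirC1 u : Prop :=
  tcontinuous u /\ forall l, pderivable l u /\ tcontinuous (partial l u).

Lemma derive_periodic (f : 'rV[R]_d -> R) (v x : 'rV[R]_d) (y : 'rV[R]_d) :
  (forall z, f (z + y) = f z) -> 'D_v f (x + y) = 'D_v f x.
Proof.
move=> pf; rewrite /derive.
suff -> : (fun h => h^-1 *: ((f \o shift (x + y)) (h *: v) - f (x + y))) =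
  (fun h : R => h^-1 *: ((f \o shift x) (h *: v) - f x)) by [].
by apply/funext => h /=; rewrite /shift /= pf addrA pf.
Qed.

Lemma torusC1_dirC1 u : torusC1 u -> dirC1 u.
Proof.
move=> [pu [dr cr] [di ci]]; split.
  split=> //; first by move=> x; exact: differentiable_continuous (dr x).
  by move=> x; exact: differentiable_continuous (di x).
move=> l; split.
  by move=> x; split; [exact: diff_derivable (dr x)|exact: diff_derivable (di x)].
split; [|exact: cr|exact: ci].
move=> x k; rewrite /partial; congr (_ +i* _).
  apply: (@derive_periodic (fun y => complex.Re (u y))) => z.
  by rewrite pu.
by apply: (@derive_periodic (fun y => complex.Im (u y))) => z; rewrite pu.
Qed.

Lemma dirC1_cst (c : R[i]) : dirC1 (fun=> c).
Proof.
split=> [|l]; first exact: tcontinuous_cst.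
split; first exact: pderivable_cst.
rewrite (_ : partial l _ = fun=> 0); first exact: tcontinuous_cst.
by apply/funext => x; exact: partial_cst.
Qed.

Lemma dirC1D u v : dirC1 u -> dirC1 v -> dirC1 (fun x => u x + v x).
Proof.
move=> [cu du] [cv dv]; split=> [|l]; first exact: tcontinuousD.
have [pu cpu] := du l; have [pv cpv] := dv l.
split; first exact: pderivableD.
rewrite (_ : partial l _ = fun x => partial l u x + partial l v x).
  exact: tcontinuousD.
by apply/funext => x; exact: partialD.
Qed.

Lemma dirC1M u v : dirC1 u -> dirC1 v -> dirC1 (fun x => u x * v x).
Proof.
move=> [cu du] [cv dv]; split=> [|l]; first exact: tcontinuousM.
have [pu cpu] := du l; have [pv cpv] := dv l.
split; first exact: pderivableM.
rewrite (_ : partial l _ = fun x => partial l u x * v x + u x * partial l v x).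
  by apply: tcontinuousD; exact: tcontinuousM.
by apply/funext => x; exact: partialM.
Qed.

Lemma dirC1_sum I (r : seq I) (F : I -> 'rV[R]_d -> R[i]) :
  (forall i, dirC1 (F i)) -> dirC1 (fun x => \sum_(i <- r) F i x).
Proof.
move=> dF; elim: r => [|i r ih].
  rewrite (_ : (fun x => _) = fun=> 0); first exact: dirC1_cst.
  by apply/funext => x; rewrite big_nil.
rewrite (_ : (fun x => _) = fun x => F i x + \sum_(i <- r) F i x).
  exact: dirC1D.
by apply/funext => x; rewrite big_cons.
Qed.

Lemma dirC1_fourier nu : dirC1 (fourier nu).
Proof.
split=> [|l]; first exact: tcontinuous_fourier.
split; first exact: pderivable_fourier.
rewrite (_ : partial l _ = fun x => (0 +i* (2 * pi * (nu 0 l)%:~R)) * fourier nu x).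
  by apply: tcontinuousM; [exact: tcontinuous_cst|exact: tcontinuous_fourier].
by apply/funext => x; exact: partial_fourier.
Qed.

Lemma mean_value_line (f : 'rV[R]_d -> R) (v x : 'rV[R]_d) (h : R) : 0 < h ->
  (forall y, derivable f y v) ->
  exists2 c, 0 < c < h & f (h *: v + x) - f x = 'D_v f (c *: v + x) * h.
Proof.
move=> h0 df.
have dg (t : R) : is_derive t 1 (fun s : R => f (s *: v + x)) ('D_v f (t *: v + x)).
  have [h1 h2] := derive_line f v x t.
  by split; [exact/h1|exact: h2].
have cg : {within `[0, h], continuous (fun s : R => f (s *: v + x))}.
  apply: continuous_subspaceT => t; apply: differentiable_continuous.
  by apply/derivable1_diffP; case: (dg t).
have [c] := MVT h0 (fun t _ => dg t) cg.
rewrite in_itv /= => ch; rewrite subr0 scale0r add0r => e.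
by exists c.
Qed.

(** The difference quotient in direction [l] has integral 0 by translation invariance. By the mean
    value theorem and uniform continuity of the derivative, it is uniformly close to that
    derivative. *)
Lemma tint_derive_eq0 (f : 'rV[R]_d -> R) l :
  tcontinuous (fun x => (f x)%:C) -> (forall x, derivable f x (e_ l)) ->
  tcontinuous (fun x => ('D_(e_ l) f x)%:C) -> tint ('D_(e_ l) f) = 0.
Proof.
move=> cf df cdf; apply/eqP; rewrite -normr_eq0 eq_le normr_ge0 andbT.
apply/ler_addgt0Pr => e e0; rewrite add0r.
have [r r0 hr] := tcontinuous_unif cdf e0.
pose h := r / 2; have h0 : 0 < h by rewrite divr_gt0.
have hltr : h < r by rewrite ltr_pdivrMr// ltr_pMr// ltr1n.
have [bf _] := tcontinuous_cbounded cf.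
have [bdf _] := tcontinuous_cbounded cdf.
have [bfs _] := tcontinuous_cbounded (tcontinuous_shift (h *: e_ l) cf).
rewrite /= in bf bdf bfs.
have shiftE : tint (fun x => f (x + h *: e_ l)) = tint f.
  exact: (congr1 (@complex.Re R) (cintegral_shift (h *: e_ l) cf)).
have close x : `|(f (x + h *: e_ l) - f x) - h * 'D_(e_ l) f x| <= h * e.
  have [c /andP[c0 ch] E] := mean_value_line x h0 df.
  rewrite [x + _]addrC E mulrC -mulrBr normrM (gtr0_norm h0) ler_wpM2l ?ltW//.
  rewrite -cabs_real rmorphB /=; apply: hr => i; rewrite !mxE eqxx /=.
  rewrite addrK normrM (gtr0_norm c0) (le_lt_trans _ hltr)//.
  apply: le_trans (ltW ch); rewrite ler_piMr ?(ltW c0)//.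
  by case: (_ == _); rewrite ?normr1 ?normr0.
have he0 : 0 < h * e by rewrite mulr_gt0.
have bl := tboundedD bfs (tboundedN bf).
have br : tbounded (fun x => h * 'D_(e_ l) f x).
  by apply: tboundedM => //; exact: tbounded_cst.
have bb := tboundedD bl (tboundedN br).
have hint : tint (fun x => (f (x + h *: e_ l) - f x) - h * 'D_(e_ l) f x) =
    - (h * tint ('D_(e_ l) f)).
  by rewrite tintD ?tintN ?tintD ?tintN ?tintZ ?shiftE ?subrr ?sub0r//; exact: tboundedN.
rewrite -(ler_pM2l h0) -[h * `|_|]/(h * `|_|) -{1}(gtr0_norm h0) -normrM -normrN -hint.
have close' x : - (h * e) <= (f (x + h *: e_ l) - f x) - h * 'D_(e_ l) f x <= h * e.
  by rewrite -ler_norml.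
rewrite ler_norml; apply/andP; split.
  rewrite -(@tint_cst R d (- (h * e))); apply: le_tint => //; first exact: tbounded_cst.
  by move=> x; have /andP[] := close' x.
rewrite -[leRHS](@tint_cst R d (h * e)); apply: le_tint => //; first exact: tbounded_cst.
by move=> x; have /andP[] := close' x.
Qed.

Lemma cintegral_partial u l : dirC1 u -> cintegral (partial l u) = 0.
Proof.
move=> [cu du]; have [pu cpu] := du l; rewrite cintegralE -[RHS]/(0 +i* 0).
congr (_ +i* _).
  apply: (@tint_derive_eq0 (fun x => complex.Re (u x))).
  - exact: tcontinuous_Re cu.
  - by move=> x; have [] := pu x.
  - exact: tcontinuous_Re cpu.
apply: (@tint_derive_eq0 (fun x => complex.Im (u x))).
- exact: tcontinuous_Im cu.
- by move=> x; have [] := pu x.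
- exact: tcontinuous_Im cpu.
Qed.

(** Integration by parts: the partial derivative of [u] times the conjugate exponential has integral
    0. *)
Lemma fcoef_partial u l nu : dirC1 u ->
  fcoef (partial l u) nu = (0 +i* (2 * pi * (nu 0 l)%:~R)) * fcoef u nu.
Proof.
move=> du; have dF := dirC1_fourier (- nu).
have := cintegral_partial l (dirC1M du dF).
have [cu /(_ l)[pu cpu]] := du; have [cF /(_ l)[pF cpF]] := dF.
set c : R[i] := 0 +i* _.
rewrite (_ : partial l _ = fun x => partial l u x * (fourier nu x)^* +
    (- c) * (u x * (fourier nu x)^*)); last first.
  apply/funext => x; rewrite partialM// partial_fourier -!fourierN.
  rewrite (_ : 0 +i* _ = - c); first by ring.
  by apply/eqP; rewrite eq_complex /= oppr0 mxE rmorphN mulrN !eqxx.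
have gu := tcontinuous_cbounded cu; have gpu := tcontinuous_cbounded cpu.
have gc := cbounded_conj (@cbounded_fourier R d nu).
rewrite cintegralD; [|exact: cboundedM|exact/cboundedZ/cboundedM].
rewrite cintegralZ; last exact: cboundedM.
by move/eqP; rewrite mulNr subr_eq0 => /eqP.
Qed.

End DirC1.

Section FiniteCauchySchwarz.
Context {R : realType}.

Lemma sum_cauchy_schwarz I (r : seq I) (f g : I -> R) :
  (\sum_(i <- r) f i * g i) ^+ 2 <=
  (\sum_(i <- r) f i ^+ 2) * (\sum_(i <- r) g i ^+ 2).
Proof.
set A := \sum_(i <- r) f i ^+ 2; set B := \sum_(i <- r) g i ^+ 2.
set C := \sum_(i <- r) f i * g i.
have disc t : 0 <= A - 2 * t * C + t ^+ 2 * B.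
  have -> : A - 2 * t * C + t ^+ 2 * B = \sum_(i <- r) (f i - t * g i) ^+ 2.
    rewrite /A /B /C !mulr_sumr -sumrB -big_split /=.
    by apply: eq_bigr => i _; ring.
  by apply: sumr_ge0 => i _; exact: sqr_ge0.
have B0 : 0 <= B by apply: sumr_ge0 => i _; exact: sqr_ge0.
have [BE|Bn0] := eqVneq B 0.
  have [->|C0] := eqVneq C 0; first by rewrite BE mulr0 expr0n.
  (* With [B = 0] the form is affine in [t]; this value of [t] makes it [-1]. *)
  have := disc ((A + 1) / (2 * C)); rewrite BE mulr0 addr0.
  have -> : A - 2 * ((A + 1) / (2 * C)) * C = - 1 by field.
  by rewrite oppr_ge0 ler10.
have Bgt0 : 0 < B by rewrite lt_def Bn0.
have := disc (C / B).
have -> : A - 2 * (C / B) * C + (C / B) ^+ 2 * B = (A * B - C ^+ 2) / B by field.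
by rewrite pmulr_lge0 ?invr_gt0// subr_ge0.
Qed.

Lemma sum_minkowski I (r : seq I) (f g : I -> R) (a b : R) : 0 <= a -> 0 <= b ->
  \sum_(i <- r) f i ^+ 2 <= a ^+ 2 -> \sum_(i <- r) g i ^+ 2 <= b ^+ 2 ->
  \sum_(i <- r) (f i + g i) ^+ 2 <= (a + b) ^+ 2.
Proof.
move=> a0 b0 fa gb.
have -> : \sum_(i <- r) (f i + g i) ^+ 2 = \sum_(i <- r) f i ^+ 2 +
    2 * (\sum_(i <- r) f i * g i) + \sum_(i <- r) g i ^+ 2.
  by rewrite mulr_sumr -!big_split /=; apply: eq_bigr => i _; ring.
have fg : \sum_(i <- r) f i * g i <= a * b.
  apply: le_trans (ler_norm _) _.
  rewrite -(@ler_pXn2r _ 2) ?nnegrE ?mulr_ge0// real_normK ?num_real//.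
  apply: le_trans (sum_cauchy_schwarz _ _ _) _.
  by rewrite exprMn ler_pM// sumr_ge0// => i _; exact: sqr_ge0.
by move: fa gb fg; lra.
Qed.

End FiniteCauchySchwarz.

(** * The diffusion operator *)

Section Diffusion.
Context {R : realType} {d : nat}.
Implicit Types (u v : 'rV[R]_d -> R[i]) (mu nu : 'rV[int]_d) (l : 'I_d).

Lemma sqnormZE nu : sqnormZ nu = (zdot nu nu)%:~R :> R.
Proof.
rewrite /sqnormZ /zdot rmorph_sum; apply: eq_bigr => i _.
by rewrite expr2 rmorphM.
Qed.

(** The factor [2 pi i nu_l / (4 pi^2 |nu|^2)] that differentiation puts in front of [fourier nu] in
    the gradient of [Psi nu]. *)
Definition grad_coef nu l : R[i] := 0 +i* ((nu 0 l)%:~R / (2 * pi * sqnormZ nu)).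

Lemma sqnormZ_neq0 nu : nu != 0 -> sqnormZ nu != 0 :> R.
Proof. by move=> nu0; rewrite sqnormZE intr_eq0 zdot_eq0. Qed.

Lemma partial_Psi nu l : nu != 0 ->
  partial l (Psi nu) = fun x : 'rV[R]_d => grad_coef nu l * fourier nu x.
Proof.
move=> nu0; apply/funext => x.
rewrite /Psi partialM; [|exact: pderivable_cst|exact: pderivable_fourier].
rewrite partial_cst mul0r add0r partial_fourier mulrA; congr (_ * _).
have n0 := sqnormZ_neq0 nu0; have p0 : pi != 0 :> R by rewrite gt_eqF ?pi_gt0.
apply/eqP; rewrite eq_complex /= !mul0r !mulr0 subr0 addr0 eqxx /=.
by apply/eqP; move: (@pi R) p0 => p p0; field; rewrite n0 p0.
Qed.

(** The product rule: the Laplacian of [Psi nu] is [- fourier nu], and what remains is the gradient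
    of [u] paired with that of [Psi nu]. *)
Lemma diffusionE u nu x : dirC1 u -> nu != 0 ->
  diffusion u nu x = u x * fourier nu x -
    \sum_l grad_coef nu l * (partial l u x * fourier nu x).
Proof.
move=> [cu du] nu0; rewrite /diffusion /divergence.
have n0 := sqnormZ_neq0 nu0; have p0 : pi != 0 :> R by rewrite gt_eqF ?pi_gt0.
have E l : partial l (fun y => u y * partial l (Psi nu) y) x =
    grad_coef nu l * (partial l u x * fourier nu x) -
    ((nu 0 l)%:~R ^+ 2 / sqnormZ nu)%:C * (u x * fourier nu x).
  have [pu _] := du l; rewrite partial_Psi//.
  have pc := @pderivable_cst R d l (grad_coef nu l).
  have pF := @pderivable_fourier R d l nu.
  rewrite partialM//; last exact: pderivableM.
  rewrite partialM// partial_cst mul0r add0r partial_fourier.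
  have -> : grad_coef nu l * ((0 +i* (2 * pi * (nu 0 l)%:~R)) * fourier nu x) =
      - ((nu 0 l)%:~R ^+ 2 / sqnormZ nu)%:C * fourier nu x.
    rewrite mulrA; congr (_ * _); apply/eqP; rewrite eq_complex /=.
    rewrite !mul0r !mulr0 addr0 oppr0 eqxx andbT sub0r eqr_opp.
    by apply/eqP; move: (@pi R) p0 => p p0; field; rewrite n0 p0.
  by ring.
under eq_bigr do rewrite E.
rewrite sumrB opprB -mulr_suml -rmorph_sum /= -mulr_suml.
have -> : \sum_l (nu 0 l)%:~R ^+ 2 = sqnormZ nu :> R by [].
by rewrite divff// mul1r.
Qed.

(* The junk value [0^-1 = 0] makes [Psi 0], hence [diffusion u 0], vanish. *)
Lemma diffusion0 u : diffusion u 0 = fun=> 0.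
Proof.
have P0 : Psi 0 = fun _ : 'rV[R]_d => 0 :> R[i].
  apply/funext => x; rewrite /Psi (_ : sqnormZ 0 = 0) ?mulr0 ?invr0 ?mul0r//.
  by rewrite sqnormZE /zdot big1// => i _; rewrite mxE mul0r.
apply/funext => x; rewrite /diffusion /divergence P0 big1 ?oppr0// => l _.
rewrite (_ : (fun y => _) = fun=> 0) ?partial_cst//.
by apply/funext => y; rewrite partial_cst mulr0.
Qed.

Lemma tcontinuous_diffusion u nu : dirC1 u -> tcontinuous (diffusion u nu).
Proof.
move=> du; have [cu pu] := du.
have [->|nu0] := eqVneq nu 0; first by rewrite diffusion0; exact: tcontinuous_cst.
rewrite (_ : diffusion u nu = fun x => u x * fourier nu x +
    \sum_l (- grad_coef nu l) * (partial l u x * fourier nu x)).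
  apply: tcontinuousD; first exact/tcontinuousM/tcontinuous_fourier.
  apply: tcontinuous_sum => l; apply: tcontinuousM; first exact: tcontinuous_cst.
  by apply: tcontinuousM; [have [] := pu l|exact: tcontinuous_fourier].
apply/funext => x; rewrite diffusionE//; congr (_ + _); rewrite -sumrN.
by apply: eq_bigr => l _; rewrite mulNr.
Qed.

Lemma fcoefD u v mu : cbounded u -> cbounded v ->
  fcoef (fun x => u x + v x) mu = fcoef u mu + fcoef v mu.
Proof. by move=> gu gv; apply: innerDl => //; exact: cbounded_fourier. Qed.

(** [kappa] arises as [1 + nu.(mu - nu) / |nu|^2], the two summands coming from the two terms of
    [diffusionE]. *)
Lemma fcoef_diffusion u nu mu : dirC1 u -> nu != 0 ->
  fcoef (diffusion u nu) mu = (@kappa R d mu nu)%:C * fcoef u (mu - nu).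
Proof.
move=> du nu0; have [cu pu] := du.
have gu := tcontinuous_cbounded cu.
have gp l : cbounded (partial l u) by apply: tcontinuous_cbounded; have [] := pu l.
have gF := @cbounded_fourier R d nu.
rewrite (_ : diffusion u nu = fun x => u x * fourier nu x +
    \sum_l (- grad_coef nu l) * (partial l u x * fourier nu x)); last first.
  apply/funext => x; rewrite diffusionE//; congr (_ + _); rewrite -sumrN.
  by apply: eq_bigr => l _; rewrite mulNr.
rewrite fcoefD; [|exact: cboundedM|]; last first.
  by apply: cbounded_sum => l; exact/cboundedZ/cboundedM.
rewrite fcoef_mul_fourier {2}/fcoef inner_suml; [|by move=> l; exact: cboundedM|exact: cbounded_fourier].
have n0 := sqnormZ_neq0 nu0; have p0 : pi != 0 :> R by rewrite gt_eqF ?pi_gt0.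
have E l : - grad_coef nu l * inner (fun x => partial l u x * fourier nu x) (fourier mu) =
    (((nu 0 l)%:~R * ((mu - nu) 0 l)%:~R) / sqnormZ nu)%:C * fcoef u (mu - nu).
  rewrite -[inner _ _]/(fcoef (fun x => partial l u x * fourier nu x) mu).
  rewrite fcoef_mul_fourier fcoef_partial// mulrA; congr (_ * _).
  apply/eqP; rewrite eq_complex /= oppr0 !mulr0 mul0r addr0 eqxx andbT sub0r.
  by rewrite mulNr opprK; apply/eqP; move: (@pi R) p0 => p p0; field; rewrite n0 p0.
under eq_bigr do rewrite E.
rewrite -mulr_suml -rmorph_sum /= -mulr_suml -{1}[fcoef u _]mul1r -mulrDl.
congr (_ * _); rewrite -[1]/(1%:C) -rmorphD; congr (_%:C).
rewrite (_ : \sum_l _ = (zdot nu (mu - nu))%:~R); last first.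
  by rewrite /zdot rmorph_sum; apply: eq_bigr => l _; rewrite rmorphM.
rewrite /kappa -sqnormZE zdotBr rmorphB /= -sqnormZE mulrBl divff// addrC subrK.
by rewrite zdotC.
Qed.

End Diffusion.

Section DiffusionBound.
Context {R : realType} {d : nat}.
Implicit Types (u v : 'rV[R]_d -> R[i]) (mu nu : 'rV[int]_d) (l : 'I_d).

Definition grad_sqn u : R := \sum_l sqn (partial l u).

Lemma grad_sqn_ge0 u : 0 <= grad_sqn u.
Proof. by apply: sumr_ge0 => l _; exact: sqn_ge0. Qed.

Lemma cabs_imag (t : R) : cabs (0 +i* t) = `|t|.
Proof. by rewrite /= expr0n add0r sqrtr_sqr. Qed.

(** Bessel for each partial derivative, whose coefficients carry the factors [2 pi tau_l]; summing
    over [l] produces [|tau|^2]. *)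
Lemma grad_bessel u (F : seq 'rV[int]_d) : dirC1 u -> uniq F ->
  \sum_(tau <- F) cabs (fcoef u tau) ^+ 2 * (zdot tau tau)%:~R
  <= grad_sqn u / (2 * pi) ^+ 2.
Proof.
move=> du uF; have [cu pu] := du.
have p0 : 0 < (2 * pi) ^+ 2 :> R by rewrite exprn_gt0// mulr_gt0 ?pi_gt0.
rewrite ler_pdivlMr// mulr_suml.
have E tau : cabs (fcoef u tau) ^+ 2 * (zdot tau tau)%:~R * (2 * pi) ^+ 2 =
    \sum_l cabs (fcoef (partial l u) tau) ^+ 2.
  rewrite -sqnormZE /sqnormZ mulr_sumr mulr_suml; apply: eq_bigr => l _.
  rewrite fcoef_partial// cabsM cabs_imag [in RHS]exprMn real_normK ?num_real//.
  by rewrite [in RHS]exprMn; ring.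
under eq_bigr do rewrite E.
rewrite exchange_big; apply: ler_sum => l _; apply: bessel => //.
by apply: tcontinuous_cbounded; have [] := pu l.
Qed.

(** The two components of [XY] are the contributions of [k] and [b] from [row_split], each estimated
    by Cauchy-Schwarz. They form a pair so that one choice over [mu] yields both. *)
Lemma row_bound u (L : {fset 'rV[int]_d}) (z : 'rV[int]_d -> R[i]) mu :
  fcoef u 0 = 0 -> 0 \notin L ->
  exists XY : R * R, [/\ 0 <= XY.1, 0 <= XY.2,
    cabs (\sum_(nu <- L) z nu * ((@kappa R d mu nu)%:C * fcoef u (mu - nu)))
      <= XY.1 + XY.2,
    XY.1 ^+ 2 <= #|` L|%:R * \sum_(nu <- L) cabs (z nu) ^+ 2 *
      (cabs (fcoef u (mu - nu)) ^+ 2 * (zdot (mu - nu) (mu - nu))%:~R) &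
    XY.2 ^+ 2 <= \sum_(nu <- L) cabs (z nu) ^+ 2 *
      cabs (fcoef u (mu - nu)) ^+ 2].
Proof.
move=> u0 L0; pose G := [seq nu <- L | nu != mu].
have uG : uniq G by rewrite filter_uniq ?fset_uniq.
have G0 : 0 \notin G by rewrite mem_filter negb_and L0 orbT.
have Gmu : mu \notin G by rewrite mem_filter eqxx.
have [k [b [kb ksum bsum]]] := @row_split R d G mu uG G0 Gmu.
pose e nu := cabs (fcoef u (mu - nu)).
have e0 nu : 0 <= e nu by exact: cabs_ge0.
have z0 nu : 0 <= cabs (z nu) by exact: cabs_ge0.
have subG (f : 'rV[int]_d -> R) : (forall nu, 0 <= f nu) ->
    \sum_(nu <- G) f nu <= \sum_(nu <- L) f nu.
  move=> f0; rewrite big_filter [leRHS](bigID (fun nu => nu != mu))/= lerDl.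
  exact: sumr_ge0.
exists (\sum_(nu <- G) cabs (z nu) * e nu * `|k nu|,
        \sum_(nu <- G) cabs (z nu) * e nu * `|b nu|) => /=; split.
- by apply: sumr_ge0 => nu _; rewrite !mulr_ge0.
- by apply: sumr_ge0 => nu _; rewrite !mulr_ge0.
(* The term [nu = mu], which [row_split] excludes, vanishes because [u] has mean 0. *)
- rewrite (bigID (fun nu => nu != mu))/= [X in _ + X]big1 ?addr0; last first.
    by move=> nu /negPn/eqP ->; rewrite subrr u0 !mulr0.
  rewrite -big_filter -/G -big_split /=.
  apply: le_trans (cabs_sum _ _ _) _; rewrite big_seq [leRHS]big_seq.
  apply: ler_sum => nu nuG; rewrite !cabsM cabs_real kb// -mulrDr -/(e nu).
  rewrite mulrCA mulrC ler_wpM2l ?mulr_ge0//.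
  by apply: lerD; exact: ler_norm.
- pose t nu : R := @zlen R d (mu - nu).
  have t0 nu : nu \in G -> 0 < t nu.
    move=> nuG; rewrite sqrtr_gt0 ltr0z zdot_gt0 subr_eq0.
    by move: nuG; rewrite mem_filter eq_sym => /andP[].
  have -> : \sum_(nu <- G) cabs (z nu) * e nu * `|k nu| =
      \sum_(nu <- G) (`|k nu| / t nu) * (cabs (z nu) * (e nu * t nu)).
    rewrite big_seq [RHS]big_seq; apply: eq_bigr => nu /t0 tn.
    by field; rewrite gt_eqF.
  apply: le_trans (sum_cauchy_schwarz _ _ _) _.
  apply: ler_pM; try by apply: sumr_ge0 => nu _; exact: sqr_ge0.
    apply: (@le_trans _ _ (size G)%:R); last first.
      by rewrite ler_nat size_filter count_size.
    apply: le_trans ksum; rewrite le_eqVlt; apply/orP; left; apply/eqP.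
    apply: eq_bigr => nu _; rewrite !expr_div_n real_normK ?num_real//.
  rewrite (eq_bigr (fun nu => cabs (z nu) ^+ 2 *
      (cabs (fcoef u (mu - nu)) ^+ 2 * (zdot (mu - nu) (mu - nu))%:~R))).
    by apply: subG => nu; rewrite mulr_ge0 ?sqr_ge0// mulr_ge0 ?sqr_ge0 ?ler0z ?zdot_ge0.
  move=> nu _; rewrite !exprMn; congr (_ * (_ * _)).
  by apply: sqr_sqrtr; rewrite ler0z zdot_ge0.
- have -> : \sum_(nu <- G) cabs (z nu) * e nu * `|b nu| =
      \sum_(nu <- G) `|b nu| * (cabs (z nu) * e nu).
    by apply: eq_bigr => nu _; rewrite mulrC.
  apply: le_trans (sum_cauchy_schwarz _ _ _) _.
  have b1 : \sum_(nu <- G) `|b nu| ^+ 2 <= 1.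
    apply: le_trans bsum; rewrite le_eqVlt; apply/orP; left; apply/eqP.
    by apply: eq_bigr => nu _; rewrite real_normK ?num_real.
  rewrite -[leRHS]mul1r; apply: ler_pM => //; try by apply: sumr_ge0 => nu _; exact: sqr_ge0.
  rewrite (eq_bigr _ (fun nu _ => exprMn _ _ _)).
  by apply: subG => nu; rewrite mulr_ge0 ?sqr_ge0.
Qed.

Lemma tcontinuous_diffusion_sum u (L : {fset 'rV[int]_d}) (z : 'rV[int]_d -> R[i]) :
  dirC1 u -> tcontinuous (fun x => \sum_(nu <- L) z nu * diffusion u nu x).
Proof.
move=> du; apply: tcontinuous_sum => nu; apply: tcontinuousM.
  exact: tcontinuous_cst.
exact: tcontinuous_diffusion.
Qed.

(** [parseval_le] reduces the norm to finitely many rows. Minkowski separates the two parts of the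
    row bounds; after exchanging the sums, Bessel applies for each fixed [nu]. *)
Lemma diffusion_sum_bound u (L : {fset 'rV[int]_d}) (z : 'rV[int]_d -> R[i]) :
  dirC1 u -> fcoef u 0 = 0 -> 0 \notin L ->
  Num.sqrt (sqn (fun x => \sum_(nu <- L) z nu * diffusion u nu x)) <=
  (Num.sqrt #|` L|%:R / (2 * pi) * Num.sqrt (grad_sqn u) + Num.sqrt (sqn u)) *
  Num.sqrt (\sum_(nu <- L) cabs (z nu) ^+ 2).
Proof.
move=> du u0 L0; have [cu pu] := du; have gu := tcontinuous_cbounded cu.
set f := (fun x => _); set Z := \sum_(nu <- L) _.
have Z0 : 0 <= Z by apply: sumr_ge0 => nu _; exact: sqr_ge0.
have nz nu : nu \in L -> nu != 0 by apply: contraTneq => ->.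
have cf : tcontinuous f by exact: tcontinuous_diffusion_sum.
have fcE mu : fcoef f mu =
    \sum_(nu <- L) z nu * ((@kappa R d mu nu)%:C * fcoef u (mu - nu)).
  rewrite /fcoef inner_suml; [|move=> nu|exact: cbounded_fourier]; last first.
    exact/tcontinuous_cbounded/tcontinuous_diffusion.
  rewrite big_seq [RHS]big_seq; apply: eq_bigr => nu /nz nu0; congr (_ * _).
  by rewrite -[RHS]fcoef_diffusion.
have p0 : 0 < 2 * pi :> R by rewrite mulr_gt0 ?pi_gt0.
set a := Num.sqrt _ / _ * _; set b := Num.sqrt (sqn u).
have a0 : 0 <= a by rewrite mulr_ge0 ?divr_ge0 ?sqrtr_ge0// ltW.
have b0 : 0 <= b by exact: sqrtr_ge0.
have rhs0 : 0 <= (a + b) * Num.sqrt Z by rewrite mulr_ge0 ?addr_ge0 ?sqrtr_ge0.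
rewrite -(ger0_norm rhs0) -sqrtr_sqr ler_sqrt ?sqr_ge0//.
apply: parseval_le => // F uF.
have /choice[XY hXY] := fun mu => @row_bound u L z mu u0 L0.
apply: (@le_trans _ _ (\sum_(mu <- F) ((XY mu).1 + (XY mu).2) ^+ 2)).
  apply: ler_sum => mu _; have [x0 y0 h _ _] := hXY mu.
  by rewrite ler_pXn2r ?nnegrE ?cabs_ge0 ?addr_ge0// fcE.
(* For fixed [nu] the differences [mu - nu] are distinct frequencies, as Bessel requires. *)
have shiftF nu : uniq [seq mu - nu | mu <- F].
  by rewrite map_inj_uniq// => x y /addIr.
rewrite mulrDl; apply: sum_minkowski.
- by rewrite mulr_ge0 ?sqrtr_ge0.
- by rewrite mulr_ge0 ?sqrtr_ge0.
- apply: (@le_trans _ _ (\sum_(mu <- F) #|` L|%:R * \sum_(nu <- L) cabs (z nu) ^+ 2 *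
      (cabs (fcoef u (mu - nu)) ^+ 2 * (zdot (mu - nu) (mu - nu))%:~R))).
    by apply: ler_sum => mu _; have [] := hXY mu.
  rewrite -mulr_sumr exchange_big /=.
  have -> : (a * Num.sqrt Z) ^+ 2 = #|` L|%:R * (Z * (grad_sqn u / (2 * pi) ^+ 2)).
    rewrite /a; move: (2 * pi) => q; rewrite !exprMn exprVn !sqr_sqrtr ?ler0n ?grad_sqn_ge0//; ring.
  rewrite ler_wpM2l// /Z mulr_suml; apply: ler_sum => nu _.
  rewrite -mulr_sumr ler_wpM2l ?sqr_ge0//.
  rewrite -(big_map (fun mu => mu - nu) xpredT
    (fun tau => cabs (fcoef u tau) ^+ 2 * (zdot tau tau)%:~R)).
  exact: grad_bessel.
- apply: (@le_trans _ _ (\sum_(mu <- F) \sum_(nu <- L) cabs (z nu) ^+ 2 *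
      cabs (fcoef u (mu - nu)) ^+ 2)).
    by apply: ler_sum => mu _; have [] := hXY mu.
  rewrite exchange_big /=.
  have -> : (b * Num.sqrt Z) ^+ 2 = Z * sqn u.
    by rewrite exprMn !sqr_sqrtr ?sqn_ge0// mulrC.
  rewrite /Z mulr_suml; apply: ler_sum => nu _.
  rewrite -mulr_sumr ler_wpM2l ?sqr_ge0//.
  rewrite -(big_map (fun mu => mu - nu) xpredT (fun tau => cabs (fcoef u tau) ^+ 2)).
  exact: bessel.
Qed.

End DiffusionBound.

(** * The norms of the statement as integrals and essential bounds *)

Section Norms.
Context {R : realType} {d : nat}.
Implicit Types (u v : 'rV[R]_d -> R[i]) (l : 'I_d).
Local Notation mu := (@torus_measure R d).

Lemma eLp_norm2 u : cbounded u -> eLp_norm 2%:E u = (Num.sqrt (sqn u))%:E.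
Proof.
move=> gu; rewrite /eLp_norm unlock.
have -> : (\int[mu]_x (`| (EFin \o (fun x => cabs (u (torus_pt x)))) x | `^ 2)
    = (sqn u)%:E)%E.
  have h := integrable_fin_num measurableT (tbounded_integrable (tbounded_sq gu)).
  rewrite /sqn /tint /Rintegral fineK//; apply: eq_integral => x _ /=.
  by rewrite ger0_norm ?cabs_ge0// -powR_mulrn ?cabs_ge0.
by rewrite poweR_EFin -powR12_sqrt ?sqn_ge0.
Qed.

Lemma eLp_norm2_sqr u : cbounded u -> (eLp_norm 2%:E u ^+ 2 = (sqn u)%:E)%E.
Proof.
by move=> gu; rewrite eLp_norm2// -EFin_expe sqr_sqrtr ?sqn_ge0.
Qed.

Lemma L2_normE u : cbounded u -> L2_norm u = Num.sqrt (sqn u).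
Proof. by move=> gu; rewrite /L2_norm eLp_norm2. Qed.

Lemma cbounded_in_L2 u : cbounded u -> in_L2 u.
Proof.
by move=> gu; have [[mR _] [mI _]] := gu; split=> //; rewrite eLp_norm2// ltry.
Qed.

Lemma tint_sum I (r : seq I) (F : I -> 'rV[R]_d -> R) :
  (forall i, tbounded (F i)) ->
  tint (fun x => \sum_(i <- r) F i x) = \sum_(i <- r) tint (F i).
Proof.
move=> bF; suff [] : tbounded (fun x => \sum_(i <- r) F i x) /\
  tint (fun x => \sum_(i <- r) F i x) = \sum_(i <- r) tint (F i) by [].
elim: r => [|i r [bs ih]].
  rewrite big_nil; under eq_fun do rewrite big_nil.
  by split; [exact: tbounded_cst|exact: tint_cst].
rewrite big_cons -ih -tintD//; under eq_fun do rewrite big_cons.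
by split=> //; exact: tboundedD.
Qed.

Lemma H1_seminormE u : dirC1 u -> H1_seminorm u = Num.sqrt (grad_sqn u).
Proof.
move=> [cu du]; rewrite /H1_seminorm; congr Num.sqrt.
rewrite -[LHS]/(tint (fun x => \sum_l cabs (partial l u x) ^+ 2)) tint_sum//.
by move=> l; apply/tbounded_sq/tcontinuous_cbounded; have [] := du l.
Qed.

Lemma H1_norm_sqr u : dirC1 u -> H1_norm u ^+ 2 = sqn u + grad_sqn u.
Proof.
move=> du; have gu := tcontinuous_cbounded du.1.
rewrite /H1_norm sqr_sqrtr ?addr_ge0 ?sqr_ge0// H1_seminormE// L2_normE//.
by rewrite !sqr_sqrtr ?grad_sqn_ge0 ?sqn_ge0.
Qed.

Lemma torus_measure_gt0 : (0 < mu setT)%E.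
Proof. by rewrite [mu setT](@probability_setT _ _ _ mu). Qed.

(** [Linf_norm] is the real part of an essential supremum, so the latter must be shown finite: it is
    at least 0 because the torus has positive measure, and bounded above because [u] is. *)
Lemma Linf_norm_ae u : cbounded u ->
  \forall x \ae mu, cabs (u (torus_pt x)) <= Linf_norm u.
Proof.
move=> gu; rewrite /Linf_norm /eLp_norm unlock torus_measure_gt0.
set f := (_ \o _); have [[_ [M hM]] [_ [M' hM']]] := gu.
have fin : ess_sup mu f \is a fin_num.
  rewrite fin_numElt; apply/andP; split.
    apply: (@lt_le_trans _ _ 0%E); first exact: ltNyr.
    apply: ess_sup_gee; first exact: torus_measure_gt0.
    by apply: nearW => x; rewrite /f /= lee_fin.
  apply: (@le_lt_trans _ _ (M + M')%:E); last exact: ltry.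
  apply/ess_supP; apply: nearW => x; rewrite /f /= lee_fin.
  rewrite ger0_norm ?cabs_ge0//; apply: le_trans (cabs_le_ReIm _) _.
  exact: lerD.
have := ess_sup_ge mu f; apply: filterS => x.
by rewrite -{1}(fineK fin) /f /= lee_fin ger0_norm ?cabs_ge0//.
Qed.

Lemma eLp_norm_infty_le u (M : R) :
  (\forall x \ae mu, cabs (u (torus_pt x)) <= M) -> (eLp_norm +oo u <= M%:E)%E.
Proof.
move=> h; rewrite /eLp_norm unlock torus_measure_gt0; apply/ess_supP.
move: h; apply: (@filterS _ _ (ae_filter_ringOfSetsType mu)) => x; rewrite /= lee_fin ger0_norm ?cabs_ge0//.
Qed.

Lemma Linf_norm_ge0 u : 0 <= Linf_norm u.
Proof. exact/fine_ge0/Lnorm_ge0. Qed.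

End Norms.

(** * Trigonometric coefficients: the truncated part [a_t] *)

Section Truncation.
Context {R : realType} {d : nat}.
Implicit Types (u v : 'rV[R]_d -> R[i]) (nu tau : 'rV[int]_d) (l : 'I_d).

Lemma fourier0 (x : 'rV[R]_d) : fourier 0 x = 1.
Proof.
by rewrite /fourier /dotZ big1 ?mulr0 ?expi0// => i _; rewrite mxE mul0r.
Qed.

Lemma cabs_fourier nu (x : 'rV[R]_d) : cabs (fourier nu x) = 1.
Proof. exact: cabs_expi. Qed.

Lemma zlen_ge1 nu : nu != 0 -> 1 <= zlen nu :> R.
Proof.
move=> nu0; rewrite -sqrtr1 ler_sqrt ?ler1z ?ler0z ?zdot_ge0//.
by have := zdot_gt0 nu; rewrite nu0 => h; lia.
Qed.

Lemma zlen_sqr nu : zlen nu ^+ 2 = (zdot nu nu)%:~R :> R.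
Proof. by rewrite sqr_sqrtr// ler0z zdot_ge0. Qed.

Lemma kappa_shift tau nu : nu != 0 ->
  kappa (tau + nu) nu = 1 + (zdot tau nu)%:~R / (zdot nu nu)%:~R :> R.
Proof.
move=> nu0; rewrite /kappa zdotDl rmorphD mulrDl addrC divff//.
by rewrite intr_eq0 zdot_eq0.
Qed.

(** [|tau.nu| / |nu|^2 <= |tau| / |nu|], and a nonzero integer vector has length at least 1. *)
Lemma normr_kappa_shift tau nu : nu != 0 ->
  `|kappa (tau + nu) nu| <= 1 + zlen tau :> R.
Proof.
move=> nu0; rewrite kappa_shift//; apply: le_trans (ler_normD _ _) _.
rewrite normr1 lerD2l normrM normfV -zlen_sqr normrX.
have z1 := zlen_ge1 nu0; have z0 : 0 < zlen nu :> R by exact: lt_le_trans z1.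
rewrite (ger0_norm (ltW z0)) ler_pdivrMr ?exprn_gt0//.
have h : `|(zdot tau nu)%:~R| <= zlen tau * zlen nu :> R.
  rewrite -(@ler_pXn2r _ 2) ?nnegrE ?mulr_ge0 ?sqrtr_ge0//.
  rewrite exprMn !zlen_sqr real_normK ?num_real// -rmorphXn -rmorphM ler_int.
  exact: zdot_cauchy.
apply: le_trans h _; rewrite ler_wpM2l ?sqrtr_ge0// expr2.
by rewrite ler_peMl// ltW.
Qed.

Lemma diffusion_fourier tau nu (x : 'rV[R]_d) : nu != 0 ->
  diffusion (fourier tau) nu x = (kappa (tau + nu) nu)%:C * fourier (tau + nu) x.
Proof.
move=> nu0; rewrite diffusionE//; last exact: dirC1_fourier.
have n0 := @sqnormZ_neq0 R d nu nu0.
have p0 : pi != 0 :> R by rewrite gt_eqF ?pi_gt0.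
have E l : grad_coef nu l * (partial l (fourier tau) x * fourier nu x) =
    - ((tau 0 l)%:~R * (nu 0 l)%:~R / sqnormZ nu)%:C * fourier (tau + nu) x.
  rewrite partial_fourier fourierD -mulrA mulrA; congr (_ * _).
  apply/eqP; rewrite eq_complex /= !mul0r !mulr0 addr0 sub0r oppr0 eqxx andbT.
  by rewrite eqr_opp; apply/eqP; move: (@pi R) p0 => p p0; field; rewrite n0 p0.
under eq_bigr do rewrite E.
rewrite -mulr_suml sumrN -rmorph_sum /= -mulr_suml mulNr opprK -fourierD.
rewrite -{1}[fourier _ x]mul1r -mulrDl; congr (_ * _).
rewrite -[1]/(1%:C) -rmorphD kappa_shift// sqnormZE; congr ((_ + _ / _)%:C).
by rewrite /zdot rmorph_sum; apply: eq_bigr => l _; rewrite rmorphM.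
Qed.

Lemma diffusionD u v nu x : dirC1 u -> dirC1 v -> nu != 0 ->
  diffusion (fun y => u y + v y) nu x = diffusion u nu x + diffusion v nu x.
Proof.
move=> du dv nu0; rewrite !diffusionE//; last exact: dirC1D.
rewrite mulrDl addrACA -opprD -big_split /=; congr (_ - _).
apply: eq_bigr => l _; have [pu _] := du.2 l; have [pv _] := dv.2 l.
by rewrite partialD// mulrDl mulrDr.
Qed.

Lemma diffusionZ (c : R[i]) u nu x : dirC1 u -> nu != 0 ->
  diffusion (fun y => c * u y) nu x = c * diffusion u nu x.
Proof.
move=> du nu0; rewrite !diffusionE//; last exact: dirC1M (dirC1_cst c) du.
rewrite mulrBr mulrA mulr_sumr; congr (_ - _); apply: eq_bigr => l _.
have [pu _] := du.2 l; have pc := @pderivable_cst R d l c.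
by rewrite partialM// partial_cst mul0r add0r -!mulrA mulrCA.
Qed.

Lemma diffusion_trig (F : seq 'rV[int]_d) (c : 'rV[int]_d -> R[i]) nu x :
  nu != 0 -> diffusion (fun y => \sum_(tau <- F) c tau * fourier tau y) nu x =
  \sum_(tau <- F) c tau * ((kappa (tau + nu) nu)%:C * fourier (tau + nu) x).
Proof.
have dF tau : dirC1 (fun y : 'rV[R]_d => c tau * fourier tau y).
  by apply: dirC1M; [exact: dirC1_cst|exact: dirC1_fourier].
move=> nu0; elim: F => [|tau F ih].
  rewrite big_nil (_ : (fun y => _) = fun y => 0 * fourier 0 y); last first.
    by apply/funext => y; rewrite big_nil mul0r.
  by rewrite diffusionZ ?mul0r//; exact: dirC1_fourier.
rewrite big_cons -ih -diffusion_fourier// -diffusionZ//; last exact: dirC1_fourier.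
rewrite -(diffusionD x (dF tau) (dirC1_sum F dF) nu0).
rewrite (_ : (fun y => \sum_(j <- _ :: _) _) =
  fun y => c tau * fourier tau y + \sum_(j <- F) c j * fourier j y)//.
by apply/funext => y; rewrite big_cons.
Qed.

Lemma sqn_reverse_triangle u v : cbounded u -> cbounded v ->
  Num.sqrt (sqn u) <= Num.sqrt (sqn (fun x => u x + v x)) + Num.sqrt (sqn v).
Proof.
move=> gu gv; have := sqn_triangle (cboundedD gu gv) (cboundedZ (-1) gv).
rewrite sqnZ// cabsN -[1]/(1%:C) cabs_real normr1 expr1n mul1r.
by under [in X in X <= _]eq_fun do rewrite mulN1r addrK.
Qed.

Lemma sqn_sum_triangle (F : seq 'rV[int]_d) (c : 'rV[int]_d -> R) W :
  (forall tau, cbounded (W tau)) ->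
  (forall tau, tau \in F -> Num.sqrt (sqn (W tau)) <= c tau) ->
  Num.sqrt (sqn (fun x : 'rV[R]_d => \sum_(tau <- F) W tau x)) <=
  \sum_(tau <- F) c tau.
Proof.
move=> gW; elim: F => [|tau F ih] h.
  rewrite big_nil (_ : (fun x => _) = fun=> 0); last first.
    by apply/funext => x; rewrite big_nil.
  rewrite /sqn (_ : (fun x => _) = fun=> 0) ?tint_cst ?sqrtr0//.
  by apply/funext => x; rewrite cabs0 expr0n.
rewrite big_cons (_ : (fun x => _) = fun x => W tau x + \sum_(j <- F) W j x).
  apply: le_trans (sqn_triangle _ _) _; [by []|exact: cbounded_sum|].
  by apply: lerD; [apply: h; exact: mem_head|apply: ih => j jF; apply: h; rewrite in_cons jF orbT].
by apply/funext => x; rewrite big_cons.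
Qed.

End Truncation.

Section SparsePart.
Context {R : realType} {d : nat}.
Implicit Types (u v a : 'rV[R]_d -> R[i]) (nu tau : 'rV[int]_d) (l : 'I_d)
  (T L : {fset 'rV[int]_d}).

Lemma fourier_truncE a T : fourier_trunc a T =
  fun x => \sum_(nu <- 0 :: enum_fset T) fcoef a nu * fourier nu x.
Proof. by apply/funext => x; rewrite big_cons fourier0 mulr1. Qed.

Lemma dirC1_fourier_trunc a T : dirC1 (fourier_trunc a T).
Proof.
rewrite fourier_truncE; apply: dirC1_sum => nu.
by apply: dirC1M; [exact: dirC1_cst|exact: dirC1_fourier].
Qed.

Lemma fcoef_fourier_trunc a T nu : 0 \notin T -> nu \in 0 :: enum_fset T ->
  fcoef (fourier_trunc a T) nu = fcoef a nu.
Proof.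
by move=> T0 nuT; rewrite fourier_truncE fcoef_trig ?nuT//= T0 fset_uniq.
Qed.

(** Bessel for the truncation on [0] and [T], added to Bessel for its gradient on [T]. *)
Lemma fourier_trunc_energy a T : 0 \notin T ->
  cabs (fcoef a 0) ^+ 2 + \sum_(tau <- T) cabs (fcoef a tau) ^+ 2 *
    (1 + (2 * pi) ^+ 2 * (zdot tau tau)%:~R) <= H1_norm (fourier_trunc a T) ^+ 2.
Proof.
move=> T0; have dt := dirC1_fourier_trunc a T; rewrite H1_norm_sqr//.
have gt := tcontinuous_cbounded dt.1.
have uT : uniq (0 :: enum_fset T) by rewrite /= T0 fset_uniq.
have h1 := bessel gt uT; have h2 := grad_bessel dt (fset_uniq T).
have E tau : tau \in 0 :: enum_fset T ->
    cabs (fcoef (fourier_trunc a T) tau) = cabs (fcoef a tau).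
  by move=> h; rewrite fcoef_fourier_trunc.
rewrite (eq_big_seq (fun tau => cabs (fcoef a tau) ^+ 2)) in h1; last first.
  by move=> tau /E ->.
rewrite ler_pdivlMr ?exprn_gt0 ?mulr_gt0 ?pi_gt0// mulr_suml in h2.
rewrite (eq_big_seq (fun tau => cabs (fcoef a tau) ^+ 2 *
  ((2 * pi) ^+ 2 * (zdot tau tau)%:~R))) in h2; last first.
  by move=> tau tauT; rewrite E ?in_cons ?tauT ?orbT// mulrAC -mulrA.
apply: le_trans (lerD h1 h2); rewrite big_cons -addrA -big_split lerD2l.
by apply: ler_sum => tau _; rewrite mulrDr mulr1.
Qed.

(** The right side is beta. Cauchy-Schwarz against the constant 1 over at most [t] frequencies
    produces the factor [t]; the weights [1 + |tau|] are then compared with those of the [H^1]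
    norm. *)
Lemma sparse_weight_le a T (t : nat) : 0 \notin T -> (#|` T| <= t)%N ->
  \sum_(tau <- T) cabs (fcoef a tau) * (1 + zlen tau) <=
  Num.sqrt (t%:R * (H1_norm (fourier_trunc a T) ^+ 2 - cabs (fcoef a 0) ^+ 2)).
Proof.
move=> T0 tT; set S := \sum_(tau <- T) _.
have S0 : 0 <= S.
  by apply: sumr_ge0 => tau _; rewrite mulr_ge0 ?cabs_ge0 ?addr_ge0 ?sqrtr_ge0.
have energy := fourier_trunc_energy a T0; rewrite addrC -lerBrDr in energy.
set Q := \sum_(tau <- T) _ in energy.
have Q0 : 0 <= Q.
  apply: sumr_ge0 => tau _; rewrite mulr_ge0 ?sqr_ge0// addr_ge0// mulr_ge0//.
    exact: sqr_ge0.
  by rewrite ler0z zdot_ge0.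
rewrite -(ger0_norm S0) -sqrtr_sqr ler_sqrt; last first.
  by rewrite mulr_ge0//; apply: le_trans energy.
apply: (@le_trans _ _ (t%:R * Q)); last by rewrite ler_wpM2l.
have -> : S = \sum_(tau <- T) 1 * (cabs (fcoef a tau) * (1 + zlen tau)).
  by apply: eq_bigr => tau _; rewrite mul1r.
apply: le_trans (sum_cauchy_schwarz _ _ _) _.
apply: ler_pM; try by apply: sumr_ge0 => tau _; exact: sqr_ge0.
  under eq_bigr do rewrite expr1n.
  by rewrite big_const_seq count_predT iter_addr_0 ler_nat.
rewrite big_seq /Q [leRHS]big_seq; apply: ler_sum => tau tauT.
rewrite exprMn ler_wpM2l ?sqr_ge0//.
have tau0 : tau != 0 by apply: contraNneq T0 => <-.
have := @zlen_ge1 R d tau tau0; rewrite -(@zlen_sqr R d) => z1.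
have p2 := pi_ge2 R; move: (@pi R) (zlen tau) p2 z1 => p s p2 s1.
(* For [s >= 1], [(1 + s)^2 <= 1 + 3 s^2], and [pi >= 2] gives [(2 pi)^2 >= 16]. *)
have : 16 * s ^+ 2 <= (2 * p) ^+ 2 * s ^+ 2 by rewrite ler_wpM2r ?sqr_ge0//; nra.
by nra.
Qed.

Lemma sqn_shifted_trig (F : seq 'rV[int]_d) (c : 'rV[int]_d -> R[i]) tau : uniq F ->
  sqn (fun x : 'rV[R]_d => \sum_(nu <- F) c nu * fourier (tau + nu) x) =
  \sum_(nu <- F) cabs (c nu) ^+ 2.
Proof.
move=> uF; have uF' : uniq [seq tau + nu | nu <- F].
  by rewrite map_inj_uniq//; exact: addrI.
rewrite (eq_bigr (fun nu => cabs (c (tau + nu - tau)) ^+ 2)); last first.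
  by move=> nu _; rewrite [tau + nu]addrC addrK.
rewrite -(big_map (fun nu => tau + nu) xpredT (fun mu => cabs (c (mu - tau)) ^+ 2)).
rewrite -sqn_trig//; congr sqn; apply/funext => x; rewrite big_map.
by apply: eq_bigr => nu _; rewrite [tau + nu]addrC addrK addrC.
Qed.

(** Grouped by [tau], the sum consists of shifted exponential sums [V tau]. Frequency 0 contributes
    exactly [e_0] times the sum of the [z nu * fourier nu], since [kappa(nu, nu) = 1]; every other
    [V tau] has norm at most [(1 + |tau|) |z|]. *)
Lemma sparse_sum_bound a T L (z : 'rV[int]_d -> R[i]) : 0 \notin L ->
  let f := fun x => \sum_(nu <- L) z nu * diffusion (fourier_trunc a T) nu x in
  let Z := \sum_(nu <- L) cabs (z nu) ^+ 2 in
  let S := \sum_(tau <- T) cabs (fcoef a tau) * (1 + zlen tau) in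
  (cabs (fcoef a 0) - S) * Num.sqrt Z <= Num.sqrt (sqn f) /\
  Num.sqrt (sqn f) <= (cabs (fcoef a 0) + S) * Num.sqrt Z.
Proof.
move=> L0 f Z S; have uL := fset_uniq L.
have nz nu : nu \in L -> nu != 0 by apply: contraTneq => ->.
pose V tau (x : 'rV[R]_d) :=
  \sum_(nu <- L) (z nu * (kappa (tau + nu) nu)%:C) * fourier (tau + nu) x.
have gV tau : cbounded (V tau) by apply: cbounded_sum => nu; exact/cboundedZ/cbounded_fourier.
have normV tau : Num.sqrt (sqn (V tau)) <= (1 + zlen tau) * Num.sqrt Z.
  have s0 : 0 <= 1 + zlen tau :> R by rewrite addr_ge0 ?sqrtr_ge0.
  rewrite -(ger0_norm s0) -sqrtr_sqr -sqrtrM ?sqr_ge0// ler_sqrt; last first.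
    by rewrite mulr_ge0 ?sqr_ge0//; apply: sumr_ge0 => nu _; exact: sqr_ge0.
  rewrite sqn_shifted_trig// mulr_sumr big_seq [leRHS]big_seq.
  apply: ler_sum => nu /nz nu0; rewrite cabsM exprMn mulrC ler_wpM2r ?sqr_ge0//.
  rewrite cabs_real ler_pXn2r ?nnegrE//; exact: normr_kappa_shift.
pose w x := fcoef a 0 * \sum_(nu <- L) z nu * fourier nu x.
pose g x := \sum_(tau <- T) fcoef a tau * V tau x.
have gw : cbounded w by apply/cboundedZ/cbounded_sum => nu; exact/cboundedZ/cbounded_fourier.
have gg : cbounded g by apply: cbounded_sum => tau; exact: cboundedZ.
have fE : f = fun x => w x + g x.
  apply/funext => x; rewrite /f /g /w.
  transitivity (\sum_(nu <- L) \sum_(tau <- 0 :: enum_fset T) fcoef a tau *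
      (z nu * (kappa (tau + nu) nu)%:C * fourier (tau + nu) x)).
    rewrite big_seq [RHS]big_seq; apply: eq_bigr => nu /nz nu0.
    rewrite fourier_truncE diffusion_trig// mulr_sumr; apply: eq_bigr => tau _.
    by rewrite mulrCA -!mulrA.
  rewrite exchange_big big_cons /= -mulr_sumr; congr (_ * _ + _).
    rewrite big_seq [RHS]big_seq; apply: eq_bigr => nu /nz nu0.
    by rewrite add0r /kappa divff ?mulr1// intr_eq0 zdot_eq0.
  by apply: eq_bigr => tau _; rewrite -mulr_sumr.
have normw : Num.sqrt (sqn w) = cabs (fcoef a 0) * Num.sqrt Z.
  rewrite sqnZ; last by apply: cbounded_sum => nu; exact/cboundedZ/cbounded_fourier.
  by rewrite sqn_trig// sqrtrM ?sqr_ge0// sqrtr_sqr ger0_norm ?cabs_ge0.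
have normg : Num.sqrt (sqn g) <= S * Num.sqrt Z.
  rewrite mulr_suml; apply: sqn_sum_triangle => tau; first exact: cboundedZ.
  move=> _; rewrite sqnZ// sqrtrM ?sqr_ge0// sqrtr_sqr ger0_norm ?cabs_ge0//.
  by rewrite -mulrA ler_wpM2l ?cabs_ge0.
split; last first.
  by rewrite fE mulrDl -normw; apply: le_trans (sqn_triangle gw gg) _; rewrite lerD2l.
rewrite mulrBl -normw lerBlDr fE.
by apply: le_trans (sqn_reverse_triangle gw gg) _; rewrite lerD2l.
Qed.

Lemma cabs_diffusion_trunc a T nu x : nu != 0 ->
  cabs (diffusion (fourier_trunc a T) nu x) <=
  cabs (fcoef a 0) + \sum_(tau <- T) cabs (fcoef a tau) * (1 + zlen tau).
Proof.
move=> nu0; rewrite fourier_truncE diffusion_trig// big_cons.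
apply: le_trans (cabsD _ _) _; apply: lerD.
  rewrite add0r /kappa divff ?intr_eq0 ?zdot_eq0// !cabsM cabs_real normr1 mul1r.
  by rewrite cabs_fourier mulr1.
apply: le_trans (cabs_sum _ _ _) _; apply: ler_sum => tau _.
rewrite !cabsM cabs_fourier mulr1 cabs_real ler_wpM2l ?cabs_ge0//.
exact: normr_kappa_shift.
Qed.

Lemma cabs_grad_coef nu l : nu != 0 -> cabs (grad_coef nu l : R[i]) <= 1.
Proof.
move=> nu0; have z1 := @zlen_ge1 R d nu nu0.
have p2 := pi_ge2 R; rewrite /grad_coef cabs_imag sqnormZE -zlen_sqr.
have q0 : 0 < 2 * pi * zlen nu ^+ 2 :> R.
  by rewrite !mulr_gt0 ?exprn_gt0 ?pi_gt0//; apply: lt_le_trans z1.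
rewrite normrM normfV (gtr0_norm q0) ler_pdivrMr// mul1r.
apply: (@le_trans _ _ (zlen nu)); last by nra.
rewrite -(@ler_pXn2r _ 2) ?nnegrE ?sqrtr_ge0// zlen_sqr real_normK ?num_real//.
rewrite -sqnormZE /sqnormZ (bigD1 l)//= lerDl.
by apply: sumr_ge0 => i _; exact: sqr_ge0.
Qed.

Lemma cabs_diffusion_le u nu x : dirC1 u -> nu != 0 ->
  cabs (diffusion u nu x) <= cabs (u x) + \sum_l cabs (partial l u x).
Proof.
move=> du nu0; rewrite diffusionE//; apply: le_trans (cabsD _ _) _.
rewrite cabsM cabs_fourier mulr1 lerD2l cabsN.
apply: le_trans (cabs_sum _ _ _) _; apply: ler_sum => l _.
rewrite !cabsM cabs_fourier mulr1 -[leRHS]mul1r ler_wpM2r ?cabs_ge0//.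
exact: cabs_grad_coef.
Qed.

End SparsePart.

(** Here [c] is [|e_0|], [g] is gamma, [y] is [|z|], and [f], [v], [s] are the norms of the full sum
    and of its parts from [a_t] and [a^*]; [r] and [C] are the square roots in the two Riesz
    constants. *)
Lemma riesz_bounds_arith (R : realType) (c S beta r g C y f v s : R) :
  S <= beta -> r <= c - beta -> c + beta <= C -> g <= r ->
  0 <= c -> 0 <= g -> 0 <= beta -> 0 <= y -> 0 <= f ->
  (c - S) * y <= v -> v <= (c + S) * y -> v <= f + s -> f <= v + s -> s <= g * y ->
  (r - g) ^+ 2 * y ^+ 2 <= f ^+ 2 /\ f ^+ 2 <= (C + g) ^+ 2 * y ^+ 2.
Proof.
move=> Sb rc cC gr c0 g0 b0 y0 f0 vlo vhi lo hi sle.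
have h1 : r * y <= (c - S) * y by rewrite ler_wpM2r//; lra.
have h2 : (c + S) * y <= C * y by rewrite ler_wpM2r//; lra.
have low : (r - g) * y <= f by rewrite mulrBl; lra.
have high : f <= (C + g) * y by rewrite mulrDl; lra.
have p1 : 0 <= (r - g) * y by rewrite mulr_ge0 ?subr_ge0.
by rewrite -!exprMn !ler_pXn2r ?nnegrE// (le_trans f0).
Qed.

Theorem proposition2 (R : realType) (d t : nat) (a : 'rV[R]_d -> R[i])
    (amin : R) (T L : {fset 'rV[int]_d}) :
  let e0 := fcoef a 0 in
  let at_ := fourier_trunc a T in
  let astar := fun x => a x - at_ x in
  let N := #|` L| in
  let beta := Num.sqrt (t%:R * (H1_norm at_ ^+ 2 - cabs e0 ^+ 2)) in
  let gamma := Num.sqrt N%:R / (2 * pi) * H1_seminorm astar + L2_norm astar in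
  let r := Num.sqrt (cabs e0 ^+ 2 - 2 * cabs e0 * beta - beta ^+ 2) in
  let b := (r - gamma) ^+ 2 in
  let B := (Num.sqrt (H1_norm at_ ^+ 2 + 2 * cabs e0 * beta + beta ^+ 2)
            + gamma) ^+ 2 in
  let K := cabs e0 + beta + Linf_norm astar
           + \sum_(l < d) Linf_norm (partial l astar) in
  torusC1 a ->
  0 < amin -> (forall x, amin <= complex.Re (a x)) ->
  complex.Im e0 = 0 -> 0 <= complex.Re e0 ->
  0 \notin T -> (#|` T| <= t)%N ->
  0 \notin L ->
  beta < (Num.sqrt 2 - 1) * cabs e0 ->
  gamma < r ->
  0 < b /\ bounded_riesz_system L (diffusion a) b B K.
Proof.
move=> e0 at_ astar N beta gamma r b B K aC1 _ _ _ _ T0 tT L0 beta_lt gamma_lt.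
have da := torusC1_dirC1 aC1; have ga := tcontinuous_cbounded da.1.
have dt : dirC1 at_ := dirC1_fourier_trunc a T.
have dm : dirC1 (fun x => -1 * at_ x) by apply: dirC1M dt; exact: dirC1_cst.
have astarE : astar = fun x => a x + -1 * at_ x.
  by apply/funext => x; rewrite /astar mulN1r.
have ds : dirC1 astar by rewrite astarE; exact: dirC1D.
have gs := tcontinuous_cbounded ds.1.
have gt := tcontinuous_cbounded dt.1.
have aE : a = fun x => at_ x + astar x by apply/funext => x; rewrite /astar addrC subrK.
(* The truncation keeps the frequency 0, so [a^*] has mean 0, as the diagonal of the matrix
   requires. *)
have s0 : fcoef astar 0 = 0.
  have : fcoef a 0 = fcoef at_ 0 + fcoef astar 0 by rewrite -fcoefD// -aE.
  rewrite fcoef_fourier_trunc ?mem_head// -[LHS]addr0 => /addrI.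
  by move=> <-.
have nz nu : nu \in L -> nu != 0 by apply: contraTneq => ->.
pose E0 := cabs e0; have E0ge : 0 <= E0 by exact: cabs_ge0.
set S := \sum_(tau <- T) cabs (fcoef a tau) * (1 + zlen tau).
have Sbeta : S <= beta by exact: sparse_weight_le.
have beta0 : 0 <= beta by exact: sqrtr_ge0.
have sqrt2 : Num.sqrt 2 < 2 :> R.
  by rewrite -[ltRHS]ger0_norm// -sqrtr_sqr ltr_sqrt ?exprn_gt0//; lra.
have beta_E0 : beta < E0.
  apply: lt_le_trans beta_lt _; rewrite -[leRHS]mul1r ler_wpM2r//; lra.
have E0_gt : 0 < E0 by exact: le_lt_trans beta_E0.
have gammaE : gamma =
    Num.sqrt #|` L|%:R / (2 * pi) * Num.sqrt (grad_sqn astar) + Num.sqrt (sqn astar).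
  by rewrite /gamma H1_seminormE// L2_normE.
have gamma0 : 0 <= gamma.
  rewrite gammaE addr_ge0 ?sqrtr_ge0// mulr_ge0 ?sqrtr_ge0// divr_ge0 ?sqrtr_ge0//.
  by rewrite mulr_ge0 ?pi_ge0.
have H_E0 : E0 ^+ 2 <= H1_norm at_ ^+ 2.
  apply: le_trans (fourier_trunc_energy a T0); rewrite lerDl.
  apply: sumr_ge0 => tau _; rewrite mulr_ge0 ?sqr_ge0// addr_ge0// mulr_ge0 ?sqr_ge0//.
  by rewrite ler0z zdot_ge0.
pose Bs := Num.sqrt (H1_norm at_ ^+ 2 + 2 * cabs e0 * beta + beta ^+ 2).
have sq_le (h e c : R) : e ^+ 2 <= h -> (e + c) ^+ 2 <= h + 2 * e * c + c ^+ 2.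
  by move=> eh; nra.
have sq_ge (e c : R) : e ^+ 2 - 2 * e * c - c ^+ 2 <= (e - c) ^+ 2 by nra.
have Bs_ge : E0 + beta <= Bs.
  rewrite -[leLHS]ger0_norm ?addr_ge0// -sqrtr_sqr ler_sqrt.
    exact: sq_le.
  by rewrite !addr_ge0 ?sqr_ge0// !mulr_ge0.
(* The radicand of [r] is [(E0 - beta)^2 - 2 beta^2], and [E0 - beta] is positive. *)
have r_le : r <= E0 - beta.
  have h : 0 <= E0 - beta by rewrite subr_ge0 ltW.
  rewrite -[leRHS](ger0_norm h) -sqrtr_sqr ler_sqrt ?sqr_ge0//.
have b0 : 0 < b by rewrite exprn_gt0// subr_gt0.
split=> //; split; [split=> //| |].
- rewrite /b /B -/Bs ler_pXn2r ?nnegrE ?subr_ge0 ?(ltW gamma_lt) ?(addr_ge0 (sqrtr_ge0 _) gamma0)//.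
  have rB : r <= Bs by apply: le_trans r_le (le_trans _ Bs_ge); rewrite lerD2l ge0_cp.
  by rewrite lerD// (le_trans _ gamma0)// oppr_le0.
- move=> nu nuL; apply: cbounded_in_L2; exact/tcontinuous_cbounded/tcontinuous_diffusion.
- move=> z Z norm_f; pose f x := \sum_(nu <- L) z nu * diffusion a nu x.
  pose v x := \sum_(nu <- L) z nu * diffusion at_ nu x.
  pose s x := \sum_(nu <- L) z nu * diffusion astar nu x.
  have gf : cbounded f by exact/tcontinuous_cbounded/tcontinuous_diffusion_sum.
  have gv : cbounded v by exact/tcontinuous_cbounded/tcontinuous_diffusion_sum.
  have gw : cbounded s by exact/tcontinuous_cbounded/tcontinuous_diffusion_sum.
  have fE : f = fun x => v x + s x.
    apply/funext => x; rewrite /f /v /s -big_split /= big_seq [RHS]big_seq.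
    apply: eq_bigr => nu /nz nu0; rewrite -mulrDr; congr (_ * _).
    by rewrite {1}aE diffusionD.
  have Z0 : 0 <= Z by apply: sumr_ge0 => nu _; exact: sqr_ge0.
  have y0 : 0 <= Num.sqrt Z by exact: sqrtr_ge0.
  have f0 : 0 <= Num.sqrt (sqn f) by exact: sqrtr_ge0.
  have [vlo vhi] := sparse_sum_bound a T z L0.
  rewrite -/at_ -/v -/Z -/e0 -/E0 -/S in vlo vhi.
  have sle : Num.sqrt (sqn s) <= gamma * Num.sqrt Z.
    by rewrite gammaE; exact: diffusion_sum_bound.
  have hi : Num.sqrt (sqn f) <= Num.sqrt (sqn v) + Num.sqrt (sqn s).
    by rewrite fE; exact: sqn_triangle.
  have lo : Num.sqrt (sqn v) <= Num.sqrt (sqn f) + Num.sqrt (sqn s).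
    by rewrite fE; exact: sqn_reverse_triangle.
  have [low high] := riesz_bounds_arith Sbeta r_le Bs_ge (ltW gamma_lt) E0ge gamma0
    beta0 y0 f0 vlo vhi lo hi sle.
  rewrite /norm_f eLp_norm2_sqr//.
  by split; rewrite lee_fin -(sqr_sqrtr Z0) -(sqr_sqrtr (sqn_ge0 f)).
- by rewrite /K -/E0 -!addrA ltr_pwDl// !addr_ge0 ?Linf_norm_ge0// sumr_ge0// => l _; exact: Linf_norm_ge0.
- move=> nu nuL; have nu0 := nz _ nuL; apply: eLp_norm_infty_le.
  (* The essential bounds of [a^*] and of its [d] partial derivatives hold together outside one null
     set, on which the pointwise estimates are avoided. *)
  have F := ae_filter_ringOfSetsType (@torus_measure R d).
  have h1 := Linf_norm_ae gs.
  have h2 : \forall x \ae @torus_measure R d, forall l,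
      cabs (partial l astar (torus_pt x)) <= Linf_norm (partial l astar).
    apply: (@filter_forall _ _ _ _ F) => l; apply: Linf_norm_ae.
    by apply: tcontinuous_cbounded; have [] := ds.2 l.
  apply: (@filterS2 _ _ F _ _ _ _ h1 h2) => x x1 x2.
  rewrite {1}aE diffusionD//; apply: le_trans (cabsD _ _) _.
  rewrite /K -[leRHS]addrA; apply: lerD.
    by apply: le_trans (cabs_diffusion_trunc a T _ nu0) _; rewrite lerD2l.
  apply: le_trans (cabs_diffusion_le _ ds nu0) _; apply: lerD => //.
  exact: ler_sum.
Qed.
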